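(* Let $G_A$, $\xi_0\in\partial G_A$ and the metric $D$ on $\partial G_A\setminus\{\xi_0\}\cong\mathbb{R}^n$ be as in the context, and assume $r\ge 2$. Let $d$ be a visual metric on $\partial G_A$ and let $F:(\partial G_A,d)\to(\partial G_A,d)$ be a quasisymmetric homeomorphism. Then $F$ maps $\partial G_A\setminus\{\xi_0\}$ onto itself, and the restriction of $F$ to $\partial G_A\setminus\{\xi_0\}$ is bilipschitz with respect to $D$, i.e. there is $L\ge1$ with $D(x,y)/L\le D(F(x),F(y))\le L\,D(x,y)$ for all $x,y\in\partial G_A\setminus\{\xi_0\}$.
   Context: Let $r\ge1$, $n_1,\dots,n_r\ge 1$, $n=n_1+\dots+n_r$, and real numbers $0<\alpha_1<\alpha_2<\dots<\alpha_r$. Let $A=\mathrm{diag}(\alpha_1I_{n_1},\dots,\alpha_rI_{n_r})$ ($I_k$ the $k\times k$ identity). $G_A=\mathbb{R}^n\rtimes_A\mathbb{R}$ is $\mathbb{R}^n\times\mathbb{R}$ with product $(x,t)\cdot(y,s)=(x+e^{tA}y,\,t+s)$, equipped with the left-invariant Riemannian metric which is Euclidean at the identity; at $(x,t)$ it is given by the matrix $\begin{pmatrix}e^{-2tA}&0\\0&1\end{pmatrix}$. $G_A$ is simply connected with sectional curvature between $-\alpha_r^2$ and $-\alpha_1^2$, hence Gromov hyperbolic with ideal (Gromov) boundary $\partial G_A$. The vertical geodesics $\gamma_x(t)=(x,t)$, $x\in\mathbb{R}^n$, are all asymptotic as $t\to+\infty$ and define a point $\xi_0\in\partial G_A$; $\partial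 G_A\setminus\{\xi_0\}$ is identified with $\mathbb{R}^n$ by sending $x$ to the endpoint of $\gamma_x$ as $t\to-\infty$. Write $x\in\mathbb{R}^n$ as $x=(x_1,\dots,x_r)$, $x_i\in\mathbb{R}^{n_i}$, and define $D(x,y)=\max\{|x_1-y_1|,|x_2-y_2|^{\alpha_1/\alpha_2},\dots,|x_r-y_r|^{\alpha_1/\alpha_r}\}$ ($|\cdot|$ the Euclidean norm). For $p\in G_A$ and boundary points $\xi,\eta$, the Gromov product is $(\xi|\eta)_p=\frac12\sup\liminf_{i,j\to\infty}(d(p,x_i)+d(p,y_j)-d(x_i,y_j))$, the sup over sequences $x_i\to\xi$, $y_j\to\eta$. A visual metric on $\partial G_A$ is a metric $d$ such that for some $p\in G_A$ and some sufficiently small $\epsilon>0$, $\frac12e^{-\epsilon(\xi|\eta)_p}\le d(\xi,\eta)\le e^{-\epsilon(\xi|\eta)_p}$ for all $\xi,\eta\in\partial G_A$. A homeomorphism $f:X\to Y$ of metric spaces is $\eta$-quasisymmetric ($\eta:[0,\infty)\to[0,\infty)$ a homeomorphism) if $\frac{d(f(x),f(y))}{d(f(x),f(z))}\le\eta\big(\frac{d(x,y)}{d(x,z)}\big)$ for all distinct $x,y,z$; quasisymmetric means $\eta$-quasisymmetric for some $\eta$. *)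

(* Defs.v *)
From HB Require Import structures.
From mathcomp Require Import all_boot all_order all_algebra.
From mathcomp Require Import all_classical all_reals all_analysis.
Set Implicit Arguments. Unset Strict Implicit. Unset Printing Implicit Defensive.
Import Order.TTheory GRing.Theory Num.Theory.
Import numFieldNormedType.Exports.
Local Open Scope classical_set_scope.
Local Open Scope ring_scope.

(* Parameters: r blocks, block sizes ns i (i < r), exponents alpha i (i < r);
   alpha 0 is the paper's alpha_1.  A vector of R^n, n = sum_i ns i, is
   a family x i j (i < r, j < ns i): x_i = (x i j)_j is the block in R^{n_i}. *)
Definition vec (R : realType) (r : nat) (ns : nat -> nat) :=
  forall i : 'I_r, 'I_(ns i) -> R.

Definition pt (R : realType) (r : nat) (ns : nat -> nat) := (vec R r ns * R)%type.

Definition blocknorm (R : realType) (r : nat) (ns : nat -> nat)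
  (x y : vec R r ns) (i : 'I_r) : R :=
  Num.sqrt (\sum_(j < ns i) (x i j - y i j) ^+ 2).

Definition Dmet (R : realType) (r : nat) (ns : nat -> nat) (alpha : nat -> R)
  (x y : vec R r ns) : R :=
  \big[Order.max/0]_(i < r) powR (blocknorm x y i) (alpha 0%N / alpha i).

Definition C1 (R : realType) (f : R -> R) : Prop :=
  (forall u, derivable f u 1) /\ continuous (derive1 f).

(* Riemannian speed of a curve c for the metric diag(e^{-2tA}, 1) *)
Definition speed (R : realType) (r : nat) (ns : nat -> nat) (alpha : nat -> R)
  (c : R -> pt R r ns) (u : R) : R :=
  Num.sqrt (\sum_(i < r) \sum_(j < ns i)
              expR (- (2 * alpha i * (c u).2)) *
              (derive1 (fun v => (c v).1 i j) u) ^+ 2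
            + (derive1 (fun v => (c v).2) u) ^+ 2).

Definition curve_length (R : realType) (r : nat) (ns : nat -> nat) (alpha : nat -> R)
  (c : R -> pt R r ns) : R :=
  Rintegral (@lebesgue_measure R) `[0, 1] (speed alpha c).

Definition C1curve (R : realType) (r : nat) (ns : nat -> nat) (c : R -> pt R r ns) : Prop :=
  (forall i j, C1 (fun v => (c v).1 i j)) /\ C1 (fun v => (c v).2).

Definition dist (R : realType) (r : nat) (ns : nat -> nat) (alpha : nat -> R)
  (p q : pt R r ns) : R :=
  inf [set curve_length alpha c | c in
        [set c : R -> pt R r ns | C1curve c /\ c 0 = p /\ c 1 = q]].

Definition gprod (R : realType) (r : nat) (ns : nat -> nat) (alpha : nat -> R)
  (o x y : pt R r ns) : R :=
  (dist alpha o x + dist alpha o y - dist alpha x y) / 2.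

Definition origin (R : realType) (r : nat) (ns : nat -> nat) : pt R r ns :=
  ((fun i j => 0), 0).

Definition conv_inf (R : realType) (r : nat) (ns : nat -> nat) (alpha : nat -> R)
  (s : nat -> pt R r ns) : Prop :=
  forall M : R, exists N, forall i j, (N <= i)%N -> (N <= j)%N ->
    M <= gprod alpha (origin R r ns) (s i) (s j).

Definition seq_equiv (R : realType) (r : nat) (ns : nat -> nat) (alpha : nat -> R)
  (s u : nat -> pt R r ns) : Prop :=
  forall M : R, exists N, forall i j, (N <= i)%N -> (N <= j)%N ->
    M <= gprod alpha (origin R r ns) (s i) (u j).

Definition bnd (R : realType) (r : nat) (ns : nat -> nat) (alpha : nat -> R) :=
  { S : set (nat -> pt R r ns) | exists s, conv_inf alpha s /\
      S = [set u | conv_inf alpha u /\ seq_equiv alpha s u] }.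
Arguments bnd : clear implicits.

Definition seq_to (R : realType) (r : nat) (ns : nat -> nat) (alpha : nat -> R)
  (s : nat -> pt R r ns) (xi : bnd R r ns alpha) : Prop := proj1_sig xi s.

Definition liminf2 (R : realType) (a : nat -> nat -> R) : \bar R :=
  ereal_sup [set ereal_inf [set y : \bar R | exists i j, (N <= i)%N /\ (N <= j)%N /\
                                 y = (a i j)%:E] | N in [set: nat]].

Definition bgprod (R : realType) (r : nat) (ns : nat -> nat) (alpha : nat -> R)
  (p : pt R r ns) (xi eta : bnd R r ns alpha) : \bar R :=
  ereal_sup [set y : \bar R | exists s u, seq_to s xi /\ seq_to u eta /\
               y = liminf2 (fun i j => gprod alpha p (s i) (u j))].

Arguments bgprod {R r ns} alpha p xi eta.

Definition expN (R : realType) (eps : R) (g : \bar R) : R :=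
  match g with
  | x%:E => expR (- (eps * x))
  | +oo%E => 0
  | -oo%E => 0 (* never used: Gromov products of boundary points are >= 0 *)
  end.

Definition is_metric (T : Type) (R : realType) (d : T -> T -> R) : Prop :=
  (forall x y, 0 <= d x y) /\ (forall x y, d x y = 0 <-> x = y) /\
  (forall x y, d x y = d y x) /\ (forall x y z, d x z <= d x y + d y z).

Definition visual_metric (R : realType) (r : nat) (ns : nat -> nat) (alpha : nat -> R)
  (d : bnd R r ns alpha -> bnd R r ns alpha -> R) : Prop :=
  is_metric d /\ exists (p : pt R r ns) (eps : R), 0 < eps /\
    forall xi eta, expN eps (bgprod alpha p xi eta) / 2 <= d xi eta /\
                   d xi eta <= expN eps (bgprod alpha p xi eta).

Definition mcont (T : Type) (R : realType) (d : T -> T -> R) (f : T -> T) : Prop :=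
  forall x (e : R), 0 < e -> exists2 delta : R, 0 < delta &
    forall y, d x y < delta -> d (f x) (f y) < e.

Definition homeo (T : Type) (R : realType) (d : T -> T -> R) (f : T -> T) : Prop :=
  exists g : T -> T, cancel f g /\ cancel g f /\ mcont d f /\ mcont d g.

(* eta : [0,oo) -> [0,oo) homeomorphism (increasing, continuous, eta 0 = 0, onto) *)
Definition qs_control (R : realType) (eta : R -> R) : Prop :=
  eta 0 = 0 /\ {in `[0, +oo[%classic &, forall s t, s < t -> eta s < eta t} /\
  {within `[0, +oo[%classic, continuous eta} /\
  (forall y, 0 <= y -> exists2 t, 0 <= t & eta t = y).

Definition quasisymmetric (T : Type) (R : realType) (d : T -> T -> R) (f : T -> T) : Prop :=
  exists eta : R -> R, qs_control eta /\
    forall x y z, x <> y -> x <> z -> y <> z ->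
      d (f x) (f y) / d (f x) (f z) <= eta (d x y / d x z).

(* xi0: the common endpoint of the vertical geodesics as t -> +oo *)
Definition is_xi0 (R : realType) (r : nat) (ns : nat -> nat) (alpha : nat -> R)
  (xi : bnd R r ns alpha) : Prop :=
  seq_to (fun k : nat => ((fun i j => 0) : vec R r ns, (k%:R : R))) xi.

(* the boundary point identified with x in R^n: endpoint of gamma_x as t -> -oo *)
Definition ident (R : realType) (r : nat) (ns : nat -> nat) (alpha : nat -> R)
  (x : vec R r ns) (xi : bnd R r ns alpha) : Prop :=
  seq_to (fun k : nat => (x, - (k%:R : R))) xi.

(* Main.v *)
(* Every curve from (x, t) to (y, s) climbs to height about
   max(t, s, log D(x, y) / alpha_1): the vertical-horizontal-vertical path shows that this
   suffices, and the Busemann functions of the hyperbolic planes spanned by t and one block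
   show that it is necessary. Hence the Gromov boundary is R^n together with xi_0, and a
   visual metric is comparable to a power of the chordal version
   D(x, y) / (max(1, |x|) max(1, |y|)) of D.

   A quasisymmetric F maps every leaf (coset of the first block) that avoids F^-1(xi_0) into
   a leaf. Indeed, suppose that the ends of a segment in a leaf go to points that differ in
   the i-th block, i > 1, and put beta = alpha_i / alpha_1 > 1. Fill a tube around the
   segment with a D-grid of mesh rho, and let d be the D-distance of the images of two
   consecutive grid points. The sum of d^beta along each of the parallel chains is bounded
   below. But quasisymmetry makes the balls of radius comparable to d about the images
   disjoint, so that the sum of d^Q over the grid is bounded by a volume, Q being the
   homogeneous dimension; as 1 < beta <= Q, the first sums are O(rho^(beta - 1)).

   If F moved xi_0, all leaves that avoid F^-1(xi_0) would go into the single leaf of F(xi_0),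
   which is absurd. So F fixes xi_0, is quasi-Mobius, hence quasisymmetric for D, and permutes
   the leaves. Two leaves are at the same distance from one another at all of their points;
   so at each scale the stretch of F is constant along a leaf up to a factor. Cutting a
   segment of a leaf into k pieces, for F and for F^-1, shows that the stretch at scale k s is
   comparable to k times the stretch at scale s. Thus the stretch is comparable to a constant,
   the same for all leaves since nearby points have comparable stretch at large scales. *)

Require Import Defs.
From HB Require Import structures.
From mathcomp Require Import all_boot all_order all_algebra.
From mathcomp Require Import all_classical all_reals all_analysis.
From mathcomp Require Import ring lra.
Import Order.TTheory GRing.Theory Num.Theory.
Import numFieldNormedType.Exports.
Local Open Scope classical_set_scope.
Local Open Scope ring_scope.

Set Implicit Arguments.
Unset Strict Implicit.
Unset Printing Implicit Defensive.

(** * The metric D *)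

Section Euclid.
Variables (R : realType) (I : finType).
Implicit Types a b : I -> R.

Lemma Cauchy_Schwarz_sqrt a b :
  \sum_i a i * b i <= Num.sqrt (\sum_i a i ^+ 2) * Num.sqrt (\sum_i b i ^+ 2).
Proof.
set A := \sum_i a i ^+ 2; set B := \sum_i b i ^+ 2.
have A0 : 0 <= A by apply: sumr_ge0 => i _; exact: sqr_ge0.
have B0 : 0 <= B by apply: sumr_ge0 => i _; exact: sqr_ge0.
have zero (c c' : I -> R) : \sum_i c i ^+ 2 = 0 -> \sum_i c i * c' i = 0.
  move=> h; apply: big1 => i _.
  have := psumr_eq0P (fun i _ => sqr_ge0 (c i)) h isT => /(_ i)/eqP.
  by rewrite sqrf_eq0 => /eqP->; rewrite mul0r.
have [A00|A1] := eqVneq A 0.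
  by rewrite zero // mulr_ge0 ?sqrtr_ge0.
have [B00|B1] := eqVneq B 0.
  under eq_bigr do rewrite mulrC.
  by rewrite zero // mulr_ge0 ?sqrtr_ge0.
set p := Num.sqrt A; set q := Num.sqrt B.
have p0 : 0 < p by rewrite sqrtr_gt0 lt0r A1.
have q0 : 0 < q by rewrite sqrtr_gt0 lt0r B1.
have pE : p ^+ 2 = A by rewrite sqr_sqrtr.
have qE : q ^+ 2 = B by rewrite sqr_sqrtr.
have step i : a i * b i <= p * q / 2 * ((a i / p) ^+ 2 + (b i / q) ^+ 2).
  have -> : a i * b i = p * q * ((a i / p) * (b i / q)).
    by field; rewrite !gt_eqF.
  rewrite -[X in _ <= X]mulrA ler_pM2l; last exact: mulr_gt0.
  have := sqr_ge0 (a i / p - b i / q); nra.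
apply: (le_trans (ler_sum _ (fun i _ => step i))).
rewrite -mulr_sumr big_split /=.
under eq_bigr do rewrite exprMn.
under [X in _ * (_ + X)]eq_bigr do rewrite exprMn.
rewrite -!mulr_suml -/A -/B -pE -qE !exprVn !divff ?expf_neq0 ?gt_eqF //.
by lra.
Qed.

Lemma sqrt_sum_sqr_triangle a b :
  Num.sqrt (\sum_i (a i + b i) ^+ 2) <=
  Num.sqrt (\sum_i a i ^+ 2) + Num.sqrt (\sum_i b i ^+ 2).
Proof.
set p := Num.sqrt (\sum_i a i ^+ 2); set q := Num.sqrt (\sum_i b i ^+ 2).
have pq0 : 0 <= p + q by rewrite addr_ge0 ?sqrtr_ge0.
rewrite -(ger0_norm pq0) -sqrtr_sqr ler_wsqrtr // sqrrD !sqr_sqrtr;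
  try by apply: sumr_ge0 => i _; exact: sqr_ge0.
under eq_bigr do rewrite sqrrD.
rewrite !big_split /= lerD2r lerD2l.
by rewrite mulr2n lerD ?Cauchy_Schwarz_sqrt.
Qed.

Lemma le_sqrt_sum_sqr a i : `|a i| <= Num.sqrt (\sum_i a i ^+ 2).
Proof.
rewrite -sqrtr_sqr ler_wsqrtr // (bigD1 i) //= lerDl.
by apply: sumr_ge0 => j _; exact: sqr_ge0.
Qed.

Lemma sqrt_sum_sqr_le a : Num.sqrt (\sum_i a i ^+ 2) <= \sum_i `|a i|.
Proof.
have a0 : 0 <= \sum_i `|a i| by apply: sumr_ge0.
rewrite -(ger0_norm a0) -sqrtr_sqr ler_wsqrtr // [leRHS]expr2 mulr_suml.
apply: ler_sum => i _; rewrite -real_normK ?num_real // expr2 ler_wpM2l //.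
rewrite (bigD1 i) //= lerDl; exact: sumr_ge0.
Qed.

End Euclid.

(** * Real powers *)

Section PowR.
Variable R : realType.
Implicit Types a b s c : R.

(** For x = a and x = b the quotient x / (a + b) lies in (0, 1], so raising it to a power s <= 1
    does not decrease it; the two bounds add up. *)
Lemma powR_subadd a b s : 0 <= a -> 0 <= b -> 0 < s <= 1 ->
  (a + b) `^ s <= a `^ s + b `^ s.
Proof.
move=> a0 b0 /andP[s0 s1].
have [->|an0] := eqVneq a 0; first by rewrite add0r lerDr powR_ge0.
have [->|bn0] := eqVneq b 0; first by rewrite addr0 lerDl powR_ge0.
have ap : 0 < a by rewrite lt0r an0.
have bp : 0 < b by rewrite lt0r bn0.
have cp : 0 < a + b by rewrite addr_gt0.
have key x : 0 < x -> x <= a + b -> x / (a + b) * (a + b) `^ s <= x `^ s.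
  move=> x0 xc.
  have xE : x = x / (a + b) * (a + b) by rewrite divfK // gt_eqF.
  rewrite [X in _ <= X `^ _]xE.
  rewrite powRM ?divr_ge0 ?(ltW x0) ?(ltW cp) // ler_wpM2r ?powR_ge0 //.
  by apply: ger1_powR => //; rewrite divr_gt0 //= ler_pdivrMr // mul1r.
have := lerD (key a ap _) (key b bp _).
rewrite -mulrDl -mulrDl divff ?gt_eqF // mul1r => -> //; lra.
Qed.

Lemma powRK a s : 0 <= a -> s != 0 -> (a `^ s) `^ s^-1 = a.
Proof. by move=> a0 s0; rewrite -powRrM divff // powRr1. Qed.

Lemma powRVK a s : 0 <= a -> s != 0 -> (a `^ s^-1) `^ s = a.
Proof. by move=> a0 s0; rewrite -powRrM mulVf // powRr1. Qed.

Lemma powR_le a b s : 0 <= s -> 0 <= a -> a <= b -> a `^ s <= b `^ s.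
Proof.
move=> s0 a0 ab; apply: ge0_ler_powR => //; rewrite nnegrE //.
exact: le_trans ab.
Qed.

Lemma powR_lt a b s : 0 < s -> 0 <= a -> a < b -> a `^ s < b `^ s.
Proof.
move=> s0 a0 ab; apply: gt0_ltr_powR => //; rewrite nnegrE //.
exact: le_trans (ltW ab).
Qed.

End PowR.

(** A class, so that the standing hypotheses are passed implicitly. *)
Class block_data (R : realType) (r : nat) (ns : nat -> nat) (alpha : nat -> R)
    : Prop := BlockData {
  blocks_ge2 : (2 <= r)%N;
  block_gt0 : forall i : nat, (i < r)%N -> (0 < ns i)%N;
  alpha0_gt0 : 0 < alpha 0%N;
  alpha_step : forall i : nat, (i.+1 < r)%N -> alpha i < alpha i.+1 }.

(** * Metric axioms and balls of D *)

Section Dmet.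
Context {R : realType} {r : nat} {ns : nat -> nat} {alpha : nat -> R}
        {hyp : block_data r ns alpha}.
Let hr : (2 <= r)%N := @blocks_ge2 _ _ _ _ hyp.
Let hns := @block_gt0 _ _ _ _ hyp.
Let ha0 := @alpha0_gt0 _ _ _ _ hyp.
Let hinc := @alpha_step _ _ _ _ hyp.

Local Notation V := (vec R r ns).
Local Notation D := (@Dmet R r ns alpha).
Implicit Types x y z : V.

Lemma alpha_lt i : (0 < i < r)%N -> alpha 0%N < alpha i.
Proof.
elim: i => // -[_ /andP[_ h]|i IH /andP[_ h]]; first exact: hinc.
by apply: lt_trans (hinc h); apply: IH => /=; exact: ltnW.
Qed.

Lemma alpha_le (i : 'I_r) : alpha 0%N <= alpha i.
Proof.
case: i => -[|i] h //=; apply/ltW/alpha_lt => //.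
Qed.

Lemma alpha_gt0 (i : 'I_r) : 0 < alpha i.
Proof. exact: lt_le_trans (alpha_le i). Qed.

(** The degree of homogeneity of block [i]: a D-ball of radius s is the product of Euclidean balls
    of radii s^[weight alpha i]. *)
Definition weight (alpha : nat -> R) (i : nat) : R := alpha i / alpha 0%N.

Lemma weight0 : weight alpha 0 = 1.
Proof. by rewrite /weight divff // gt_eqF. Qed.

Lemma weight_gt0 (i : 'I_r) : 0 < weight alpha i.
Proof. by rewrite divr_gt0 ?alpha_gt0. Qed.

Lemma weight_ge0 (i : 'I_r) : 0 <= weight alpha i.
Proof. exact/ltW/weight_gt0. Qed.

Lemma weight_neq0 (i : 'I_r) : weight alpha i != 0.
Proof. by rewrite gt_eqF ?weight_gt0. Qed.

Lemma weight_gt1 i : (0 < i < r)%N -> 1 < weight alpha i.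
Proof. by move=> h; rewrite ltr_pdivlMr // mul1r alpha_lt. Qed.

Lemma weightV (i : 'I_r) : alpha 0%N / alpha i = (weight alpha i)^-1.
Proof. by rewrite /weight invfM invrK mulrC. Qed.

Lemma blocknorm_ge0 x y i : 0 <= blocknorm x y i.
Proof. exact: sqrtr_ge0. Qed.

Lemma blocknormC x y i : blocknorm x y i = blocknorm y x i.
Proof. by congr Num.sqrt; apply: eq_bigr => j _; rewrite -sqrrN opprB. Qed.

Lemma blocknorm_triangle y x z i :
  blocknorm x z i <= blocknorm x y i + blocknorm y z i.
Proof.
have := sqrt_sum_sqr_triangle (fun j => x i j - y i j) (fun j => y i j - z i j).
by under eq_bigr do rewrite addrA subrK.
Qed.

Lemma coord_le_blocknorm x y i j : `|x i j - y i j| <= blocknorm x y i.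
Proof. exact: (le_sqrt_sum_sqr (fun j => x i j - y i j)). Qed.

Lemma blocknorm_le_sum x y i : blocknorm x y i <= \sum_j `|x i j - y i j|.
Proof. exact: sqrt_sum_sqr_le. Qed.

Lemma Dmet_ge0 x y : 0 <= D x y.
Proof.
rewrite /Dmet; elim/big_ind: _ => //; last by move=> i _; exact: powR_ge0.
by move=> a b a0 b0; rewrite le_max a0.
Qed.

Lemma DmetC x y : D x y = D y x.
Proof. by apply: eq_bigr => i _; rewrite blocknormC. Qed.

Lemma Dmet_le x y s : 0 <= s ->
  (forall i, blocknorm x y i <= s `^ weight alpha i) -> D x y <= s.
Proof.
move=> s0 h; apply: bigmax_le => // i _; rewrite weightV.
rewrite -[leRHS](@powRK _ s (weight alpha i)) // ?weight_neq0 //.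
by apply: powR_le; rewrite ?invr_ge0 ?weight_ge0 ?blocknorm_ge0.
Qed.

Lemma blocknorm_le_Dmet x y i : blocknorm x y i <= D x y `^ weight alpha i.
Proof.
rewrite -[leLHS](@powRVK _ _ (weight alpha i)) ?blocknorm_ge0 ?weight_neq0 //.
apply: powR_le; rewrite ?powR_ge0 ?weight_ge0 //.
by rewrite -weightV; exact: (@le_bigmax _ _ _ 0 (fun i : 'I_r => blocknorm x y i `^ (alpha 0%N / alpha i)) i).
Qed.

Lemma blocknorm_le_of_Dmet x y i s : D x y <= s -> blocknorm x y i <= s `^ weight alpha i.
Proof.
move=> h; apply: le_trans (blocknorm_le_Dmet _ _ _) _.
by apply: powR_le; rewrite ?Dmet_ge0 ?weight_ge0.
Qed.

Lemma coord_le_Dmet x y i j : `|x i j - y i j| <= D x y `^ weight alpha i.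
Proof. exact: le_trans (coord_le_blocknorm _ _ _) (blocknorm_le_Dmet _ _ _). Qed.

Lemma Dmet_attained x y : exists i : 'I_r, D x y `^ weight alpha i = blocknorm x y i.
Proof.
have r0 : (0 < r)%N by exact: ltnW.
pose F (i : 'I_r) := blocknorm x y i `^ (alpha 0%N / alpha i).
have [|i _ E] := @eq_bigmax _ _ _ 0 (Ordinal r0) xpredT F isT.
  by move=> i _; exact: powR_ge0.
exists i; rewrite /Dmet E /F weightV powRVK ?blocknorm_ge0 ?weight_neq0 //.
Qed.

(** In the block that attains D x z, the Euclidean triangle inequality is followed by subadditivity
    of the power 1 / weight <= 1. *)
Lemma Dmet_triangle y x z : D x z <= D x y + D y z.
Proof.
have [i Ei] := Dmet_attained x z.
have wi := weight_gt0 i.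
rewrite -[leLHS](@powRK _ _ (weight alpha i)) ?Dmet_ge0 ?gt_eqF // Ei.
apply: le_trans (powR_le _ _ (blocknorm_triangle y x z i)) _;
  rewrite ?invr_ge0 ?(ltW wi) ?blocknorm_ge0 //.
have w1 : 0 < (weight alpha i)^-1 <= 1.
  by rewrite invr_gt0 wi /= -weightV ler_pdivrMr ?alpha_gt0 // mul1r alpha_le.
apply: le_trans (powR_subadd _ _ w1) _; rewrite ?blocknorm_ge0 //.
by apply: lerD; rewrite -[leRHS](@powRK _ _ (weight alpha i)) ?Dmet_ge0 ?gt_eqF //;
  apply: powR_le; rewrite ?invr_ge0 ?(ltW wi) ?blocknorm_ge0 ?blocknorm_le_Dmet.
Qed.

Lemma Dmet_refl x : D x x = 0.
Proof.
apply/eqP; rewrite eq_le Dmet_ge0 andbT; apply: Dmet_le => // i.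
rewrite powR0 ?weight_neq0 //.
by apply: le_trans (blocknorm_le_sum _ _ _) _; rewrite big1 // => j _; rewrite subrr normr0.
Qed.

Lemma Dmet_eq0 x y : D x y = 0 -> x = y.
Proof.
move=> h; apply/functional_extensionality_dep => i; apply/funext => j.
have := coord_le_Dmet x y j; rewrite h powR0 ?weight_neq0 //.
by rewrite normr_le0 subr_eq0 => /eqP.
Qed.

Lemma Dmet_gt0 x y : x <> y -> 0 < D x y.
Proof. by move=> h; rewrite lt0r Dmet_ge0 andbT; apply/eqP => /Dmet_eq0. Qed.

(** All n coordinates as one finite type, so that boxes, lattices and volumes are indexed by a
    single variable. *)
Definition idx (r : nat) (ns : nat -> nat) := {i : 'I_r & 'I_(ns i)}.
Definition dimn (r : nat) (ns : nat -> nat) : nat := #|{: idx r ns}|.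

Lemma ns_le_dimn (i : 'I_r) : (ns i <= dimn r ns)%N.
Proof.
rewrite -{1}(card_ord (ns i)) /dimn.
have /card_codom <- : injective (fun j : 'I_(ns i) => Tagged (fun i : 'I_r => 'I_(ns i)) j).
  by move=> j k /eqP; rewrite -tag_eqE /tag_eq eqxx tagged_asE => /eqP.
exact: max_card.
Qed.

Lemma dimn_gt0 : (0 < dimn r ns)%N.
Proof.
have r0 : (0 < r)%N by exact: leq_trans hr.
by apply: leq_trans (ns_le_dimn (Ordinal r0)); exact: hns.
Qed.

(** The Euclidean norm of a block is at most the sum of its absolute coordinates; dividing by n
    rather than by the size of the block makes the bound uniform. *)
Lemma Dmet_le_coord x y s : 0 <= s ->
  (forall i j, `|x i j - y i j| <= s `^ weight alpha i / (dimn r ns)%:R) -> D x y <= s.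
Proof.
move=> s0 h; apply: Dmet_le => // i; apply: le_trans (blocknorm_le_sum _ _ _) _.
apply: le_trans (ler_sum _ (fun j _ => h i j)) _.
rewrite sumr_const card_ord -[_ *+ ns i]mulr_natr -mulrA ler_piMr ?powR_ge0 //.
by rewrite mulrC ler_pdivrMr ?ltr0n ?dimn_gt0 // mul1r ler_nat ns_le_dimn.
Qed.

Lemma exists_coord_ge x y s : 0 <= s -> s < D x y ->
  exists (i : 'I_r) (j : 'I_(ns i)), s `^ weight alpha i / (dimn r ns)%:R < `|x i j - y i j|.
Proof.
move=> s0 h; apply: contrapT => H; move: h; apply/negP; rewrite -leNgt.
apply: Dmet_le_coord => // i j; rewrite leNgt; apply/negP => h.
by apply: H; exists i, j.
Qed.

Definition same_leaf x y := forall i : 'I_r, (0 < i)%N -> x i = y i.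

(** Natural numbers as indices allow [shift 0 b] without bound proofs; an index out of range gives
    the identity. *)
Definition shift (a b : nat) (t : R) x : V :=
  fun i j => x i j + (if ((i : nat) == a) && ((j : nat) == b) then t else 0).

Arguments shift : clear implicits.

Lemma Dmet_shift (a : 'I_r) b t x : (b < ns a)%N ->
  D x (shift a b t x) = `|t| `^ (weight alpha a)^-1.
Proof.
move=> bn.
have E i j : x i j - shift a b t x i j =
    - (if ((i : nat) == a) && ((j : nat) == b) then t else 0).
  by rewrite /shift opprD addrA subrr add0r.
have bnE : blocknorm x (shift a b t x) a = `|t|.
  rewrite /blocknorm (bigD1 (Ordinal bn)) //= E !eqxx /= sqrrN big1 ?addr0 ?sqrtr_sqr //.
  move=> j jb; rewrite E eqxx /=; case: eqP => [e|_]; last by rewrite oppr0 expr0n.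
  by case/eqP: jb; apply: val_inj.
apply/eqP; rewrite eq_le; apply/andP; split.
  apply: Dmet_le => [|i]; first exact: powR_ge0.
  have [->|ia] := eqVneq i a.
    by rewrite powRVK ?bnE ?weight_neq0.
  apply: le_trans (blocknorm_le_sum _ _ _) _; rewrite big1 ?powR_ge0 // => j _.
  by move: ia; rewrite E -val_eqE /= => /negbTE->; rewrite oppr0 normr0.
rewrite -bnE -weightV.
exact: (@le_bigmax _ _ _ 0 (fun i : 'I_r => blocknorm x (shift a b t x) i `^ (alpha 0%N / alpha i)) a).
Qed.

End Dmet.
Arguments shift {R r ns} a b t x i j.

(** * The Riemannian distance *)

Section Derivatives.
Variable R : realType.
Implicit Types (f g : R -> R) (u a : R).

Lemma C1_is_derive f u : C1 f -> is_derive u 1 f (derive1 f u).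
Proof. by move=> [df _]; rewrite derive1E; apply: derivableP. Qed.

Lemma is_derive_derive1 f u a : is_derive u 1 f a -> derive1 f u = a.
Proof. by move=> h; rewrite derive1E; exact: derive_val. Qed.

Lemma is_derive_continuous f (f' : R -> R) :
  (forall u, is_derive u 1 f (f' u)) -> continuous f.
Proof.
move=> h u; apply: differentiable_continuous; apply/derivable1_diffP.
exact: ex_derive.
Qed.

Lemma C1_of_is_derive f (f' : R -> R) :
  (forall u, is_derive u 1 f (f' u)) -> continuous f' -> C1 f.
Proof.
move=> h cf; split=> [u|]; first exact: ex_derive.
by rewrite (_ : derive1 f = f') //; apply/funext => u; exact: is_derive_derive1.
Qed.

Lemma C1_continuous f : C1 f -> continuous f.
Proof. by move=> h; apply: (is_derive_continuous (fun u => C1_is_derive u h)). Qed.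

Lemma is_derive_fun_add f g u a b : is_derive u 1 f a -> is_derive u 1 g b ->
  is_derive u 1 (fun v => f v + g v) (a + b).
Proof. exact: is_deriveD. Qed.

Lemma is_derive_fun_cst (k u : R) : is_derive u 1 (fun=> k) (0 : R).
Proof. exact: is_derive_cst. Qed.

Lemma is_derive_fun_id u : is_derive u 1 (fun v : R => v) (1 : R).
Proof. exact: is_derive_id. Qed.

Lemma continuous_fun_cst (k : R) : continuous (fun _ : R => k).
Proof. by move=> u; exact: cvg_cst. Qed.

Lemma continuous_fun_add f g : continuous f -> continuous g ->
  continuous (fun u => f u + g u).
Proof. by move=> cf cg u; apply: cvgD; [exact: cf|exact: cg]. Qed.

Lemma continuous_fun_mul f g : continuous f -> continuous g ->
  continuous (fun u => f u * g u).
Proof. by move=> cf cg u; apply: cvgM; [exact: cf|exact: cg]. Qed.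

Lemma continuous_fun_scale (k : R) f : continuous f -> continuous (fun u => k * f u).
Proof. by move=> cf; apply: continuous_fun_mul => //; exact: continuous_fun_cst. Qed.

Lemma continuous_fun_comp f g : continuous f -> continuous g ->
  continuous (fun u => g (f u)).
Proof. by move=> cf cg u; exact: (continuous_comp (cf u) (cg (f u))). Qed.

Lemma is_derive_fun_mul f g u a b : is_derive u 1 f a -> is_derive u 1 g b ->
  is_derive u 1 (fun v => f v * g v) (a * g u + f u * b).
Proof.
move=> h k; apply: (is_derive_eq (is_deriveM h k)).
by rewrite addrC /GRing.scale /= [_ * a]mulrC.
Qed.

Lemma is_derive_fun_scale k f u a : is_derive u 1 f a ->
  is_derive u 1 (fun v => k * f v) (k * a).
Proof.
move=> h; apply: (is_derive_eq (is_derive_fun_mul (is_derive_fun_cst k u) h)).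
by rewrite mul0r add0r.
Qed.

Lemma is_derive_fun_comp f g u a b : is_derive u 1 g b -> is_derive (g u) 1 f a ->
  is_derive u 1 (fun v => f (g v)) (a * b).
Proof. by move=> h k; exact: is_derive1_comp. Qed.

Lemma is_derive_fun_sum n (h : 'I_n -> R -> R) u (a : 'I_n -> R) :
  (forall j, is_derive u 1 (h j) (a j)) ->
  is_derive u 1 (fun v => \sum_j h j v) (\sum_j a j).
Proof.
move=> H; have := is_derive_sum H; rewrite (_ : \sum_j h j = fun v => \sum_j h j v) //.
by apply/funext => v; rewrite fct_sumE.
Qed.

Lemma is_derive_quadratic f u a :
  (forall v, `|f v - f u - a * (v - u)| <= (v - u) ^+ 2) -> is_derive u 1 f a.
Proof.
move=> h.
have H : h^-1 *: (f (h *: 1 + u) - f u) @[h --> 0^'] --> a.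
  apply/cvgrPdist_le => e e0; near=> t.
  have t0 : t != 0 by near: t; exact: nbhs_dnbhs_neq.
  have te : `|t| <= e.
    by near: t; exact: dnbhs0_le.
  rewrite /GRing.scale /= mulr1 distrC.
  have -> : t^-1 * (f (t + u) - f u) - a = t^-1 * (f (t + u) - f u - a * (t + u - u)).
    by field.
  rewrite normrM normfV ler_pdivrMl ?normr_gt0 //.
  apply: le_trans (h _) _; rewrite addrK -real_normK ?num_real // expr2.
  by rewrite ler_wpM2l.
apply: DeriveDef; first by apply/cvg_ex; exists a.
exact: cvg_lim H.
Unshelve. all: by end_near. Qed.

(** Its square is C1, so that quadratic splines made of such squares give admissible curves. *)
Definition pos_part u : R := Num.max 0 u.

Lemma is_derive_sqr_pos_part u :
  is_derive u 1 (fun v => pos_part v ^+ 2) (2 * pos_part u).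
Proof.
apply: is_derive_quadratic => v; rewrite ler_norml /pos_part.
have := sqr_ge0 (v - u); have := sqr_ge0 u; have := sqr_ge0 v.
case: (leP 0 v) => v0; case: (leP 0 u) => u0 *.
- by apply/andP; split; nra.
- have vu := mulr_ge0_le0 v0 (ltW u0).
  by apply/andP; split; nra.
- by apply/andP; split; nra.
- by apply/andP; split; nra.
Qed.

Lemma pos_part_continuous : continuous pos_part.
Proof. by move=> u; apply: continuous_max; [exact: cvg_cst|exact: cvg_id]. Qed.

Lemma is_derive_sqr_pos_part_aff (k c u : R) :
  is_derive u 1 (fun v => pos_part (k * v + c) ^+ 2) (2 * k * pos_part (k * u + c)).
Proof.
have h : is_derive u 1 (fun v => k * v + c) k.
  apply: (is_derive_eq (is_derive_fun_add
    (is_derive_fun_scale k (is_derive_fun_id u)) (is_derive_fun_cst c u))).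
  by rewrite mulr1 addr0.
apply: (is_derive_eq (is_derive_fun_comp h (is_derive_sqr_pos_part (k * u + c)))).
by ring.
Qed.

Lemma pos_part_aff_continuous (k c : R) : continuous (fun v => pos_part (k * v + c)).
Proof.
move=> u; apply: (@continuous_comp _ _ _ (fun v => k * v + c) pos_part).
  by apply: cvgD; [apply: cvgM; [exact: cvg_cst|exact: cvg_id]|exact: cvg_cst].
exact: pos_part_continuous.
Qed.

Local Notation mu := (@lebesgue_measure R).

Lemma continuous_integrable01 f : continuous f -> mu.-integrable `[0, 1] (EFin \o f).
Proof.
move=> cf; apply: continuous_compact_integrable; first exact: segment_compact.
exact: continuous_subspaceT.
Qed.

Lemma Rintegral_derive f f' : (forall u, is_derive u 1 f (f' u)) ->
  continuous f' -> Rintegral mu `[0, 1] f' = f 1 - f 0.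
Proof.
move=> h cf.
have c := is_derive_continuous h.
rewrite /Rintegral (@continuous_FTC2 _ f' f 0 1) //.
- exact: continuous_subspaceT.
- split; first by move=> u _; exact: ex_derive.
    exact/cvg_at_right_filter/c.
  exact/cvg_at_left_filter/c.
- by move=> u _; exact: is_derive_derive1.
Qed.

Lemma Rintegral_ge_derive f f' g : (forall u, is_derive u 1 f (f' u)) ->
  continuous f' -> continuous g -> (forall u, f' u <= g u) ->
  f 1 - f 0 <= Rintegral mu `[0, 1] g.
Proof.
move=> h cf cg fg; rewrite -(Rintegral_derive h cf).
by apply: le_Rintegral => //; exact: continuous_integrable01.
Qed.

Lemma Rintegral_le_derive f f' g : (forall u, is_derive u 1 f (f' u)) ->
  continuous f' -> continuous g -> (forall u, g u <= f' u) ->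
  Rintegral mu `[0, 1] g <= f 1 - f 0.
Proof.
move=> h cf cg fg; rewrite -(Rintegral_derive h cf).
by apply: le_Rintegral => //; exact: continuous_integrable01.
Qed.

End Derivatives.

(** * Upper and lower bounds of the Riemannian distance *)

Section Distance.
Context {R : realType} {r : nat} {ns : nat -> nat} {alpha : nat -> R}
        {hyp : block_data r ns alpha}.
Local Notation V := (vec R r ns).
Local Notation P := (pt R r ns).
Local Notation D := (@Dmet R r ns alpha).
Implicit Types (p q : P) (c : R -> P).

Lemma continuous_sum_fun n (h : 'I_n -> R -> R) :
  (forall j, continuous (h j)) -> continuous (fun u => \sum_j h j u).
Proof.
move=> H; rewrite (_ : (fun u => _) = \sum_j h j); last first.
  by apply/funext => v; rewrite fct_sumE.
apply: (big_ind (fun g : R -> R => continuous g)) => [|f g cf cg u|j _].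
- by move=> u; exact: cvg_cst.
- by apply: cvgD; [exact: cf|exact: cg].
- exact: H.
Qed.

Lemma speed_continuous c : C1curve c -> continuous (speed alpha c).
Proof.
move=> [h1 h2].
apply: (@continuous_fun_comp _ _ Num.sqrt); last exact: sqrt_continuous.
have sqc (f : R -> R) : continuous f -> continuous (fun u => f u ^+ 2).
  by move=> cf; apply: (@continuous_fun_comp _ f (fun x => x ^+ 2)) => //; exact: exprn_continuous.
apply: continuous_fun_add; last exact/sqc/h2.2.
apply: continuous_sum_fun => i; apply: continuous_sum_fun => j.
apply: continuous_fun_mul; last exact/sqc/(h1 i j).2.
apply: (@continuous_fun_comp _ _ expR); last exact: continuous_expR.
move=> u; apply: cvgN; move: u; apply: continuous_fun_scale.
exact: C1_continuous h2.
Qed.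

Lemma curve_length_ge0 c : 0 <= curve_length alpha c.
Proof. by apply: Rintegral_ge0 => u _; exact: sqrtr_ge0. Qed.

Lemma dist_le_length c p q : C1curve c -> c 0 = p -> c 1 = q ->
  dist alpha p q <= curve_length alpha c.
Proof.
move=> h0 h1 h2; apply: ge_inf; last by exists c.
by exists 0 => _ [d _ <-]; exact: curve_length_ge0.
Qed.

Lemma C1curve_profile (phi tau phi' tau' : R -> R) p q :
  (forall u : R, is_derive u 1 phi (phi' u)) -> continuous phi' ->
  (forall u : R, is_derive u 1 tau (tau' u)) -> continuous tau' ->
  C1curve (fun u => ((fun i j => p.1 i j + phi u * (q.1 i j - p.1 i j)) : V, tau u)).
Proof.
move=> h1 c1 h2 c2; split => /= [i j|]; last exact: C1_of_is_derive h2 c2.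
apply: (@C1_of_is_derive _ _ (fun u => 0 + (phi' u * (q.1 i j - p.1 i j) + phi u * 0))).
  move=> u; exact: (is_derive_fun_add (is_derive_fun_cst _ u)
    (is_derive_fun_mul (h1 u) (is_derive_fun_cst _ u))).
apply: continuous_fun_add; first exact: continuous_fun_cst.
apply: continuous_fun_add; apply: continuous_fun_mul => //; try exact: continuous_fun_cst.
exact: (is_derive_continuous h1).
Qed.

Lemma sum_sqr_bound (F t k s : R) : 1 <= k -> 0 <= t -> t <= F - 6 * k ->
  s <= 36 * k -> s + t ^+ 2 <= F ^+ 2.
Proof.
move=> k1 t0 tF sk; apply: (@le_trans _ _ ((6 * k + t) ^+ 2)); first nra.
by rewrite lerXn2r ?nnegrE //; lra.
Qed.

Lemma dist_le_top p q (H : R) : p.2 <= H -> q.2 <= H ->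
  (forall i : 'I_r, blocknorm p.1 q.1 i <= expR (alpha i * H)) ->
  dist alpha p q <= 2 * H - p.2 - q.2 + 6 * r%:R.
Proof.
move=> pH qH hb.
set A := H - p.2; set B := H - q.2.
have A0 : 0 <= A by rewrite subr_ge0.
have B0 : 0 <= B by rewrite subr_ge0.
(* The curve climbs to height H on [0, 1/3], moves horizontally on [1/3, 2/3] and
   descends on [2/3, 1]; the quadratic splines make it C1. *)
pose g (k e u : R) : R := pos_part (k * u + e).
pose tau (u : R) : R := H + (- (9 * A) * g (-1) 3^-1 u ^+ 2 + - (9 * B) * g 1 (- (2 / 3)) u ^+ 2).
pose tau' (u : R) : R := 0 + (- (9 * A) * (2 * (-1) * g (-1) 3^-1 u)
                 + - (9 * B) * (2 * 1 * g 1 (- (2 / 3)) u)).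
pose phi (u : R) : R := 18 * (g 1 (- 3^-1) u ^+ 2 + (- 2 * g 1 (- 2^-1) u ^+ 2
                 + g 1 (- (2 / 3)) u ^+ 2)).
pose phi' (u : R) : R := 18 * (2 * 1 * g 1 (- 3^-1) u + (- 2 * (2 * 1 * g 1 (- 2^-1) u)
                 + 2 * 1 * g 1 (- (2 / 3)) u)).
have gc k e : continuous (g k e) by exact: pos_part_aff_continuous.
have gd (k e u : R) : is_derive u 1 (fun v => g k e v ^+ 2) (2 * k * g k e u).
  exact: is_derive_sqr_pos_part_aff.
have gs (s k e : R) : continuous (fun u => s * g k e u) by exact: continuous_fun_scale.
have dtau (u : R) : is_derive u 1 tau (tau' u).
  exact: (is_derive_fun_add (is_derive_fun_cst _ u) (is_derive_fun_add
    (is_derive_fun_scale _ (gd _ _ u)) (is_derive_fun_scale _ (gd _ _ u)))).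
have dphi (u : R) : is_derive u 1 phi (phi' u).
  exact: (is_derive_fun_scale _ (is_derive_fun_add (gd _ _ u) (is_derive_fun_add
    (is_derive_fun_scale _ (gd _ _ u)) (gd _ _ u)))).
have ctau : continuous tau'.
  apply: continuous_fun_add; first exact: continuous_fun_cst.
  by apply: continuous_fun_add; apply: continuous_fun_scale; exact: gs.
have cphi : continuous phi'.
  apply: continuous_fun_scale; apply: continuous_fun_add; first exact: gs.
  by apply: continuous_fun_add; [apply: continuous_fun_scale|]; exact: gs.
have cC := C1curve_profile p q dphi cphi dtau ctau.
set c := (X in C1curve X) in cC.
have c0 : c 0 = p.
  rewrite /c [p in RHS]surjective_pairing; congr pair.
    apply/functional_extensionality_dep => i; apply/funext => j.
    rewrite (_ : phi 0 = 0) ?mul0r ?addr0 // /phi /g /pos_part !mulr0 !add0r.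
    by rewrite !max_l ?oppr_le0; lra.
  rewrite /tau /g /pos_part !mulr0 !add0r max_r; last lra.
  by rewrite max_l ?oppr_le0 /A; lra.
have c1 : c 1 = q.
  rewrite /c [q in RHS]surjective_pairing; congr pair.
    apply/functional_extensionality_dep => i; apply/funext => j.
    have -> : phi 1 = 1 by rewrite /phi /g /pos_part !mulr1 !max_r; lra.
    by rewrite mul1r addrC subrK.
  rewrite /tau /g /pos_part !mulr1 max_l; last lra.
  by rewrite max_r /B; lra.
apply: (le_trans (dist_le_length cC c0 c1)).
(* [f'] is 6r plus a bound of the vertical speed; it dominates the speed of the curve, and f 1 - f 0
   is the asserted bound. *)
pose f (u : R) : R := 6 * r%:R * u + (- (9 * A) * g (-1) 3^-1 u ^+ 2 + 9 * B * g 1 (- (2 / 3)) u ^+ 2).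
pose f' (u : R) : R := 6 * r%:R * 1 + (- (9 * A) * (2 * (-1) * g (-1) 3^-1 u)
                 + 9 * B * (2 * 1 * g 1 (- (2 / 3)) u)).
have df (u : R) : is_derive u 1 f (f' u).
  exact: (is_derive_fun_add (is_derive_fun_scale _ (is_derive_fun_id u)) (is_derive_fun_add
    (is_derive_fun_scale _ (gd _ _ u)) (is_derive_fun_scale _ (gd _ _ u)))).
have cf : continuous f'.
  apply: continuous_fun_add; first exact: continuous_fun_cst.
  by apply: continuous_fun_add; apply: continuous_fun_scale; exact: gs.
have -> : 2 * H - p.2 - q.2 + 6 * r%:R = f 1 - f 0.
  rewrite /f /g /pos_part !mulr0 !mulr1 !add0r.
  rewrite [Num.max 0 (-1 + _)]max_l; last lra.
  rewrite [Num.max 0 (1 + _)]max_r; last lra.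
  rewrite [Num.max 0 3^-1]max_r; last lra.
  rewrite [Num.max 0 (- _)]max_l; last lra.
  by rewrite /A /B; field.
apply: (Rintegral_le_derive df cf (speed_continuous cC)) => u.
have gp k d v : 0 <= g k d v by rewrite /g /pos_part le_max lexx.
have f'E : f' u = 6 * r%:R + 18 * A * g (-1) 3^-1 u + 18 * B * g 1 (- (2 / 3)) u.
  by rewrite /f'; ring.
have f'0 : 0 <= f' u.
  by rewrite f'E !addr_ge0 ?mulr_ge0 ?gp ?ler0n.
have tauf : `|tau' u| <= f' u - 6 * r%:R.
  rewrite f'E /tau'.
  have a1 : 0 <= A * g (-1) 3^-1 u by rewrite mulr_ge0.
  have b1 : 0 <= B * g 1 (- (2 / 3)) u by rewrite mulr_ge0.
  by rewrite ler_norml; apply/andP; split; lra.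
have phi6 : `|phi' u| <= 6.
  rewrite /phi' /g /pos_part !mul1r ler_norml.
  by case: (leP 0 (u + - 3^-1)); case: (leP 0 (u + - 2^-1));
     case: (leP 0 (u + - (2 / 3))) => *; apply/andP; split; lra.
(* Horizontal motion takes place only on [1/3, 2/3], where the height is exactly H. *)
have phit : phi' u = 0 \/ tau u = H.
  have [u1|u1] := leP u 3^-1.
    left; rewrite /phi' /g /pos_part !mul1r !max_l; lra.
  have [u2|u2] := leP (2 / 3) u.
    left; rewrite /phi' /g /pos_part !mul1r !max_r; lra.
  right; rewrite /tau /g /pos_part !max_l; lra.
rewrite -(ger0_norm f'0) -sqrtr_sqr ler_wsqrtr //.
have E1 i j : derive1 (fun v => (c v).1 i j) u = phi' u * (q.1 i j - p.1 i j).
  apply: is_derive_derive1 => /=.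
  apply: (is_derive_eq (is_derive_fun_add (is_derive_fun_cst _ u)
    (is_derive_fun_mul (dphi u) (is_derive_fun_cst _ u)))).
  by rewrite mulr0 addr0 add0r.
have E2 : derive1 (fun v => (c v).2) u = tau' u by exact: is_derive_derive1.
rewrite E2.
under eq_bigr do under eq_bigr do rewrite E1.
(* At height H the factor exp (- 2 alpha_i H) offsets the squared block norm, so each block
   contributes at most 6^2, where 6 bounds the slope of [phi]. *)
have hS : \sum_(i < r) \sum_(j < ns i)
   expR (- (2 * alpha i * (c u).2)) * (phi' u * (q.1 i j - p.1 i j)) ^+ 2 <= 36 * r%:R.
  have [->|tauE] := phit.
    rewrite big1 ?mulr_ge0 ?ler0n // => i _; rewrite big1 // => j _.
    by rewrite mul0r expr0n mulr0.
  have step (i : 'I_r) : \sum_(j < ns i) expR (- (2 * alpha i * (c u).2)) *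
      (phi' u * (q.1 i j - p.1 i j)) ^+ 2 <= 36.
    rewrite -mulr_sumr; under eq_bigr do rewrite exprMn; rewrite -mulr_sumr.
    have bE : \sum_(j < ns i) (q.1 i j - p.1 i j) ^+ 2 = blocknorm p.1 q.1 i ^+ 2.
      rewrite sqr_sqrtr; last by apply: sumr_ge0 => j _; exact: sqr_ge0.
      by apply: eq_bigr => j _; rewrite -sqrrN opprB.
    rewrite bE /= tauE mulrCA -[36]mulr1.
    apply: ler_pM; first exact: sqr_ge0.
    - by apply: mulr_ge0; [exact: expR_ge0|exact: sqr_ge0].
    - rewrite -real_normK ?num_real //.
      have -> : 36 = 6 ^+ 2 :> R by ring.
      by rewrite lerXn2r // nnegrE.
    rewrite expRN mulrC ler_pdivrMr ?expR_gt0 // mul1r.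
    have -> : 2 * alpha i * H = alpha i * H + alpha i * H by ring.
    rewrite expRD -expr2 lerXn2r ?nnegrE ?blocknorm_ge0 ?expR_ge0 //.
  apply: le_trans (ler_sum _ (fun i _ => step i)) _.
  by rewrite sumr_const card_ord mulr_natr.
have r1 : 1 <= r%:R :> R by rewrite ler1n; apply: ltnW; exact: blocks_ge2.
have tt : tau' u ^+ 2 = `|tau' u| ^+ 2 by rewrite real_normK ?num_real.
have t0 := normr_ge0 (tau' u).
rewrite tt; exact: sum_sqr_bound r1 t0 tauf hS.
Qed.

(** Cauchy-Schwarz for (v, T) against (2k, 1 - k^2), a vector of norm 1 + k^2. *)
Lemma plane_Cauchy (k v T : R) :
  2 * k * v + T * (1 - k ^+ 2) <= Num.sqrt (v ^+ 2 + T ^+ 2) * (1 + k ^+ 2).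
Proof.
have k0 : 0 <= 1 + k ^+ 2 by rewrite addr_ge0 ?sqr_ge0.
apply: le_trans (ler_norm _) _; rewrite -sqrtr_sqr.
have -> : 1 + k ^+ 2 = Num.sqrt ((1 + k ^+ 2) ^+ 2) by rewrite sqrtr_sqr ger0_norm.
rewrite -sqrtrM ?addr_ge0 ?sqr_ge0 //.
apply: ler_wsqrtr.
rewrite -subr_ge0 (_ : _ - _ = (2 * k * T - v * (1 - k ^+ 2)) ^+ 2) ?sqr_ge0 //.
by ring.
Qed.

(** The left side is the derivative of (1/a) ln (a^2 s^2 / E + E) along a curve with E = exp (a t),
    t' = [T] and (s^2)' = [S']. With k = a s / E and v = w / E it is at most (2 k v + T (1 - k^2)) /
    (1 + k^2), and [plane_Cauchy] concludes. *)
Lemma busemann_slope (a s w E S' T : R) : 0 < a -> 0 < E -> S' <= 2 * (s * w) ->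
  a^-1 * ((a ^+ 2 * (s ^+ 2 / E) + E)^-1 *
    (a ^+ 2 * (S' / E + s ^+ 2 * (E^-1 * (- a * T))) + E * (a * T)))
  <= Num.sqrt ((w / E) ^+ 2 + T ^+ 2).
Proof.
move=> a0 E0 hS; set Z := Num.sqrt _; pose k := a * s / E.
have k1 : 0 < 1 + k ^+ 2 by rewrite ltr_pwDl ?sqr_ge0.
have GE : a ^+ 2 * (s ^+ 2 / E) + E = E * (1 + k ^+ 2).
  by rewrite /k; field; rewrite gt_eqF.
rewrite mulrA -invfM mulrC ler_pdivrMr; last by rewrite GE !mulr_gt0.
have h : 2 * k * (w / E) + T * (1 - k ^+ 2) <= Z * (1 + k ^+ 2) := plane_Cauchy _ _ _.
have aE := mulr_gt0 a0 E0.
apply: (@le_trans _ _ (a * E * (2 * k * (w / E) + T * (1 - k ^+ 2)))); last first.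
  by move: h; rewrite -(ler_pM2l aE) GE; congr (_ <= _); ring.
have -> : a * E * (2 * k * (w / E) + T * (1 - k ^+ 2)) =
   a ^+ 2 / E * (2 * (s * w)) + a * T * E - a ^+ 3 * T * s ^+ 2 / E.
  by rewrite /k; field; rewrite gt_eqF.
have -> : a ^+ 2 * (S' / E + s ^+ 2 * (E^-1 * (- a * T))) + E * (a * T) =
   a ^+ 2 / E * S' + a * T * E - a ^+ 3 * T * s ^+ 2 / E.
  by field; rewrite gt_eqF.
by rewrite !lerD2r ler_pM2l // divr_gt0 // exprn_gt0.
Qed.

Lemma busemann_end (a x y z : R) : 0 < a ->
  a^-1 * (y *+ 2 + (x *+ 2 + - a * z)) = 2 * x / a + 2 * y / a - z.
Proof. by move=> a0; field; rewrite gt_eqF. Qed.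

Lemma dist_lower_bound p q (a : R) :
  (forall c, C1curve c -> c 0 = p -> c 1 = q -> a <= curve_length alpha c) ->
  a <= dist alpha p q.
Proof.
move=> h; apply: lb_le_inf; last by move=> _ [c [? [? ?]] <-]; exact: h.
(* A lower bound passes to the infimum only if some curve exists; the affine path from p to q is
   one. *)
pose tau (u : R) : R := p.2 + u * (q.2 - p.2).
have dtau (u : R) : is_derive u 1 tau (0 + (1 * (q.2 - p.2) + u * 0)).
  exact: (is_derive_fun_add (is_derive_fun_cst _ u)
    (is_derive_fun_mul (is_derive_fun_id u) (is_derive_fun_cst _ u))).
have ctau : continuous (fun u : R => 0 + (1 * (q.2 - p.2) + u * 0)).
  rewrite (_ : (fun u => _) = fun _ : R => q.2 - p.2); first exact: continuous_fun_cst.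
  by apply/funext => u; rewrite mulr0 addr0 add0r mul1r.
have cC := C1curve_profile p q (fun u => is_derive_fun_id u)
  (@continuous_fun_cst _ 1) dtau ctau.
set c := (X in C1curve X) in cC.
exists (curve_length alpha c); exists c => //; split=> //; split.
  rewrite /c [p in RHS]surjective_pairing; congr pair; last by rewrite /tau mul0r addr0.
  by apply/functional_extensionality_dep => i; apply/funext => j; rewrite mul0r addr0.
rewrite /c [q in RHS]surjective_pairing; congr pair; last by rewrite /tau mul1r addrC subrK.
by apply/functional_extensionality_dep => i; apply/funext => j; rewrite mul1r addrC subrK.
Qed.

Lemma dist_ge_height p q : `|p.2 - q.2| <= dist alpha p q.
Proof.
apply: dist_lower_bound => c cC cp cq.
have tau_le u : `|derive1 (fun v => (c v).2) u| <= speed alpha c u.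
  rewrite -sqrtr_sqr; apply: ler_wsqrtr; rewrite lerDr.
  apply: sumr_ge0 => i _; apply: sumr_ge0 => j _.
  by rewrite mulr_ge0 ?expR_ge0 ?sqr_ge0.
have d2 (u : R) := C1_is_derive u cC.2.
have c2 := cC.2.2.
have := Rintegral_ge_derive d2 c2 (speed_continuous cC)
  (fun u => le_trans (ler_norm _) (tau_le u)).
have := Rintegral_ge_derive (fun u => is_derive_fun_scale (-1) (d2 u))
  (@continuous_fun_scale _ (-1) _ c2) (speed_continuous cC).
have h u : -1 * derive1 (fun v => (c v).2) u <= speed alpha c u.
  by rewrite mulN1r; apply: le_trans (tau_le u); rewrite -normrN ler_norm.
move=> /(_ h); rewrite /= cp cq -/(curve_length alpha c) => h1 h2.
by rewrite ler_norml; apply/andP; split; lra.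
Qed.

(* The 1-Lipschitz function is the Busemann function, centred at the endpoint of
   the vertical geodesic through p, of the hyperbolic plane of curvature
   -(alpha i)^2 spanned by t and the distance to p in the i-th block. *)
Lemma dist_ge_block p q (i : 'I_r) : 0 < blocknorm p.1 q.1 i ->
  2 * ln (blocknorm p.1 q.1 i) / alpha i + 2 * ln (alpha i) / alpha i
    - p.2 - q.2 <= dist alpha p q.
Proof.
move=> b0; apply: dist_lower_bound => c cC cp cq.
set a := alpha i; have a0 : 0 < a by exact: alpha_gt0.
pose X (j : 'I_(ns i)) (u : R) := (c u).1 i j.
pose X' (j : 'I_(ns i)) (u : R) := derive1 (X j) u.
pose T (u : R) := (c u).2; pose T' (u : R) := derive1 T u.
have dX j (u : R) : is_derive u 1 (X j) (X' j u) by exact: C1_is_derive (cC.1 i j).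
have dT (u : R) : is_derive u 1 T (T' u) by exact: C1_is_derive cC.2.
have cX j : continuous (X j) by exact: C1_continuous (cC.1 i j).
have cT : continuous T by exact: C1_continuous cC.2.
have cX' j : continuous (X' j) by exact: (cC.1 i j).2.
have cT' : continuous T' by exact: cC.2.2.
pose Y j (u : R) := X j u + - p.1 i j.
have dY j (u : R) : is_derive u 1 (Y j) (X' j u).
  by apply: (is_derive_eq (is_derive_fun_add (dX j u) (is_derive_fun_cst _ u))); rewrite addr0.
have cY j : continuous (Y j).
  exact: (continuous_fun_add (cX j) (@continuous_fun_cst _ _)).
pose S (u : R) := \sum_j Y j u * Y j u.
pose S' (u : R) := \sum_j (X' j u * Y j u + Y j u * X' j u).
have dS (u : R) : is_derive u 1 S (S' u).
  exact: (is_derive_fun_sum (fun j => is_derive_fun_mul (dY j u) (dY j u))).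
have cS : continuous S.
  by apply: continuous_sum_fun => j; exact: continuous_fun_mul.
have cS' : continuous S'.
  by apply: continuous_sum_fun => j; apply: continuous_fun_add; exact: continuous_fun_mul.
have S0 u : 0 <= S u by apply: sumr_ge0 => j _; rewrite -expr2 sqr_ge0.
pose e (s u : R) := expR (s * T u).
have de s (u : R) : is_derive u 1 (e s) (e s u * (s * T' u)).
  exact: (is_derive_fun_comp (is_derive_fun_scale s (dT u)) (is_derive_expR _)).
have ce s : continuous (e s).
  by apply: (@continuous_fun_comp _ _ expR (@continuous_fun_scale _ s _ cT)); exact: continuous_expR.
pose G (u : R) := a ^+ 2 * (S u * e (- a) u) + e a u.
pose G' (u : R) := a ^+ 2 * (S' u * e (- a) u + S u * (e (- a) u * (- a * T' u)))
                   + e a u * (a * T' u).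
have dG (u : R) : is_derive u 1 G (G' u).
  exact: (is_derive_fun_add (is_derive_fun_scale _ (is_derive_fun_mul (dS u) (de _ u))) (de _ u)).
have cG : continuous G := is_derive_continuous dG.
have cG' : continuous G'.
  apply: continuous_fun_add.
    apply: continuous_fun_scale; apply: continuous_fun_add.
      exact: continuous_fun_mul.
    apply: continuous_fun_mul => //; apply: continuous_fun_mul => //.
    exact: continuous_fun_scale.
  by apply: continuous_fun_mul => //; exact: continuous_fun_scale.
have G0 u : 0 < G u.
  apply: ltr_wpDl; last exact: expR_gt0.
  apply: mulr_ge0; first exact: sqr_ge0.
  by apply: mulr_ge0; [exact: S0|exact: expR_ge0].
(* The Busemann function along the curve. It equals the height at p; at q, dropping the summand exp
   (a t) of [G] leaves the stated lower bound. *)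
pose f (u : R) := a^-1 * ln (G u).
pose f' (u : R) := a^-1 * ((G u)^-1 * G' u).
have df (u : R) : is_derive u 1 f (f' u).
  exact: (is_derive_fun_scale _ (is_derive_fun_comp (dG u) (is_derive1_ln (G0 u)))).
have cf : continuous f'.
  apply: continuous_fun_scale; apply: continuous_fun_mul => // u.
  by apply: cvgV; [rewrite gt_eqF ?G0|exact: cG].
have key u : f' u <= speed alpha c u.
  set w := Num.sqrt (\sum_j X' j u ^+ 2).
  set E := e a u; have E0 : 0 < E by exact: expR_gt0.
  have EV : e (- a) u = E^-1 by rewrite /e mulNr expRN.
  pose v := w / E.
  have sp : Num.sqrt (v ^+ 2 + T' u ^+ 2) <= speed alpha c u.
    apply: ler_wsqrtr; rewrite lerD2r (bigD1 i) //= -[leLHS]addr0 lerD //; last first.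
      apply: sumr_ge0 => k _; apply: sumr_ge0 => j _.
      by rewrite mulr_ge0 ?expR_ge0 ?sqr_ge0.
    rewrite -mulr_sumr /v exprMn sqr_sqrtr; last first.
      by apply: sumr_ge0 => j _; exact: sqr_ge0.
    rewrite mulrC.
    rewrite ler_wpM2r //; first by apply: sumr_ge0 => j _; exact: sqr_ge0.
    rewrite exprVn -[E]/(expR _) expRN lef_pV2 ?posrE ?expR_gt0 ?exprn_gt0 //.
    by rewrite expr2 -expRD -/a -/(T u) -mulrDl -mulr2n -[a *+ 2]mulr_natl.
  apply: le_trans sp.
  have S'le : S' u <= 2 * (Num.sqrt (S u) * w).
    rewrite /S' (_ : \sum_j _ = 2 * \sum_j Y j u * X' j u); last first.
      by rewrite mulr_sumr; apply: eq_bigr => j _; ring.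
    rewrite ler_pM2l // /S; under [X in Num.sqrt X * _]eq_bigr do rewrite -expr2.
    exact: Cauchy_Schwarz_sqrt.
  have sS : Num.sqrt (S u) ^+ 2 = S u by rewrite sqr_sqrtr.
  have := busemann_slope (T' u) a0 E0 S'le.
  by rewrite sS /f' /G /G' EV.
have := Rintegral_ge_derive df cf (speed_continuous cC) key.
rewrite -/(curve_length alpha c); apply: le_trans.
have S00 : S 0 = 0.
  by rewrite /S big1 // => j _; rewrite /Y /X cp subrr mul0r.
have S11 : S 1 = blocknorm p.1 q.1 i ^+ 2.
  rewrite sqr_sqrtr; last by apply: sumr_ge0 => j _; exact: sqr_ge0.
  by apply: eq_bigr => j _; rewrite /Y /X cq; ring.
have -> : f 0 = p.2.
  rewrite /f /G S00 mul0r mulr0 add0r /e expRK /T cp mulrA mulVf ?mul1r ?gt_eqF //.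
have pS1 : 0 < a ^+ 2 * (S 1 * e (- a) 1).
  apply: mulr_gt0; first exact: exprn_gt0.
  by apply: mulr_gt0; [rewrite S11 exprn_gt0|exact: expR_gt0].
have : a^-1 * ln (a ^+ 2 * (S 1 * e (- a) 1)) <= f 1.
  rewrite ler_pM2l ?invr_gt0 // ler_ln ?posrE ?G0 ?pS1 //.
  by rewrite /G lerDl expR_ge0.
rewrite lnM ?posrE ?exprn_gt0 //; last first.
  by apply: mulr_gt0; [rewrite S11 exprn_gt0|exact: expR_gt0].
rewrite S11 lnM ?posrE ?exprn_gt0 ?expR_gt0 // /e expRK /T cq => h.
have bE : ln (blocknorm p.1 q.1 i ^+ 2) = ln (blocknorm p.1 q.1 i) *+ 2 by exact: lnXn.
have aE : ln (a ^+ 2) = ln a *+ 2 by exact: lnXn.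
move: h; rewrite bE aE (busemann_end _ _ _ a0) => h.
by rewrite addrAC lerD2r.
Qed.

End Distance.

(** * Distance and Gromov product up to a bounded error *)

Section Peak.
Context {R : realType} {r : nat} {ns : nat -> nat} {alpha : nat -> R}
        {hyp : block_data r ns alpha}.
Local Notation P := (pt R r ns).
Local Notation D := (@Dmet R r ns alpha).
Implicit Types p q w : P.

(* exp (alpha 0 * height of a geodesic from p to q), up to a constant factor *)
Definition peak (alpha : nat -> R) p q : R :=
  Num.max (Dmet alpha p.1 q.1)
    (Num.max (expR (alpha 0%N * p.2)) (expR (alpha 0%N * q.2))).

Lemma peak_ge_Dmet p q : D p.1 q.1 <= peak alpha p q.
Proof. by rewrite le_max lexx. Qed.

Lemma peak_ge_l p q : expR (alpha 0%N * p.2) <= peak alpha p q.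
Proof. by rewrite !le_max lexx !orbT. Qed.

Lemma peak_ge_r p q : expR (alpha 0%N * q.2) <= peak alpha p q.
Proof. by rewrite !le_max lexx !orbT. Qed.

Lemma peak_gt0 p q : 0 < peak alpha p q.
Proof. exact: lt_le_trans (expR_gt0 _) (peak_ge_l p q). Qed.

Lemma peak_le p q s : D p.1 q.1 <= s -> expR (alpha 0%N * p.2) <= s ->
  expR (alpha 0%N * q.2) <= s -> peak alpha p q <= s.
Proof. by move=> h1 h2 h3; rewrite !ge_max h1 h2. Qed.

Lemma peakC p q : peak alpha p q = peak alpha q p.
Proof. by rewrite /peak DmetC [Num.max (expR _) _]maxC. Qed.

(** From above, a path through the height ln (peak) / alpha_0, at which every block fits. From
    below, the term that attains the maximum decides: the block attaining D gives [dist_ge_block], a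
    height gives [dist_ge_height]. *)
Lemma dist_peak : exists C : R, forall p q,
  `|dist alpha p q - (2 * ln (peak alpha p q) / alpha 0%N - p.2 - q.2)| <= C.
Proof.
have a0 : 0 < alpha 0%N := @alpha0_gt0 _ _ _ _ hyp.
pose C0 : R := \sum_(i < r) `|2 * ln (alpha i) / alpha i|.
have C00 : 0 <= C0 by apply: sumr_ge0.
exists (6 * r%:R + C0) => p q; set X := peak alpha p q.
have X0 : 0 < X := peak_gt0 p q.
have r0 : 0 <= 6 * r%:R :> R by rewrite mulr_ge0.
have up : dist alpha p q <= 2 * (ln X / alpha 0%N) - p.2 - q.2 + 6 * r%:R.
  apply: dist_le_top => [||i].
  - rewrite ler_pdivlMr // mulrC -(expRK (alpha 0%N * p.2)).
    by rewrite ler_ln ?posrE ?expR_gt0 ?peak_gt0 ?peak_ge_l.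
  - rewrite ler_pdivlMr // mulrC -(expRK (alpha 0%N * q.2)).
    by rewrite ler_ln ?posrE ?expR_gt0 ?peak_gt0 ?peak_ge_r.
  - have -> : expR (alpha i * (ln X / alpha 0%N)) = X `^ weight alpha i.
      rewrite /powR gt_eqF // /weight; congr expR.
      by rewrite mulrCA mulrC.
    exact: blocknorm_le_of_Dmet (peak_ge_Dmet p q).
have lo : 2 * ln X / alpha 0%N - p.2 - q.2 - C0 <= dist alpha p q.
  have := @dist_ge_height _ _ _ alpha p q; rewrite ler_norml => /andP[h1 h2].
  have [XD|XD] := eqVneq X (D p.1 q.1).
    have [i Ei] := @Dmet_attained _ _ _ _ hyp p.1 q.1.
    have b0 : 0 < blocknorm p.1 q.1 i by rewrite -Ei powR_gt0 // -XD.
    have ai := @alpha_gt0 _ _ _ _ hyp i.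
    have := @dist_ge_block _ _ _ alpha hyp _ _ _ b0; rewrite -Ei ln_powR -XD.
    have -> : 2 * (weight alpha i * ln X) / alpha i = 2 * ln X / alpha 0%N.
      by rewrite /weight; field; rewrite !gt_eqF.
    have : `|2 * ln (alpha i) / alpha i| <= C0.
      by rewrite /C0 (bigD1 i) //= lerDl sumr_ge0.
    by rewrite ler_norml => /andP[]; lra.
  have lnE t : 2 * ln (expR (alpha 0%N * t)) / alpha 0%N = 2 * t.
    by rewrite expRK; field; rewrite gt_eqF.
  have : X = expR (alpha 0%N * p.2) \/ X = expR (alpha 0%N * q.2).
    move: XD; rewrite /X /peak; case: (leP (D p.1 q.1)) => _; last by rewrite eqxx.
    by move=> _; case: leP; [right|left].
  by move=> [->|->]; rewrite lnE; lra.
rewrite ler_norml; move: up lo; rewrite [2 * (_ / _)]mulrA => up lo.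
by apply/andP; split; lra.
Qed.

(** The additive error of the triangle inequality becomes a factor because [peak alpha w' p] is
    bounded below by the exponential of the height of w'. *)
Lemma peak_compare w w' : exists K : R, 0 < K /\
  forall p, peak alpha w p <= K * peak alpha w' p.
Proof.
set W := expR (alpha 0%N * w.2); set W' := expR (alpha 0%N * w'.2).
have W0 : 0 < W := expR_gt0 _.
have W0' : 0 < W' := expR_gt0 _.
have D0 : 0 <= D w.1 w'.1 := Dmet_ge0 _ _.
have K0 : 0 <= (D w.1 w'.1 + W) / W' by rewrite divr_ge0 ?addr_ge0 // ltW.
exists ((D w.1 w'.1 + W) / W' + 1); split; first by rewrite ltr_wpDl.
move=> p; have Y0 := peak_gt0 w' p.
have hW : W' <= peak alpha w' p := peak_ge_l w' p.
have h : D w.1 w'.1 + W <= (D w.1 w'.1 + W) / W' * peak alpha w' p.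
  by rewrite mulrAC ler_pdivlMr // ler_wpM2l // addr_ge0 // ltW.
rewrite mulrDl mul1r; apply: peak_le.
- apply: le_trans (Dmet_triangle w'.1 _ _) _; apply: lerD; last exact: peak_ge_Dmet.
  by apply: le_trans h; rewrite lerDl ltW.
- apply: le_trans (_ : D w.1 w'.1 + W <= _); first by rewrite lerDr.
  by apply: le_trans h _; rewrite lerDl ltW.
- by apply: le_trans (peak_ge_r w' p) _; rewrite lerDr mulr_ge0 // ltW.
Qed.

Lemma gprod_arith (C L w p q dwp dwq dpq x1 x2 y1 y2 z : R) :
  `|dwp - (2 * y1 - w - p)| <= C -> `|dwq - (2 * x1 - w - q)| <= C ->
  `|dpq - (2 * z - p - q)| <= C -> `|y1 - y2| <= L -> `|x1 - x2| <= L ->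
  `|(dwp + dwq - dpq) / 2 - (y2 + x2 - z)| <= 3 * C / 2 + `|w| + 2 * L.
Proof.
have := ler_norm w; have := ler_norm (- w); rewrite normrN.
rewrite !ler_norml => ? ? /andP[? ?] /andP[? ?] /andP[? ?] /andP[? ?] /andP[? ?].
by apply/andP; split; lra.
Qed.

Local Notation o := (origin R r ns).

(** In the Gromov product the heights of p and q cancel, and moving the base point to the origin
    costs a bounded error. *)
Lemma gprod_peak w : exists C : R, forall p q,
  `|gprod alpha w p q -
    (ln (peak alpha o p) + ln (peak alpha o q) - ln (peak alpha p q)) / alpha 0%N| <= C.
Proof.
have a0 : 0 < alpha 0%N := @alpha0_gt0 _ _ _ _ hyp.
have [C hC] := dist_peak.
have [K1 [K10 h1]] := peak_compare w o.
have [K2 [K20 h2]] := peak_compare o w.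
have cmp p : `|ln (peak alpha w p) - ln (peak alpha o p)| <= `|ln K1| + `|ln K2|.
  have := h1 p; rewrite -ler_ln ?posrE ?mulr_gt0 ?peak_gt0 // lnM ?posrE ?peak_gt0 //.
  have := h2 p; rewrite -ler_ln ?posrE ?mulr_gt0 ?peak_gt0 // lnM ?posrE ?peak_gt0 //.
  have := ler_norm (ln K1); have := ler_norm (ln K2).
  have := normr_ge0 (ln K1); have := normr_ge0 (ln K2).
  by move=> *; rewrite ler_norml; apply/andP; split; lra.
set L := `|ln K1| + `|ln K2| in cmp.
have divL (x y : R) : `|x - y| <= L -> `|x / alpha 0%N - y / alpha 0%N| <= L / alpha 0%N.
  move=> h; rewrite -mulrBl normrM [X in _ * X]gtr0_norm ?invr_gt0 //.
  by rewrite ler_wpM2r // invr_ge0 ltW.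
exists (3 * C / 2 + `|w.2| + 2 * (L / alpha 0%N)) => p q.
rewrite mulrBl mulrDl.
apply: (gprod_arith (p := p.2) (q := q.2) _ _ _ (divL _ _ (cmp p)) (divL _ _ (cmp q))).
- by rewrite [2 * (_ / _)]mulrA; exact: hC.
- by rewrite [2 * (_ / _)]mulrA; exact: hC.
- by rewrite [2 * (_ / _)]mulrA; exact: hC.
Qed.

End Peak.

(** * Quasisymmetric images of leaves *)

Section Packing.
Variable R : realType.

(** The interval has length 2w, so it contains at least trunc (2w / e) of the points e, 2e, ..., Me;
    as w >= e, truncation costs at most w / e. *)
Lemma card_lattice_interval (M : nat) (e lo w : R) : 0 < e -> 0 <= lo -> e <= w ->
  lo + w * 2 <= e * M%:R ->
  w / e <= (#|[pred z : 'I_M | lo < e * z.+1%:R <= lo + w * 2]|)%:R.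
Proof.
move=> e0 lo0 ew hM.
have w0 : 0 < w by exact: lt_le_trans ew.
pose b := Num.trunc (lo / e); pose m := Num.trunc (w * 2 / e).
have b1 : b%:R <= lo / e by rewrite truncn_le divr_ge0 // ltW.
have b2 : lo / e < b.+1%:R by exact: truncnS_gt.
have m1 : m%:R <= w * 2 / e by rewrite truncn_le divr_ge0 ?mulr_ge0 // ltW.
have m2 : w * 2 / e < m.+1%:R by exact: truncnS_gt.
have wm : w / e <= m%:R.
  have h1 : 1 <= w / e by rewrite ler_pdivlMr // mul1r.
  by move: m2; rewrite -natr1 mulrAC; lra.
have up (k : 'I_m) : (b + k).+1%:R <= (lo + w * 2) / e.
  rewrite mulrDl -addnS natrD; apply: lerD => //.
  by apply: le_trans m1; rewrite ler_nat.
have lt (k : 'I_m) : (b + k < M)%N.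
  rewrite -(ler_nat R); apply: le_trans (up k) _.
  by rewrite ler_pdivrMr // [leRHS]mulrC.
apply: le_trans wm _; rewrite ler_nat -{1}(card_ord m).
have /card_codom <- : injective (fun k : 'I_m => Ordinal (lt k)).
  by move=> k l [/addnI kl]; exact: val_inj.
apply: subset_leq_card; apply/fintype.subsetP => z /codomP[k ->]; rewrite inE /=.
apply/andP; split; last by rewrite mulrC -ler_pdivlMr.
rewrite mulrC -ltr_pdivrMr //; apply: lt_le_trans b2 _.
by rewrite ler_nat ltnS leq_addr.
Qed.

Lemma natr_card_family (T : finType) (M : nat) (F : T -> pred 'I_M) :
  (#|family F|)%:R = \prod_t (#|F t|)%:R :> R.
Proof.
by rewrite card_family foldrE big_image /= natr_prod.
Qed.

(* Comparison of volumes, by counting the points of a fine lattice in the boxes with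
   centres [c k] and half-sides [h k]. *)
Lemma box_packing (T I : finType) (c h : I -> T -> R) (B : R) : 0 < B ->
  (forall k t, 0 < h k t) -> (forall k t, `|c k t| + h k t <= B) ->
  (forall k l, k != l -> exists t, h k t + h l t <= `|c k t - c l t|) ->
  \sum_k \prod_t h k t <= (2 * B) ^+ #|T|.
Proof.
move=> B0 h0 hB hd.
(* M exceeds every 2B / h, so the mesh e = 2B / M is at most every half-side. *)
pose m k t := (Num.trunc (2 * B / h k t)).+1.
pose M := (\sum_k \sum_t m k t).+1.
pose e := 2 * B / M%:R.
have M0 : 0 < M%:R :> R by rewrite ltr0n.
have e0 : 0 < e by rewrite divr_gt0 ?mulr_gt0.
have eM : e * M%:R = 2 * B by rewrite divfK ?gt_eqF.
have eh k t : e <= h k t.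
  rewrite ler_pdivrMr // [leRHS]mulrC -ler_pdivrMr //.
  apply: le_trans (ltW (truncnS_gt _)) _; rewrite ler_nat ltnW // ltnS.
  by rewrite (bigD1 k) //= (bigD1 t) //= -addnA leq_addr.
pose lo k t := c k t - h k t + B.
pose F k t := [pred z : 'I_M | lo k t < e * z.+1%:R <= lo k t + h k t * 2].
have cnt k t : h k t / e <= (#|F k t|)%:R.
  have := hB k t; have := ler_norm (c k t); have := ler_norm (- c k t).
  rewrite normrN => *; apply: card_lattice_interval => //.
    by rewrite /lo; lra.
  by rewrite eM /lo; lra.
(* A lattice point lies in at most one box, since two boxes are separated in some coordinate. *)
have disj : \sum_k (#|family (F k)|)%:R <= (M ^ #|T|)%:R :> R.
  have -> : (M ^ #|T|)%N = #|{: {ffun T -> 'I_M}}| by rewrite card_ffun card_ord.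
  rewrite -natr_sum ler_nat.
  under eq_bigr do rewrite -sum1_card big_mkcond /=.
  rewrite exchange_big /= -sum1_card; apply: leq_sum => z _.
  case: (pickP (fun k => z \in family (F k))) => [k zk|z0]; last first.
    by rewrite big1 // => k _; rewrite z0.
  rewrite (bigD1 k) //= zk big1 ?addn0 // => l lk; case: ifP => // zl.
  have [t ht] := hd _ _ lk.
  move/familyP/(_ t): zk; move/familyP/(_ t): zl; rewrite !inE /= /lo.
  move=> /andP[l1 l2] /andP[k1 k2]; exfalso.
  by move: ht; rewrite ler_normr => /orP[]; lra.
have h1 : \sum_k \prod_t (h k t / e) <= (M ^ #|T|)%:R.
  apply: le_trans disj; apply: ler_sum => k _; rewrite natr_card_family.
  by apply: ler_prod => t _; rewrite cnt divr_ge0 // ltW.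
have -> : \sum_k \prod_t h k t = e ^+ #|T| * \sum_k \prod_t (h k t / e).
  rewrite mulr_sumr; apply: eq_bigr => k _; rewrite -prodr_const -big_split /=.
  by apply: eq_bigr => t _; rewrite mulrC divfK ?gt_eqF.
have -> : (2 * B) ^+ #|T| = e ^+ #|T| * M%:R ^+ #|T| by rewrite -exprMn eM.
rewrite ler_pM2l ?exprn_gt0 //.
by apply: le_trans h1 _; rewrite natrX.
Qed.

End Packing.

(** * Translations as isometries of D *)

Section Translation.
Context {R : realType} {r : nat} {ns : nat -> nat} {alpha : nat -> R}
        {hyp : block_data r ns alpha}.
Local Notation V := (vec R r ns).
Local Notation D := (@Dmet R r ns alpha).
Implicit Types x y z : V.

Lemma vecP x y : (forall i j, x i j = y i j) -> x = y.
Proof.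
move=> h; apply/functional_extensionality_dep => i; apply/funext => j; exact: h.
Qed.

Lemma Dmet_shift2 a b t x y : D (shift a b t x) (shift a b t y) = D x y.
Proof.
apply: eq_bigr => i _; congr (Num.sqrt _ `^ _); apply: eq_bigr => j _.
by rewrite /shift opprD addrACA subrr addr0.
Qed.

Lemma shift_shift a b s t x : shift a b s (shift a b t x) = shift a b (t + s) x.
Proof. by apply: vecP => i j; rewrite /shift; case: ifP; rewrite ?addr0 ?addrA. Qed.

Lemma shift0 a b x : shift a b 0 x = x.
Proof. by apply: vecP => i j; rewrite /shift if_same addr0. Qed.

Definition block0 : 'I_r := Ordinal (ltnW (@blocks_ge2 _ _ _ _ hyp)).

Lemma Dmet_shift0 b t x : (b < ns 0)%N -> D x (shift 0 b t x) = `|t|.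
Proof.
by move=> bn; rewrite (@Dmet_shift _ _ _ _ hyp block0) // weight0 invr1 powRr1.
Qed.

Lemma le_Dmet_of_coord s x y (i : 'I_r) (j : 'I_(ns i)) : 0 <= s -> s `^ weight alpha i <= `|x i j - y i j| -> s <= D x y.
Proof.
move=> s0 h; rewrite leNgt; apply/negP => hD.
have := powR_lt (@weight_gt0 _ _ _ alpha hyp i) (Dmet_ge0 x y) hD.
by apply/negP; rewrite -leNgt (le_trans h) // coord_le_Dmet.
Qed.

End Translation.

(** * Tubes around segments of a leaf *)

Section Segment.
Context {R : realType} {r : nat} {ns : nat -> nat} {alpha : nat -> R}
        {hyp : block_data r ns alpha}.
Local Notation V := (vec R r ns).
Local Notation D := (@Dmet R r ns alpha).
Local Notation T := (idx r ns).
Local Notation n := (dimn r ns).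
Local Notation w t := (weight alpha (tag t)).
Implicit Types x y z : V.

Definition tube p b (l th : R) : set V :=
  [set z | exists t : R, 0 <= t <= l /\ D (shift 0 b t p) z <= th].

Let n0 : 0 < n%:R :> R.
Proof. by rewrite ltr0n (@dimn_gt0 _ _ _ _ hyp). Qed.

Let wgt0 (t : T) : 0 < w t.
Proof. exact: weight_gt0. Qed.

Let wge0 (t : T) : 0 <= w t.
Proof. exact: weight_ge0. Qed.

(** Put q = d / rho. If q <= 1 the summand 1 dominates q^w; otherwise the full product does, as its
    other factors are at least 1. The product compares the volumes of balls of radii d and rho. *)
Lemma prod_powR_young (d rho : R) (t : T) : 0 <= d -> 0 < rho ->
  d `^ w t <= rho `^ w t * (1 + \prod_(s : T) (d / rho) `^ w s).
Proof.
move=> d0 rho0.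
have P0 (Q : pred T) : 0 <= \prod_(s | Q s) (d / rho) `^ w s.
  by apply: prodr_ge0 => s _; exact: powR_ge0.
have -> : d `^ w t = rho `^ w t * (d / rho) `^ w t.
  have q0 : 0 <= d / rho by rewrite divr_ge0 // ltW.
  by rewrite -powRM ?(ltW rho0) // mulrC divfK ?gt_eqF.
rewrite ler_pM2l ?powR_gt0 //.
have q0 : 0 <= d / rho by rewrite divr_ge0 // ltW.
have [q1|q1] := leP (d / rho) 1.
  rewrite -[leLHS]addr0 lerD // ?P0 //.
  have <- : 1 `^ w t = 1 by rewrite powR1.
  exact: powR_le.
rewrite -[leLHS]add0r lerD // (bigD1 t) //= ler_peMr ?powR_ge0 //.
elim/big_ind: _ => // [x y x1 y1|s _]; first by rewrite mulr_ege1.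
have <- : 1 `^ w s = 1 by rewrite powR1.
by apply: powR_le => //; exact: ltW.
Qed.

(** * Parallel chains of grid points and the gaps between their images *)

Section Grid.
Variables (f : V -> V) (p : V) (b : nat) (l th H B rho : R) (N : nat).
Hypotheses (bn : (b < ns 0)%N) (th0 : 0 < th) (H1 : 1 <= H) (B0 : 0 < B)
  (rho0 : 0 < rho) (Nl : N%:R * rho = l).
Local Notation K := (tube p b l th).
Hypothesis fB : forall z, K z -> D (fun i j => 0) (f z) <= B.
Hypothesis fqs : forall x y z, K x -> K y -> K z ->
  D x y <= D x z -> D (f x) (f y) <= H * D (f x) (f z).
Hypothesis finj : forall x y, K x -> K y -> f x = f y -> x = y.

Definition on_axis (t : T) := ((tag t : nat) == 0%N) && ((tagged t : nat) == b).

(** Direction [b] of the first block is left to the chain index and gets one value; in the other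
    directions the size keeps the chains within [th] of the segment. *)
Definition grid_size (t : T) : nat :=
  if on_axis t then 1%N else (Num.trunc ((th / rho) `^ w t / n%:R)).+1.

Local Notation A := {dffun forall t : T, 'I_(grid_size t)}.

Definition grid_base (v : A) : V :=
  fun i j => @p i j + (v (Tagged (fun i : 'I_r => 'I_(ns i)) j))%:R * rho `^ weight alpha i.

(** The k-th point of the chain over [v], which is parallel to the segment. *)
Definition grid_pt (v : A) (k : nat) : V := shift 0 b (k%:R * rho) (grid_base v).

Lemma grid_size_axis t : on_axis t -> grid_size t = 1%N.
Proof. by rewrite /grid_size => ->. Qed.

Lemma grid_base_near v : D p (grid_base v) <= th.
Proof.
apply: Dmet_le_coord; first exact: ltW.
move=> i j; rewrite /grid_base opprD addrA subrr add0r normrN.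
set t := Tagged (fun i : 'I_r => 'I_(ns i)) j.
rewrite ger0_norm ?mulr_ge0 ?powR_ge0 //.
move: (ltn_ord (v t)); move: (nat_of_ord (v t)) => m; rewrite /grid_size; case: ifP => _.
  by rewrite ltnS leqn0 => /eqP->; rewrite mul0r divr_ge0 ?powR_ge0 ?(ltW n0).
rewrite ltnS => vt.
have : m%:R <= (th / rho) `^ weight alpha i / n%:R.
  apply: (@le_trans _ _ (Num.trunc ((th / rho) `^ weight alpha i / n%:R))%:R).
    by rewrite ler_nat.
  by rewrite truncn_le divr_ge0 ?powR_ge0 ?(ltW n0).
move=> /(ler_wpM2r (powR_ge0 rho (weight alpha i)))/le_trans; apply.
by rewrite mulrAC -powRM ?divr_ge0 ?(ltW th0) ?(ltW rho0) // divfK ?gt_eqF.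
Qed.

Lemma grid_pt_near v k : D (shift 0 b (k%:R * rho) p) (grid_pt v k) <= th.
Proof. by rewrite Dmet_shift2 grid_base_near. Qed.

Lemma grid_pt_tube v k : (k <= N)%N -> K (grid_pt v k).
Proof.
move=> kN; exists (k%:R * rho); split; last exact: grid_pt_near.
by rewrite mulr_ge0 ?(ltW rho0) //= -Nl ler_pM2r // ler_nat.
Qed.

Lemma grid_ptS v k : grid_pt v k.+1 = shift 0 b rho (grid_pt v k).
Proof. by rewrite /grid_pt shift_shift -natr1 mulrDl mul1r. Qed.

Lemma grid_step v k : D (grid_pt v k) (grid_pt v k.+1) = rho.
Proof. by rewrite grid_ptS Dmet_shift0 // gtr0_norm. Qed.

Lemma dist_natr_ge1 (a c : nat) : a != c -> 1 <= `|a%:R - c%:R| :> R.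
Proof.
wlog ac : a c / (a < c)%N => [hw ac|_].
  move: (ac); rewrite neq_ltn => /orP[h|h]; first exact: hw.
  by rewrite distrC hw // eq_sym.
rewrite distrC ler_normr; apply/orP; left.
by rewrite -natrB ?ler1n ?subn_gt0 // ltnW.
Qed.

(** Within a chain the points differ by multiples of rho along the axis; different chains differ by
    a grid step in a coordinate off the axis, which [shift] leaves alone. *)
Lemma grid_sep v k v' k' : (v, k) != (v', k') -> rho <= D (grid_pt v k) (grid_pt v' k').
Proof.
have axis0 (u : A) t : on_axis t -> (u t : nat) = 0%N.
  move=> ta; move: (ltn_ord (u t)); move: (nat_of_ord (u t)) => m.
  by rewrite grid_size_axis // ltnS leqn0 => /eqP.
have [-> hk|vv _] := eqVneq v v'.
  have {}hk : k != k' by move: hk; rewrite xpair_eqE eqxx.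
  apply: (@le_Dmet_of_coord _ _ _ _ hyp _ _ _ block0 (Ordinal bn)); first exact: ltW.
  rewrite /grid_pt /shift /= eqxx /= weight0 powRr1 ?(ltW rho0) //.
  rewrite opprD addrACA subrr add0r -mulrBl normrM (gtr0_norm rho0).
  by rewrite ler_peMl ?(ltW rho0) // dist_natr_ge1.
have [t vt] : exists t, v t != v' t.
  apply: contrapT => h; move/eqP: vv; apply; apply/ffunP => t.
  by apply/eqP; apply: contrapT => /negP ht; apply: h; exists t.
have ta : ~~ on_axis t.
  by apply: contra vt => ta; rewrite -val_eqE /= !axis0.
case: t vt ta => i j vt ta.
apply: (@le_Dmet_of_coord _ _ _ _ hyp _ _ _ i j); first exact: ltW.
move: ta; rewrite /on_axis /= => /negbTE ta.
rewrite /grid_pt /shift ta !addr0 /grid_base opprD addrACA subrr add0r -mulrBl normrM.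
rewrite [X in _ * X]ger0_norm ?powR_ge0 // ler_peMl ?powR_ge0 //.
by apply: dist_natr_ge1; rewrite val_eqE.
Qed.

Definition grid_gap (a : A * 'I_N) : R :=
  D (f (grid_pt a.1 a.2)) (f (grid_pt a.1 a.2.+1)).

Lemma grid_gap_gt0 a : 0 < grid_gap a.
Proof.
case: a => v k; apply: Dmet_gt0.
have kN : (k < N)%N := ltn_ord k.
move=> /finj h.
have := grid_step v k; rewrite -h; last first.
- exact: grid_pt_tube.
- by apply: grid_pt_tube; exact: ltnW.
by rewrite Dmet_refl => e; move: rho0; rewrite -e ltxx.
Qed.

Lemma grid_gap_le a : grid_gap a <= 2 * B.
Proof.
case: a => v k; have kN : (k < N)%N := ltn_ord k.
apply: le_trans (Dmet_triangle (fun i j => 0) _ _) _; rewrite /= DmetC.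
rewrite mulr_natl mulr2n.
by apply: lerD; apply: fB; apply: grid_pt_tube => //; exact: ltnW.
Qed.

(** The next point of the chain is at distance rho and no other grid point is closer; quasisymmetry
    carries this comparison to the images. *)
Lemma grid_gap_sep a a' : a != a' ->
  grid_gap a <= H * D (f (grid_pt a.1 a.2)) (f (grid_pt a'.1 a'.2)).
Proof.
case: a a' => v k [v' k'] aa; have kN : (k < N)%N := ltn_ord k.
have kN' : (k' < N)%N := ltn_ord k'.
apply: fqs; rewrite ?grid_step; try by apply: grid_pt_tube => //; exact: ltnW.
by apply: grid_sep.
Qed.

(** The volume of a cube that contains all the boxes of [grid_volume]; summing over the coordinates
    gives one half-side that serves for all. *)
Definition volume_bound : R :=
  (2 * (\sum_(t : T) (B `^ w t + (2 * B) `^ w t) + 1)) ^+ #|{: T}|.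

(** About each image point lies a box of half-sides (gap / (2H))^w / (2n). Two image points are more
    than m / (2H) apart, m being the larger gap, so some coordinate differs by more than (m /
    (2H))^w / n, and half of this is available to each box. *)
Lemma grid_volume :
  \sum_(a : A * 'I_N) \prod_(t : T) ((grid_gap a / (2 * H)) `^ w t / (2 * n%:R)) <= volume_bound.
Proof.
have H0 : 0 < H by exact: lt_le_trans H1.
have HH : 0 < 2 * H by rewrite mulr_gt0.
have nn : 0 < 2 * n%:R :> R by rewrite mulr_gt0.
have n1 : 1 <= n%:R :> R by rewrite ler1n (@dimn_gt0 _ _ _ _ hyp).
have := @box_packing R T (A * 'I_N)%type
  (fun a t => (@f (grid_pt a.1 a.2) : V) (tag t) (tagged t))
  (fun a t => (grid_gap a / (2 * H)) `^ w t / (2 * n%:R))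
  (\sum_(t : T) (B `^ w t + (2 * B) `^ w t) + 1); apply.
- by rewrite ltr_wpDl // sumr_ge0 // => t _; rewrite addr_ge0 ?powR_ge0.
- by move=> a t; rewrite divr_gt0 ?powR_gt0 ?divr_gt0 ?grid_gap_gt0.
- move=> a t.
  have kN : (a.2 < N)%N := ltn_ord a.2.
  apply: (@le_trans _ _ (B `^ w t + (2 * B) `^ w t)); last first.
    rewrite (bigD1 t) //= -addrA lerDl addr_ge0 // sumr_ge0 // => s _.
    by rewrite addr_ge0 ?powR_ge0.
  apply: lerD.
    have := coord_le_blocknorm (fun i j => 0) (f (grid_pt a.1 a.2)) (tagged t).
    rewrite sub0r normrN => /le_trans; apply; apply: blocknorm_le_of_Dmet.
    by apply: fB; apply: grid_pt_tube; exact: ltnW.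
  rewrite ler_pdivrMr //.
  apply: (@le_trans _ _ ((2 * B) `^ w t)); last first.
    by rewrite ler_peMr ?powR_ge0 //; lra.
  apply: powR_le => //; first by rewrite divr_ge0 ?(ltW HH) // ltW // grid_gap_gt0.
  rewrite ler_pdivrMr //; apply: le_trans (grid_gap_le a) _.
  have H2 : 1 <= 2 * H by apply: le_trans H1 _; rewrite mulr_natl mulr2n lerDl ltW.
  have B2 : 0 <= 2 * B by rewrite mulr_ge0 // ltW.
  by rewrite ler_peMr.
- move=> a a' aa.
  set m := Num.max (grid_gap a) (grid_gap a').
  set dd := D (f (grid_pt a.1 a.2)) (f (grid_pt a'.1 a'.2)).
  have m0 : 0 < m by rewrite lt_max grid_gap_gt0.
  have mH : m <= H * dd.
    rewrite ge_max grid_gap_sep //= /dd DmetC grid_gap_sep // eq_sym //.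
  have md : m / (2 * H) < dd.
    have Hd : 0 < H * dd := lt_le_trans m0 mH.
    rewrite ltr_pdivrMr //; apply: le_lt_trans mH _.
    by rewrite [2 * H]mulrC mulrA [dd * H]mulrC ltr_pMr ?ltr1n.
  have [i [j hij]] := exists_coord_ge (divr_ge0 (ltW m0) (ltW HH)) md.
  exists (Tagged (fun i : 'I_r => 'I_(ns i)) j) => /=; apply: ltW; apply: le_lt_trans hij.
  have part c : c <= m -> 0 < c -> (c / (2 * H)) `^ weight alpha i / (2 * n%:R)
      <= (m / (2 * H)) `^ weight alpha i / n%:R / 2.
    move=> cm c0; rewrite -[leRHS]mulrA -invfM [n%:R * 2]mulrC ler_pM2r ?invr_gt0 //.
    apply: powR_le; rewrite ?weight_ge0 //.
      by rewrite divr_ge0 // ltW.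
    by rewrite ler_pM2r ?invr_gt0.
  have := lerD (part _ _ (grid_gap_gt0 a)) (part _ _ (grid_gap_gt0 a')).
  rewrite -splitr => -> //; by rewrite /m le_max lexx ?orbT.
Qed.

Definition card_factor : R :=
  4 * H * n%:R * \prod_(t : T | ~~ on_axis t) ((2 * H / th) `^ w t * (2 * n%:R ^+ 2)).

Lemma card_grid : (#|{: A}|)%:R = \prod_(t : T) (grid_size t)%:R :> R.
Proof.
rewrite card_dep_ffun foldrE big_image /= natr_prod.
by apply: eq_bigr => t _; rewrite card_ord.
Qed.

(** Each coordinate off the axis contributes rho^-w, at most a constant times [grid_size]; the axis
    has weight 1 and contributes 1 / rho. *)
Lemma card_grid_ge :
  \prod_(t : T) ((2 * H / rho) `^ w t * (2 * n%:R)) <= (#|{: A}|)%:R * (card_factor / rho).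
Proof.
have H0 : 0 < H by exact: lt_le_trans H1.
pose t0 : T := Tagged (fun i : 'I_r => 'I_(ns i)) (Ordinal bn : 'I_(ns (@block0 _ _ _ _ hyp))).
have ax0 : on_axis t0 by rewrite /on_axis /= !eqxx.
have axE t : on_axis t = (t == t0).
  apply/idP/eqP => [|->//]; case: t => i j /andP[/= /eqP hi /eqP hj].
  have ei : i = @block0 _ _ _ _ hyp by apply: val_inj.
  by subst i; congr existT; apply: val_inj.
rewrite card_grid (bigD1 t0) //= [X in _ <= X * _](bigD1 t0) //= grid_size_axis // mul1r.
rewrite weight0 powRr1 ?divr_ge0 ?mulr_ge0 ?(ltW H0) ?(ltW rho0) //.
rewrite /card_factor.
have -> : \prod_(t : T | ~~ on_axis t) ((2 * H / th) `^ w t * (2 * n%:R ^+ 2)) =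
    \prod_(t : T | t != t0) ((2 * H / th) `^ w t * (2 * n%:R ^+ 2)).
  by apply: eq_bigl => t; rewrite axE.
rewrite (_ : _ * (_ / rho) = 2 * H / rho * (2 * n%:R) * (\prod_(t | t != t0) (grid_size t)%:R *
   \prod_(t | t != t0) ((2 * H / th) `^ w t * (2 * n%:R ^+ 2)))); last first.
  by field; rewrite gt_eqF.
have c0 : 0 < 2 * H / rho * (2 * n%:R).
  by apply: mulr_gt0; [apply: divr_gt0 => //|]; exact: mulr_gt0.
rewrite (ler_pM2l c0) -big_split /=.
apply: ler_prod => t tt; rewrite mulr_ge0 ?powR_ge0 ?mulr_ge0 ?(ltW n0) //=.
have gs : (th / rho) `^ w t / n%:R <= (grid_size t)%:R.
  rewrite /grid_size axE (negbTE tt); exact/ltW/truncnS_gt.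
have Q0 : 0 <= (2 * H / th) `^ w t * (2 * n%:R ^+ 2).
  by rewrite mulr_ge0 ?powR_ge0 ?mulr_ge0 ?exprn_ge0 ?ltW.
apply: le_trans (ler_wpM2r Q0 gs).
have -> : 2 * H / rho = (th / rho) * (2 * H / th).
  by field; rewrite !gt_eqF.
rewrite powRM ?divr_ge0 ?mulr_ge0 ?(ltW H0) ?(ltW th0) ?(ltW rho0) //.
rewrite le_eqVlt; apply/orP; left; apply/eqP; field; by rewrite gt_eqF.
Qed.

(** Apply [prod_powR_young] to each gap. The summands 1 give N rho^w = l rho^(w - 1) per chain; the
    products sum to rho^-Q times a bounded volume, and [card_grid_ge] bounds rho^-Q by the number of
    chains over rho. *)
Lemma grid_sum_le (t : T) : (0 < N)%N ->
  \sum_(a : A * 'I_N) grid_gap a `^ w t <=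
  (#|{: A}|)%:R * ((l + card_factor * volume_bound) * rho `^ (w t - 1)).
Proof.
move=> N0; have H0 : 0 < H by exact: lt_le_trans H1.
have step a : grid_gap a `^ w t <= rho `^ w t * (1 +
   \prod_(s : T) ((2 * H / rho) `^ w s * (2 * n%:R)) *
   \prod_(s : T) ((grid_gap a / (2 * H)) `^ w s / (2 * n%:R))).
  have g0 := ltW (grid_gap_gt0 a).
  apply: le_trans (prod_powR_young t g0 rho0) _.
  rewrite -big_split /= ler_pM2l ?powR_gt0 // lerD2l.
  rewrite le_eqVlt; apply/orP; left; apply/eqP; apply: eq_bigr => s _.
  rewrite mulrACA divff ?mulr1 ?gt_eqF ?mulr_gt0 // -powRM ?divr_ge0 ?mulr_ge0 ?(ltW H0) ?(ltW rho0) //.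
  by congr (_ `^ _); field; rewrite !gt_eqF.
apply: le_trans (ler_sum _ (fun a _ => step a)) _.
rewrite -mulr_sumr big_split /= -mulr_sumr sumr_const card_prod card_ord.
set P := \prod_s _; set S := \sum_a _; set nA := #|_|.
have P0 : 0 <= P by apply: prodr_ge0 => s _; rewrite mulr_ge0 ?powR_ge0 ?mulr_ge0 ?ltW.
have PS : P * S <= nA%:R * (card_factor / rho) * volume_bound.
  apply: ler_pM => //; last exact: grid_volume.
  - apply: sumr_ge0 => a _; apply: prodr_ge0 => s _.
    by rewrite divr_ge0 ?powR_ge0 ?mulr_ge0 ?ltW.
  - exact: card_grid_ge.
have -> : nA%:R * ((l + card_factor * volume_bound) * rho `^ (w t - 1)) =
    rho `^ w t * (nA%:R * N%:R + nA%:R * (card_factor / rho) * volume_bound).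
  rewrite -(mulr_powRB1 (ltW rho0) (wgt0 t)) -Nl; field; by rewrite gt_eqF.
by rewrite ler_pM2l ?powR_gt0 // -mulr_natl mulr1 natrM lerD2l.
Qed.

End Grid.

End Segment.

(** * Segments of leaves have their ends mapped into one leaf *)

Section SegmentLeaf.
Context {R : realType} {r : nat} {ns : nat -> nat} {alpha : nat -> R}
        {hyp : block_data r ns alpha}.
Local Notation V := (vec R r ns).
Local Notation D := (@Dmet R r ns alpha).

Lemma tube_sub (p : V) b (l th th' : R) : th' <= th ->
  @tube R r ns alpha p b l th' `<=` @tube R r ns alpha p b l th.
Proof. by move=> h z [t [t0 tz]]; exists t; split => //; exact: le_trans h. Qed.

Lemma natr_powR_small (l c a : R) : 0 < l -> 0 < c -> 0 < a ->
  exists2 N : nat, (0 < N)%N & (l / N%:R) `^ a <= c.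
Proof.
move=> l0 c0 a0; pose s := c `^ a^-1.
have s0 : 0 < s by exact: powR_gt0.
exists (Num.trunc (l / s)).+1 => //.
rewrite -[leRHS](@powRVK _ c a) ?(ltW c0) ?gt_eqF //.
apply: powR_le; first exact: ltW.
  by rewrite divr_ge0 ?(ltW l0).
rewrite ler_pdivrMr ?ltr0n // mulrC -ler_pdivrMr //.
exact/ltW/truncnS_gt.
Qed.

(** Along each chain the coordinate [t] of the image changes by at least g / 2, since the ends have
    images within g / 4 of those of the segment; each step changes it by at most gap^w. Summing over
    the chains brings in [grid_sum_le]. *)
Lemma segment_gap_le (f : V -> V) (p : V) b (l th H B g : R) (t : idx r ns) N :
  (b < ns 0)%N -> 0 < l -> 0 < th -> 1 <= H -> 0 < B ->
  (forall z, @tube R r ns alpha p b l th z -> D (fun i j => 0) (f z) <= B) ->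
  (forall x y z, @tube R r ns alpha p b l th x -> @tube R r ns alpha p b l th y ->
     @tube R r ns alpha p b l th z -> D x y <= D x z -> D (f x) (f y) <= H * D (f x) (f z)) ->
  (forall x y, @tube R r ns alpha p b l th x -> @tube R r ns alpha p b l th y ->
     f x = f y -> x = y) ->
  (forall z, D p z <= th -> `|f z (tag t) (tagged t) - f p (tag t) (tagged t)| <= g / 4) ->
  (forall z, D (shift 0 b l p) z <= th ->
     `|f z (tag t) (tagged t) - f (shift 0 b l p) (tag t) (tagged t)| <= g / 4) ->
  g <= `|f (shift 0 b l p) (tag t) (tagged t) - f p (tag t) (tagged t)| ->
  (0 < N)%N ->
  g / 2 <= (l + @card_factor R r ns alpha b th H * @volume_bound R r ns alpha B)
           * (l / N%:R) `^ (weight alpha (tag t) - 1).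
Proof.
move=> bn l0 th0 H1 B0 fB fqs finj c0 c1 hg N0.
set rho := l / N%:R.
have rho0 : 0 < rho by rewrite divr_gt0 ?ltr0n.
have Nl : N%:R * rho = l by rewrite mulrC divfK ?pnatr_eq0 -?lt0n.
have := @grid_sum_le _ _ _ _ hyp _ _ _ _ _ _ _ _ _ bn th0 H1 B0 rho0 Nl fB fqs finj t N0.
pose A := {dffun forall t0 : idx r ns, 'I_(@grid_size R r ns alpha b th rho t0)}.
set C := (_ + _) * _ => hS.
have nA : 0 < (#|{: A}|)%:R :> R.
  rewrite card_grid; apply: prodr_gt0 => s _; rewrite ltr0n /grid_size.
  by case: ifP.
rewrite -(ler_pM2l nA); apply: le_trans hS.
have low (v : A) : g / 2 <= \sum_(k < N) grid_gap f p (v, k) `^ weight alpha (tag t).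
  pose y k := f (grid_pt p v k) (tag t) (tagged t).
  have e0 : `|y 0%N - f p (tag t) (tagged t)| <= g / 4.
    apply: c0; have := @grid_pt_near _ _ _ _ hyp p _ _ _ th0 rho0 v 0.
    by rewrite mulr0n mul0r shift0.
  have e1 : `|y N - f (shift 0 b l p) (tag t) (tagged t)| <= g / 4.
    by apply: c1; have := @grid_pt_near _ _ _ _ hyp p _ _ _ th0 rho0 v N; rewrite Nl.
  have tel : y N - y 0%N = \sum_(k < N) (y k.+1 - y k).
    by rewrite -(big_mkord xpredT (fun k => y k.+1 - y k)) telescope_sumr.
  apply: (@le_trans _ _ `|y N - y 0%N|).
    move: e0 e1 hg; set a := f p _ _; set c := f (shift _ _ _ _) _ _.
    rewrite !ler_norml => /andP[? ?] /andP[? ?].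
    by rewrite ler_normr => /orP[h|h]; rewrite ler_normr; apply/orP; [left|right]; lra.
  rewrite tel; apply: le_trans (ler_norm_sum _ _ _) _.
  by apply: ler_sum => k _; rewrite distrC; exact: coord_le_Dmet.
rewrite -(pair_bigA _ (fun v k => grid_gap f p (v, k) `^ weight alpha (tag t))) /=.
apply: le_trans (ler_sum _ (fun v _ => low v)).
by rewrite sumr_const mulr_natl.
Qed.

(* If the images of the ends of a segment in the first block were in different leaves,
   each of the parallel chains of the grid would have total gap bounded below, while
   the images of the grid balls are disjoint, so have bounded total volume. *)
Lemma segment_same_leaf (f : V -> V) (p : V) b (l th H B : R) :
  (b < ns 0)%N -> 0 < l -> 0 < th -> 1 <= H -> 0 < B ->
  (forall z, @tube R r ns alpha p b l th z -> D (fun i j => 0) (f z) <= B) ->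
  (forall x y z, @tube R r ns alpha p b l th x -> @tube R r ns alpha p b l th y ->
     @tube R r ns alpha p b l th z -> D x y <= D x z -> D (f x) (f y) <= H * D (f x) (f z)) ->
  (forall x y, @tube R r ns alpha p b l th x -> @tube R r ns alpha p b l th y ->
     f x = f y -> x = y) ->
  (forall e, 0 < e -> exists2 e', 0 < e' & forall z, D p z <= e' -> D (f p) (f z) <= e) ->
  (forall e, 0 < e -> exists2 e', 0 < e' & forall z, D (shift 0 b l p) z <= e' ->
     D (f (shift 0 b l p)) (f z) <= e) ->
  same_leaf (f p) (f (shift 0 b l p)).
Proof.
move=> bn l0 th0 H1 B0 fB fqs finj c0 c1 i ip; apply/funext => j; apply: contrapT => ne.
set q := shift 0 b l p in c1 ne *.
pose g := `|f q i j - f p i j|.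
have g0 : 0 < g by rewrite normr_gt0 subr_eq0; apply/eqP => e; exact: ne.
have w1 : 1 < weight alpha i by apply: (@weight_gt1 _ _ _ _ hyp); rewrite ip ltn_ord.
have w0 : 0 < weight alpha i by exact: lt_trans w1.
have g4 : 0 < g / 4 by rewrite divr_gt0.
have d0 : 0 < (g / 4) `^ (weight alpha i)^-1 by exact: powR_gt0.
have [e1 e10 he1] := c0 _ d0; have [e2 e20 he2] := c1 _ d0.
(* The tube is thinned until the ends of all chains have images close to [f p] and [f q]. *)
pose th' := Num.min th (Num.min e1 e2).
have th'0 : 0 < th' by rewrite !lt_min th0 e10 e20.
have th'1 : th' <= th by rewrite ge_min lexx.
have th'2 : th' <= e1 by rewrite !ge_min lexx !orbT.
have th'3 : th' <= e2 by rewrite !ge_min lexx !orbT.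
have coord x y : D x y <= (g / 4) `^ (weight alpha i)^-1 -> `|y i j - x i j| <= g / 4.
  move=> h; rewrite distrC; apply: le_trans (coord_le_blocknorm _ _ _) _.
  have := @blocknorm_le_of_Dmet _ _ _ _ hyp _ _ i _ h.
  by rewrite powRVK ?(ltW g4) ?gt_eqF.
have sub z := @tube_sub p b l _ _ th'1 z.
have key N := @segment_gap_le f p b l th' H B g (Tagged (fun i : 'I_r => 'I_(ns i)) j) N
  bn l0 th'0 H1 B0 (fun z hz => fB z (sub z hz))
  (fun x y z hx hy hz => fqs x y z (sub x hx) (sub y hy) (sub z hz))
  (fun x y hx hy => finj x y (sub x hx) (sub y hy))
  (fun z hz => coord _ _ (he1 z (le_trans hz th'2)))
  (fun z hz => coord _ _ (he2 z (le_trans hz th'3))) (lexx _).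
move: key; set C := (l + _) => key.
(* [C2] is a positive bound of C; N then makes the right side of [key] at most g / 4 < g / 2. *)
pose C2 := Num.max C 1.
have C20 : 0 < C2 by rewrite lt_max ltr01 orbT.
have [||N N0 hN] := @natr_powR_small l (g / (4 * C2)) (weight alpha i - 1) l0.
- by rewrite divr_gt0 ?mulr_gt0.
- by rewrite subr_gt0.
have := key N N0 => /=.
set x := _ `^ _ in hN *.
have x0 : 0 <= x by exact: powR_ge0.
have Cx : C * x <= C2 * x by rewrite ler_wpM2r // le_max lexx.
have : C2 * x <= g / 4.
  apply: le_trans (ler_wpM2l (ltW C20) hN) _.
  by rewrite invfM mulrCA mulrA mulrACA divff ?gt_eqF // mulr1 mulrC.
by move=> h1 h2; lra.
Qed.

End SegmentLeaf.

(** * The Gromov boundary and its visual metrics *)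

Section Boundary.
Context {R : realType} {r : nat} {ns : nat -> nat} {alpha : nat -> R}
        {hyp : block_data r ns alpha}.
Local Notation V := (vec R r ns).
Local Notation P := (pt R r ns).
Local Notation D := (@Dmet R r ns alpha).
Local Notation o := (origin R r ns).
Local Notation N p := (peak alpha o p).
Local Notation H p := (expR (alpha 0%N * p.2)).
Local Notation zero := ((fun i j => 0) : V).
Implicit Types (p q : P) (x y : V) (s u : nat -> P).
Let a0 : 0 < alpha 0%N := @alpha0_gt0 _ _ _ _ hyp.

Lemma opeak_ge1 p : 1 <= N p.
Proof. by apply: le_trans (peak_ge_l o p); rewrite mulr0 expR0. Qed.

Lemma opeak_gt0 p : 0 < N p.
Proof. exact: peak_gt0. Qed.

Lemma peak_le_opeakD p q : peak alpha p q <= N p + N q.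
Proof.
have [p0 q0] := (ltW (opeak_gt0 p), ltW (opeak_gt0 q)).
apply: peak_le.
- apply: le_trans (Dmet_triangle zero _ _) _; rewrite DmetC.
  by apply: lerD; exact: (@peak_ge_Dmet _ _ _ alpha o).
- by apply: le_trans (peak_ge_r o p) _; rewrite lerDl.
- by apply: le_trans (peak_ge_r o q) _; rewrite lerDr.
Qed.

Lemma opeak_le p q : N q <= N p + peak alpha p q.
Proof.
have pk0 := ltW (@peak_gt0 _ _ _ alpha p q).
apply: peak_le.
- apply: le_trans (Dmet_triangle p.1 _ _) _.
  by apply: lerD; [exact: (@peak_ge_Dmet _ _ _ alpha o)|exact: peak_ge_Dmet].
- by apply: le_trans (peak_ge_l o p) _; rewrite lerDl.
- by apply: le_trans (peak_ge_r p q) _; rewrite lerDr ltW ?opeak_gt0.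
Qed.

(** Equivalence of sequences in multiplicative form: up to a constant factor, peak / (N N) is the
    exponential of minus alpha_0 times the Gromov product. *)
Definition vanish s u := forall e : R, 0 < e -> exists K, forall i j,
  (K <= i)%N -> (K <= j)%N -> peak alpha (s i) (u j) <= e * (N (s i) * N (u j)).

Lemma seq_equivP s u : seq_equiv alpha s u <-> vanish s u.
Proof.
have arith3 (L a b c : R) : - L <= a + b - c -> c <= L + (a + b) by move=> *; lra.
have arith4 (L a b c : R) : c <= - L + (a + b) -> L <= a + b - c by move=> *; lra.
have [C hC] := @gprod_peak _ _ _ alpha hyp o.
have lnNN p q : ln (N p * N q) = ln (N p) + ln (N q) by rewrite lnM ?posrE ?opeak_gt0.
have NN0 p q : 0 < N p * N q by rewrite mulr_gt0 ?opeak_gt0.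
have lnpk p q e : 0 < e -> (peak alpha p q <= e * (N p * N q)) =
    (ln (peak alpha p q) <= ln e + (ln (N p) + ln (N q))).
  by move=> e0; rewrite -ler_ln ?posrE ?mulr_gt0 ?peak_gt0 ?opeak_gt0 // lnM ?posrE // lnNN.
have arith1 (g w L x : R) : g - w / alpha 0%N <= C -> C - L / alpha 0%N <= g ->
    w = x -> - L <= x.
  move=> h1 h2 <-; have : (- L) / alpha 0%N <= w / alpha 0%N by rewrite mulNr; lra.
  by rewrite ler_pM2r ?invr_gt0.
have arith2 (g w M : R) : - C <= g - w / alpha 0%N -> alpha 0%N * (M + C) <= w -> M <= g.
  move=> h1 h2; have : M + C <= w / alpha 0%N by rewrite ler_pdivlMr // mulrC.
  by lra.
split=> [h e e0|h M].
  have [K hK] := h (C - ln e / alpha 0%N); exists K => i j Ki Kj.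
  have := hK i j Ki Kj; have := hC (s i) (u j); rewrite ler_norml => /andP[_ h1] h2.
  by rewrite lnpk //; apply: arith3; exact: arith1 h1 h2 erefl.
have [|K hK] := h (expR (- (alpha 0%N * (M + C)))); first exact: expR_gt0.
exists K => i j Ki Kj; have := hK i j Ki Kj; rewrite lnpk ?expR_gt0 // expRK => h1.
have := hC (s i) (u j); rewrite ler_norml => /andP[h2 _].
exact: (arith2 _ _ _ h2 (arith4 _ _ _ _ h1)).
Qed.

Lemma vanishC s u : vanish s u -> vanish u s.
Proof.
move=> h e e0; have [K hK] := h e e0; exists K => i j Ki Kj.
by rewrite peakC [N _ * _]mulrC hK.
Qed.

(** With N (s i) <= B, vanishing gives peak <= N (u j) / 2, while N (u j) <= N (s i) + peak. *)
Lemma vanish_bounded s u (B : R) : 0 < B -> vanish s u ->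
  (forall K, exists2 i, (K <= i)%N & N (s i) <= B) ->
  exists K, forall j, (K <= j)%N -> N (u j) <= 2 * B.
Proof.
move=> B0 h hB; have [|K hK] := h (2 * B)^-1; first by rewrite invr_gt0 mulr_gt0.
exists K => j Kj; have [i Ki iB] := hB K.
have := hK i j Ki Kj; have := opeak_le (s i) (u j).
have : (2 * B)^-1 * (N (s i) * N (u j)) <= N (u j) / 2.
  have -> : (2 * B)^-1 * (N (s i) * N (u j)) = N (s i) / B * (N (u j) / 2).
    by move: (N (s i)) (N (u j)) => a b; field; rewrite gt_eqF.
  by rewrite ler_piMl ?divr_ge0 ?(ltW (opeak_gt0 _)) // ler_pdivrMr // mul1r.
by move: (N (u j)) (N (s i)) iB => a b; lra.
Qed.

Lemma div_mul_le (c a b A B : R) : 0 < c -> 0 < A -> 0 < B ->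
  0 <= a -> 0 <= b -> a <= A -> b <= B -> c / (A * B) * (a * b) <= c.
Proof.
move=> c0 A0 B0 a1 b1 aA bB.
by rewrite mulrAC ler_pdivrMr ?mulr_gt0 // ler_pM2l // ler_pM.
Qed.

(** In the upper half-space picture, with exp (alpha_0 t) as height, this is convergence to the
    point x of the bottom. *)
Definition to_pt x s := forall e : R, 0 < e -> exists K, forall i, (K <= i)%N ->
  D x (s i).1 <= e /\ H (s i) <= e.

Definition to_inf s := forall M : R, exists K, forall i, (K <= i)%N -> M <= N (s i).

(* [None] stands for xi_0 and [Some x] for the lower end of the geodesic gamma_x. *)
Definition lim_to (a : option V) s := if a is Some x then to_pt x s else to_inf s.

Lemma to_pt_vanish x s u : to_pt x s -> to_pt x u -> vanish s u.
Proof.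
move=> hs hu e e0; have e2 : 0 < e / 2 by rewrite divr_gt0.
have [K1 h1] := hs _ e2; have [K2 h2] := hu _ e2.
exists (maxn K1 K2) => i j; rewrite !geq_max => /andP[i1 _] /andP[_ j2].
have [a1 a2] := h1 i i1; have [b1 b2] := h2 j j2.
apply: (@le_trans _ _ e).
  apply: peak_le; try lra.
  by apply: le_trans (Dmet_triangle x _ _) _; rewrite DmetC; lra.
rewrite -[leLHS]mulr1 ler_pM2l // -[leLHS]mulr1.
by apply: ler_pM => //; exact: opeak_ge1.
Qed.

(** The peak is at most the sum of the two values of N, which is small against their product when
    both are large. *)
Lemma to_inf_vanish s u : to_inf s -> to_inf u -> vanish s u.
Proof.
move=> hs hu e e0.
have [K1 h1] := hs (2 / e); have [K2 h2] := hu (2 / e).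
exists (maxn K1 K2) => i j; rewrite !geq_max => /andP[i1 _] /andP[_ j2].
have := h1 i i1; have := h2 j j2; rewrite !ler_pdivrMr // => b1 a1.
apply: le_trans (peak_le_opeakD _ _) _.
have := opeak_gt0 (s i); have := opeak_gt0 (u j).
by move: (N (s i)) (N (u j)) a1 b1 => a b; nra.
Qed.

Lemma to_pt_bounded x s : to_pt x s ->
  exists K, forall i, (K <= i)%N -> N (s i) <= D zero x + 1.
Proof.
move=> hs; have [//|K hK] := hs 1; exists K => i /hK[h1 h2].
have d0 := @Dmet_ge0 _ _ _ alpha zero x.
apply: peak_le => /=.
- by apply: le_trans (Dmet_triangle x _ _) _; rewrite lerD2l.
- by rewrite mulr0 expR0 lerDr.
- by apply: le_trans h2 _; rewrite lerDr.
Qed.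

(** As [s] is eventually bounded, so is [u], hence the peak of the two tends to 0; it controls both
    D and the height of [u]. *)
Lemma vanish_to_pt x s u : to_pt x s -> vanish s u -> to_pt x u.
Proof.
move=> hs hv; set B := D zero x + 1.
have B1 : 1 <= B by rewrite lerDr Dmet_ge0.
have B0 : 0 < B by exact: lt_le_trans B1.
have [K0 hK0] := to_pt_bounded hs; rewrite -/B in hK0.
have [|K1 hK1] := vanish_bounded B0 hv.
  by move=> K; exists (maxn K K0); [exact: leq_maxl|apply: hK0; exact: leq_maxr].
move=> e e0; have e2 : 0 < e / 2 by rewrite divr_gt0.
have [K2 hK2] := hs _ e2.
have c0 : 0 < e / 2 / (B * (2 * B)) by rewrite !divr_gt0 // !mulr_gt0.
have [K3 hK3] := hv _ c0.
exists (maxn K1 K3) => j; rewrite geq_max => /andP[j1 j3].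
pose i := maxn K0 (maxn K2 K3).
have [i0 i2 i3] : [/\ (K0 <= i)%N, (K2 <= i)%N & (K3 <= i)%N].
  by rewrite /i !leq_max !leqnn !orbT.
have pk : peak alpha (s i) (u j) <= e / 2.
  apply: le_trans (hK3 i j i3 j3) _; apply: div_mul_le; rewrite ?mulr_gt0 ?(ltW (opeak_gt0 _)) //.
    exact: hK0.
  exact: hK1.
have [a1 _] := hK2 i i2; split.
  apply: le_trans (Dmet_triangle (s i).1 _ _) _.
  have := le_trans (@peak_ge_Dmet _ _ _ alpha (s i) (u j)) pk.
  by move: (D _ _) (D _ _) a1 => a b; lra.
by apply: le_trans (peak_ge_r (s i) (u j)) _; lra.
Qed.

Lemma not_to_inf s : ~ to_inf s ->
  exists2 B : R, 0 < B & forall K, exists2 i, (K <= i)%N & N (s i) <= B.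
Proof.
move=> h; apply: contrapT => h2; apply: h => M; apply: contrapT => h3.
apply: h2; exists (Num.max M 1); first by rewrite lt_max ltr01 orbT.
move=> K; apply: contrapT => h4; apply: h3; exists K => i Ki.
rewrite leNgt; apply/negP => h5; apply: h4; exists i => //.
by rewrite le_max (ltW h5).
Qed.

Lemma vanish_to_inf s u : to_inf s -> vanish s u -> to_inf u.
Proof.
move=> hs hv; apply: contrapT => /not_to_inf[B B0 hB].
have [K hK] := vanish_bounded B0 (vanishC hv) hB.
have [K' hK'] := hs (2 * B + 1).
have := hK _ (leq_maxl K K'); have := hK' _ (leq_maxr K K').
by move: (N _) => a; lra.
Qed.

(** The limit is obtained as the supremum of all eventual lower bounds. *)
Lemma Cauchy_real (f : nat -> R) :
  (forall e, 0 < e -> exists K, forall i j, (K <= i)%N -> (K <= j)%N -> `|f i - f j| <= e) ->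
  exists l, forall e, 0 < e -> exists K, forall i, (K <= i)%N -> `|l - f i| <= e.
Proof.
move=> hf; pose A := [set a : R | exists K, forall i, (K <= i)%N -> a <= f i].
exists (sup A) => e e0; have e2 : 0 < e / 2 by rewrite divr_gt0.
have [K hK] := hf _ e2; exists K => i Ki.
have lo : A (f i - e / 2).
  exists K => j Kj; have := hK i j Ki Kj; rewrite ler_norml => /andP[_]; lra.
have ub : ubound A (f i + e / 2).
  move=> a [K' ha]; have := ha _ (leq_maxr K K').
  have := hK _ i (leq_maxl K K') Ki; rewrite ler_norml => /andP[_].
  by move: (f (maxn _ _)) => z; lra.
have h1 : f i - e / 2 <= sup A by apply: ub_le_sup => //; exists (f i + e / 2).
have h2 : sup A <= f i + e / 2 by apply: ge_sup => //; exists (f i - e / 2).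
by rewrite ler_norml; apply/andP; split; lra.
Qed.

Lemma Dmet_complete (f : nat -> V) :
  (forall e, 0 < e -> exists K, forall i j, (K <= i)%N -> (K <= j)%N -> D (f i) (f j) <= e) ->
  exists x, forall e, 0 < e -> exists K, forall i, (K <= i)%N -> D x (f i) <= e.
Proof.
move=> hf.
have lim (i : 'I_r) (j : 'I_(ns i)) : exists l, forall e, 0 < e ->
    exists K, forall k, (K <= k)%N -> `|l - f k i j| <= e.
  apply: Cauchy_real => e e0.
  have w0 := @weight_gt0 _ _ _ alpha hyp i.
  have [K hK] := hf _ (powR_gt0 (weight alpha i)^-1 e0).
  exists K => k m Kk Km; apply: le_trans (coord_le_blocknorm _ _ _) _.
  have := @blocknorm_le_of_Dmet _ _ _ _ hyp _ _ i _ (hK k m Kk Km).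
  by rewrite powRVK ?(ltW e0) ?gt_eqF.
pose x : V := fun i j => sval (cid (lim i j)).
have hx i j : forall e, 0 < e -> exists K, forall k, (K <= k)%N -> `|x i j - f k i j| <= e.
  exact: svalP (cid (lim i j)).
exists x => e e0; pose n := dimn r ns.
have n0 : 0 < n%:R :> R by rewrite ltr0n (@dimn_gt0 _ _ _ _ hyp).
have c0 : 0 < e / (2 * n%:R) by rewrite divr_gt0 ?mulr_gt0.
have [K hK] := hf _ c0; exists K => k Kk.
apply: Dmet_le_coord; first exact: ltW.
move=> i j.
have w0 := @weight_gt0 _ _ _ alpha hyp i.
have w1 : 1 <= weight alpha i.
  by rewrite ler_pdivlMr // mul1r; exact: (@alpha_le _ _ _ alpha hyp).
have g0 : 0 < e `^ weight alpha i / n%:R / 2 by rewrite !divr_gt0 ?powR_gt0.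
(* [K'] depends on the coordinate, but enters only through the auxiliary index [maxn K K']; the
   bound holds for all k >= K. *)
have [K' hK'] := hx i j _ g0.
have := hK' _ (leq_maxr K K').
have := le_trans (coord_le_blocknorm _ _ j)
  (@blocknorm_le_of_Dmet _ _ _ _ hyp _ _ i _ (hK _ k (leq_maxl K K') Kk)).
have : (e / (2 * n%:R)) `^ weight alpha i <= e `^ weight alpha i / n%:R / 2.
  have q0 : 0 < (2 * n%:R)^-1 :> R by rewrite invr_gt0 mulr_gt0.
  rewrite powRM ?(ltW e0) ?(ltW q0) // -mulrA ler_pM2l ?powR_gt0 // -invfM.
  rewrite [n%:R * 2]mulrC; apply: ge1r_powR => //; rewrite q0 /=.
  rewrite invf_le1 ?mulr_gt0 //.
  have : 1 <= n%:R :> R by rewrite ler1n (@dimn_gt0 _ _ _ _ hyp).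
  by lra.
set g := _ / n%:R; set z := f (maxn _ _) i j; set y := f k i j; set xx := x i j.
set h := _ `^ _ => h1; rewrite -/xx !ler_norml => /andP[h2 h3] /andP[h4 h5].
by apply/andP; split; lra.
Qed.

(** If N does not tend to infinity, [s] is eventually bounded; then its peaks tend to 0, so the
    projections are Cauchy for D and the heights tend to minus infinity. *)
Lemma vanish_lim s : vanish s s -> exists a, lim_to a s.
Proof.
move=> hv; have [h|/not_to_inf[B B0 hB]] := pselect (to_inf s); first by exists None.
have [K hK] := vanish_bounded B0 hv hB.
have key e : 0 < e -> exists K, forall i j, (K <= i)%N -> (K <= j)%N ->
    peak alpha (s i) (s j) <= e.
  move=> e0; have c0 : 0 < e / ((2 * B) * (2 * B)) by rewrite divr_gt0 ?mulr_gt0.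
  have [K' hK'] := hv _ c0; exists (maxn K K') => i j.
  rewrite !geq_max => /andP[i1 i2] /andP[j1 j2]; apply: le_trans (hK' i j i2 j2) _.
  by apply: div_mul_le; rewrite ?mulr_gt0 ?(ltW (opeak_gt0 _)) ?hK.
have [|x hx] := @Dmet_complete (fun k => (s k).1).
  move=> e /key[K' hK']; exists K' => i j i1 j1.
  exact: le_trans (@peak_ge_Dmet _ _ _ alpha (s i) (s j)) (hK' i j i1 j1).
exists (Some x) => e e0; have [K1 h1] := hx e e0; have [K2 h2] := key e e0.
exists (maxn K1 K2) => i; rewrite geq_max => /andP[i1 i2]; split; first exact: h1.
exact: le_trans (peak_ge_l (s i) (s i)) (h2 i i i2 i2).
Qed.

Lemma lim_vanish a s u : lim_to a s -> lim_to a u -> vanish s u.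
Proof. by case: a => [x|]; [exact: to_pt_vanish|exact: to_inf_vanish]. Qed.

Lemma vanish_lim_to a s u : lim_to a s -> vanish s u -> lim_to a u.
Proof. by case: a => [x|]; [exact: vanish_to_pt|exact: vanish_to_inf]. Qed.

Lemma boundary_class a s : lim_to a s ->
  [set u | conv_inf alpha u /\ seq_equiv alpha s u] = [set u | lim_to a u].
Proof.
move=> hs; apply/seteqP; split=> u /=.
  by move=> [_ /seq_equivP]; exact: vanish_lim_to.
move=> hu; split; first by apply/seq_equivP; exact: (lim_vanish hu hu).
by apply/seq_equivP; exact: (lim_vanish hs hu).
Qed.

(** The vertical geodesics that define [ident] and [is_xi0]. *)
Definition model_seq (a : option V) : nat -> P :=
  fun k => if a is Some x then (x, - k%:R) else (zero, k%:R).

Lemma expR_natr_large (M : R) : exists K, forall k, (K <= k)%N -> M <= expR (alpha 0%N * k%:R).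
Proof.
exists (Num.trunc (M / alpha 0%N)).+1 => k hk.
apply: le_trans (expR_ge1Dx _); apply: (@le_trans _ _ (alpha 0%N * k%:R)); last by rewrite lerDr.
rewrite mulrC -ler_pdivrMr //; apply: le_trans (ltW (truncnS_gt _)) _.
by rewrite ler_nat.
Qed.

Lemma model_seq_lim a : lim_to a (model_seq a).
Proof.
case: a => [x e e0|M] /=.
  have [K hK] := expR_natr_large e^-1; exists K => k /hK h.
  rewrite Dmet_refl mulrN expRN; split; first exact: ltW.
  by rewrite -[leRHS]invrK lef_pV2 ?posrE ?expR_gt0 ?invr_gt0.
have [K hK] := expR_natr_large M; exists K => k /hK h.
by apply: le_trans h _; exact: (@peak_ge_r _ _ _ alpha o (zero, k%:R)).
Qed.

Lemma model_seq_conv a : conv_inf alpha (model_seq a).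
Proof.
by apply/seq_equivP; exact: (lim_vanish (model_seq_lim a) (model_seq_lim a)).
Qed.

Definition bpoint (a : option V) : bnd R r ns alpha :=
  exist _ [set u | conv_inf alpha u /\ seq_equiv alpha (model_seq a) u]
    (ex_intro _ (model_seq a) (conj (model_seq_conv a) erefl)).

Lemma seq_to_bpoint a s : seq_to s (bpoint a) <-> lim_to a s.
Proof.
have /(congr1 (fun S : set (nat -> P) => S s)) /= E := boundary_class (model_seq_lim a).
by rewrite /seq_to /= E.
Qed.

Lemma bpoint_surj (xi : bnd R r ns alpha) : exists a, xi = bpoint a.
Proof.
case: xi => S hS; have [s [cs SE]] := hS.
have [a ha] := vanish_lim (iffLR (seq_equivP s s) cs).
exists a; apply: eq_exist; rewrite SE (boundary_class ha).
by rewrite (boundary_class (model_seq_lim a)).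
Qed.

End Boundary.

(** * Visual metrics and the chordal form of D *)

Section Visual.
Context {R : realType} {r : nat} {ns : nat -> nat} {alpha : nat -> R}
        {hyp : block_data r ns alpha}.
Local Notation V := (vec R r ns).
Local Notation P := (pt R r ns).
Local Notation D := (@Dmet R r ns alpha).
Local Notation o := (origin R r ns).
Local Notation N p := (peak alpha o p).
Local Notation zero := ((fun i j => 0) : V).
Implicit Types (p q : P) (x y : V) (s u : nat -> P) (a b : option V).
Let a0 : 0 < alpha 0%N := @alpha0_gt0 _ _ _ _ hyp.

Definition vnorm (alpha : nat -> R) x : R := Num.max 1 (Dmet alpha zero x).

Lemma vnorm_ge1 x : 1 <= vnorm alpha x.
Proof. by rewrite le_max lexx. Qed.

Lemma vnorm_gt0 x : 0 < vnorm alpha x.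
Proof. exact: lt_le_trans (vnorm_ge1 x). Qed.

(* exp (- alpha 0 * Gromov product) of boundary points, up to a constant factor *)
Definition chord (alpha : nat -> R) a b : R :=
  match a, b with
  | Some x, Some y => Dmet alpha x y / (vnorm alpha x * vnorm alpha y)
  | Some x, None | None, Some x => (vnorm alpha x)^-1
  | None, None => 0
  end.

Lemma chord_gt0 a b : a <> b -> 0 < chord alpha a b.
Proof.
case: a b => [x|] [y|] //= h; rewrite ?invr_gt0 ?vnorm_gt0 //.
rewrite divr_gt0 ?mulr_gt0 ?vnorm_gt0 //; apply: Dmet_gt0 => e; apply: h.
by rewrite e.
Qed.

Lemma chord_refl a : chord alpha a a = 0.
Proof. by case: a => [x|] //=; rewrite Dmet_refl mul0r. Qed.

Lemma chord_ge0 a b : 0 <= chord alpha a b.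
Proof.
have [->|h] := pselect (a = b); first by rewrite chord_refl.
exact/ltW/chord_gt0.
Qed.

Lemma to_pt_opeak x s : to_pt (alpha := alpha) x s -> exists K, forall i, (K <= i)%N ->
  vnorm alpha x / 2 <= N (s i) <= 2 * vnorm alpha x.
Proof.
have arith (d1 d2 d3 nn : R) : d1 <= d2 + d3 -> d2 <= nn -> d3 <= 1 -> 1 <= nn ->
    d1 <= nn * 2 by move=> *; lra.
have arith1 (m : R) : 1 <= m -> 1 <= m * 2 by move=> *; lra.
move=> hs; have [//|K hK] := hs 1; exists K => i /hK[h1 h2].
have v1 := vnorm_ge1 x; have n1 := @opeak_ge1 _ _ _ alpha (s i).
have vD : D zero x <= vnorm alpha x by rewrite le_max lexx orbT.
apply/andP; split.
  rewrite ler_pdivrMr //.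
  have t := @Dmet_triangle _ _ _ alpha hyp (s i).1 zero x.
  have g : D zero (s i).1 <= N (s i) := @peak_ge_Dmet _ _ _ alpha o (s i).
  rewrite DmetC in h1.
  rewrite ge_max (arith _ _ _ _ t g h1 n1) andbT.
  exact: arith1.
have v2 : 1 + vnorm alpha x <= 2 * vnorm alpha x by rewrite mulr_natl mulr2n lerD2r.
apply: le_trans v2; apply: peak_le => /=.
- apply: le_trans (Dmet_triangle x _ _) _; rewrite addrC; exact: lerD.
- by rewrite mulr0 expR0 lerDl (le_trans _ v1).
- by apply: le_trans h2 _; rewrite lerDl (le_trans _ v1).
Qed.

Lemma ratio_bounds (pk n m d v w : R) : 0 < v -> 0 < w ->
  v / 2 <= n <= 2 * v -> w / 2 <= m <= 2 * w -> 0 < d -> d / 2 <= pk <= 2 * d ->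
  d / (v * w) / 8 <= pk / (n * m) <= 8 * (d / (v * w)).
Proof.
move=> v0 w0 /andP[n1 n2] /andP[m1 m2] d0 /andP[p1 p2].
have n0 : 0 < n by lra.
have m0 : 0 < m by lra.
have vw : 0 < v * w by exact: mulr_gt0.
have nm : 0 < n * m by exact: mulr_gt0.
have up : n * m <= 4 * (v * w).
  have -> : 4 * (v * w) = (2 * v) * (2 * w) by ring.
  by apply: ler_pM; rewrite // ltW.
have lo : v * w / 4 <= n * m.
  have -> : v * w / 4 = (v / 2) * (w / 2) by field.
  by apply: ler_pM; rewrite // divr_ge0 // ltW.
apply/andP; split.
  rewrite ler_pdivlMr // mulrAC -mulrA mulrAC ler_pdivrMr // mulrC.
  have := ler_wpM2l (ltW d0) up; have := ler_wpM2r (ltW vw) p1.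
  by move: (v * w) (n * m) => a b; lra.
rewrite ler_pdivrMr // mulrA mulrAC ler_pdivlMr //.
have := ler_wpM2l (ltW d0) lo; have := ler_wpM2r (ltW vw) p2.
by move: (v * w) (n * m) => a b; lra.
Qed.

(** Once both sequences are within D x y / 4 of their limits, in D and in height, the peak lies
    between D x y / 2 and 2 D x y. *)
Lemma peak_chord_pp x y s u : x <> y -> to_pt (alpha := alpha) x s -> to_pt (alpha := alpha) y u ->
  exists K, forall i j, (K <= i)%N -> (K <= j)%N ->
    chord alpha (Some x) (Some y) / 8 <= peak alpha (s i) (u j) / (N (s i) * N (u j))
      <= 8 * chord alpha (Some x) (Some y).
Proof.
have A1 (d su xs uy m : R) : xs <= d / 4 -> uy <= d / 4 -> d <= xs + (su + uy) ->
   su <= m -> d / 2 <= m by move=> *; lra.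
have A2 (d su xs uy : R) : 0 < d -> xs <= d / 4 -> uy <= d / 4 -> su <= xs + (d + uy) ->
   su <= 2 * d by move=> *; lra.
have A3 (d e : R) : 0 < d -> e <= d / 4 -> e <= 2 * d by move=> *; lra.
move=> xy hs hu; have d0 : 0 < D x y by exact: Dmet_gt0.
have e0 : 0 < D x y / 4 by rewrite divr_gt0.
have [K1 h1] := to_pt_opeak hs; have [K2 h2] := to_pt_opeak hu.
have [K3 h3] := hs _ e0; have [K4 h4] := hu _ e0.
exists (maxn (maxn K1 K2) (maxn K3 K4)) => i j.
rewrite !geq_max => /andP[/andP[i1 _] /andP[i3 _]] /andP[/andP[_ j2] /andP[_ j4]].
apply: ratio_bounds => //; rewrite ?vnorm_gt0 //; first exact: h1; first exact: h2.
have [a1 a2] := h3 i i3; have [b1 b2] := h4 j j4.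
have t1 := @Dmet_triangle _ _ _ alpha hyp (s i).1 x y.
have t2 := @Dmet_triangle _ _ _ alpha hyp (u j).1 (s i).1 y.
have t3 := @Dmet_triangle _ _ _ alpha hyp x (s i).1 (u j).1.
have t4 := @Dmet_triangle _ _ _ alpha hyp y x (u j).1.
have pk := @peak_ge_Dmet _ _ _ alpha (s i) (u j).
apply/andP; split.
  rewrite [D (u j).1 y]DmetC in t2.
  exact: (A1 _ _ _ _ _ a1 b1 (le_trans t1 (lerD (lexx _) t2)) pk).
rewrite [D (s i).1 x]DmetC in t3.
apply: peak_le; [|exact: A3 d0 a2|exact: A3 d0 b2].
exact: (A2 _ _ _ _ d0 a1 b1 (le_trans t3 (lerD (lexx _) t4))).
Qed.

(** Once N (u j) >= 4 [vnorm] x, the peak is comparable to N (u j), which then cancels. *)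
Lemma peak_chord_pi x s u : to_pt (alpha := alpha) x s -> to_inf (alpha := alpha) u ->
  exists K, forall i j, (K <= i)%N -> (K <= j)%N ->
    chord alpha (Some x) None / 8 <= peak alpha (s i) (u j) / (N (s i) * N (u j))
      <= 8 * chord alpha (Some x) None.
Proof.
have A1 (m : R) : 0 < m -> m / 2 <= m <= 2 * m by move=> *; apply/andP; split; lra.
have A2 (v n m pk : R) : 4 * v <= m -> v / 2 <= n <= 2 * v -> m <= n + pk -> pk <= n + m ->
  0 < v -> m / 2 <= pk <= 2 * m.
  by move=> ? /andP[? ?] ? ? ?; apply/andP; split; lra.
move=> hs hu.
have [K1 h1] := to_pt_opeak hs; have [K2 h2] := hu (4 * vnorm alpha x).
exists (maxn K1 K2) => i j; rewrite !geq_max => /andP[i1 _] /andP[_ j2].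
have := h1 i i1; have := h2 j j2 => m1 n12.
have l1 := @opeak_le _ _ _ alpha hyp (s i) (u j).
have l2 := @peak_le_opeakD _ _ _ alpha hyp (s i) (u j).
have v0 := vnorm_gt0 x.
have m0 : 0 < N (u j) := @peak_gt0 _ _ _ alpha o (u j).
have -> : chord alpha (Some x) None = N (u j) / (vnorm alpha x * N (u j)).
  by rewrite /= invfM mulrCA divff ?gt_eqF // mulr1.
apply: ratio_bounds => //.
  exact: A1.
exact: A2 m1 n12 l1 l2 v0.
Qed.

Lemma peak_chord a b s u : a <> b -> lim_to (alpha := alpha) a s -> lim_to (alpha := alpha) b u ->
  exists K, forall i j, (K <= i)%N -> (K <= j)%N ->
    chord alpha a b / 8 <= peak alpha (s i) (u j) / (N (s i) * N (u j)) <= 8 * chord alpha a b.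
Proof.
case: a b => [x|] [y|] // xy hs hu.
- by apply: peak_chord_pp => // e; apply: xy; rewrite e.
- exact: peak_chord_pi.
- have [K hK] := peak_chord_pi hu hs; exists K => i j Ki Kj.
  by rewrite peakC [N _ * _]mulrC; exact: hK.
Qed.

Lemma gprod_chord w : exists C : R, forall a b s u, a <> b ->
  lim_to (alpha := alpha) a s -> lim_to (alpha := alpha) b u ->
  exists K, forall i j, (K <= i)%N -> (K <= j)%N ->
    - ln (chord alpha a b) / alpha 0%N - C <= gprod alpha w (s i) (u j)
      <= - ln (chord alpha a b) / alpha 0%N + C.
Proof.
have A1 (a b c g n : R) : g <= n + c -> n <= a + b -> g <= a + (c + b) by move=> *; lra.
have A2 (a b c g n : R) : n - c <= g -> a - b <= n -> a - (c + b) <= g by move=> *; lra.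
have [C hC] := @gprod_peak _ _ _ alpha hyp w.
exists (C + ln 8 / alpha 0%N) => a b s u ab hs hu.
have [K hK] := peak_chord ab hs hu; exists K => i j Ki Kj.
have := hK i j Ki Kj => /andP[k1 k2].
have := hC (s i) (u j); rewrite ler_distl => /andP[g1 g2].
have c0 := chord_gt0 ab.
have n0 : 0 < N (s i) * N (u j) by rewrite mulr_gt0 ?peak_gt0.
have p0 := @peak_gt0 _ _ _ alpha (s i) (u j).
have E : (ln (N (s i)) + ln (N (u j)) - ln (peak alpha (s i) (u j))) / alpha 0%N =
   - ln (peak alpha (s i) (u j) / (N (s i) * N (u j))) / alpha 0%N.
  rewrite ln_div ?posrE // lnM ?posrE ?peak_gt0 //.
  by rewrite opprB.
rewrite E in g1 g2.
have q0 : 0 < peak alpha (s i) (u j) / (N (s i) * N (u j)) by rewrite divr_gt0.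
have q1 : 0 < chord alpha a b / 8 by rewrite divr_gt0.
have q2 : 0 < 8 * chord alpha a b by rewrite mulr_gt0.
rewrite -ler_ln ?posrE // in k1; rewrite -ler_ln ?posrE // in k2.
rewrite ln_div ?posrE // in k1; rewrite [ln (8 * _)]lnM ?posrE // in k2.
apply/andP; split.
  apply: A2 g1 _; rewrite -mulrBl ler_pM2r ?invr_gt0 // -opprD lerN2 [leRHS]addrC.
  exact: k2.
apply: A1 g2 _; rewrite -mulrDl ler_pM2r ?invr_gt0 // lerNl opprD opprK.
exact: k1.
Qed.

(** The bounds along sequences are uniform, so they survive the lower limit and the supremum; the
    model sequences give the supremum a member. *)
Lemma bgprod_chord w : exists C : R, forall a b, a <> b -> exists2 v : R,
  bgprod alpha w (bpoint a) (bpoint b) = v%:E &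
  - ln (chord alpha a b) / alpha 0%N - C <= v <= - ln (chord alpha a b) / alpha 0%N + C.
Proof.
have [C hC] := gprod_chord w; exists C => a b ab.
set L := _ - C; set U := _ + C.
have key s u : seq_to s (bpoint a) -> seq_to u (bpoint b) ->
    (L%:E <= liminf2 (fun i j => gprod alpha w (s i) (u j)) <= U%:E)%E.
  move=> /seq_to_bpoint hs /seq_to_bpoint hu.
  have [K hK] := hC a b s u ab hs hu; apply/andP; split.
    apply: (@le_trans _ _ (ereal_inf [set y : \bar R | exists i j, (K <= i)%N /\ (K <= j)%N /\
        y = (gprod alpha w (s i) (u j))%:E])%E).
      apply: le_ereal_inf_tmp => _ [i [j [Ki [Kj ->]]]]; rewrite lee_fin.
      by have /andP[] := hK i j Ki Kj.
    by apply: ereal_sup_ubound; exists K.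
  apply: ge_ereal_sup => _ [M _ <-].
  apply: (@le_trans _ _ (gprod alpha w (s (maxn M K)) (u (maxn M K)))%:E).
    apply: ereal_inf_lbound; exists (maxn M K), (maxn M K).
    by rewrite leq_maxl.
  by rewrite lee_fin; have /andP[] := hK _ _ (leq_maxr M K) (leq_maxr M K).
have hL : (L%:E <= bgprod alpha w (bpoint a) (bpoint b))%E.
  have sa : seq_to (model_seq a) (bpoint a) by apply/seq_to_bpoint; exact: model_seq_lim.
  have sb : seq_to (model_seq b) (bpoint b) by apply/seq_to_bpoint; exact: model_seq_lim.
  have /andP[h _] := key _ _ sa sb; apply: le_trans h _.
  by apply: ereal_sup_ubound; exists (model_seq a), (model_seq b).
have hU : (bgprod alpha w (bpoint a) (bpoint b) <= U%:E)%E.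
  apply: ge_ereal_sup => _ [s [u [hs [hu ->]]]].
  by have /andP[] := key _ _ hs hu.
case: (bgprod _ _ _ _) hL hU => [v||] //=.
by rewrite !lee_fin => h1 h2; exists v => //; rewrite h1 h2.
Qed.

(** The exponent is eps / alpha_0, since the chord is the exponential of minus alpha_0 times the
    Gromov product up to a factor. *)
Lemma visual_chord (d : bnd R r ns alpha -> bnd R r ns alpha -> R) : visual_metric d ->
  exists k C : R, [/\ 0 < k, 1 <= C & forall a b,
    chord alpha a b `^ k / C <= d (bpoint a) (bpoint b) <= C * chord alpha a b `^ k].
Proof.
move=> [[_ [d0 _]] [p [eps [eps0 hd]]]].
have [C hC] := bgprod_chord p.
exists (eps / alpha 0%N), (2 * expR (eps * `|C|)); split.
- by rewrite divr_gt0.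
- have : 1 <= expR (eps * `|C|) by rewrite -[leLHS]expR0 ler_expR mulr_ge0 // ltW.
  by lra.
(* On the diagonal all terms vanish because d is a metric; the Gromov product of a point with itself
   is not computed. *)
move=> a b; have [->|ab] := pselect (a = b).
  rewrite (iffRL (d0 _ _) erefl) chord_refl powR0 ?mul0r ?mulr0 ?lexx //.
  by rewrite gt_eqF // divr_gt0.
have [v hv /andP[v1 v2]] := hC a b ab.
have [h1 h2] := hd (bpoint a) (bpoint b); rewrite hv /= in h1 h2.
have c0 := chord_gt0 ab.
have E : chord alpha a b `^ (eps / alpha 0%N) = expR (- (eps * (- ln (chord alpha a b) / alpha 0%N))).
  rewrite /powR gt_eqF //; congr expR.
  by rewrite !mulrA mulrN !mulNr opprK mulrAC.
rewrite E; move: v1 v2; set L := - ln _ / _ => v1 v2.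
have nC := ler_norm C.
apply/andP; split.
  apply: le_trans h1; rewrite invfM mulrA mulrAC ler_pM2r ?invr_gt0 //.
  rewrite -expRN -expRD ler_expR -opprD lerN2 -mulrDr ler_pM2l //.
  by apply: le_trans v2 _; rewrite lerD2l.
apply: le_trans h2 _.
apply: (@le_trans _ _ (expR (- (eps * L)) * expR (eps * `|C|))).
  have h3 : eps * L <= eps * v + eps * `|C|.
    rewrite -mulrDr ler_pM2l // -lerBlDr; apply: le_trans v1.
    by rewrite lerD2l lerN2.
  by rewrite -expRD ler_expR lerNl opprD opprK lerBlDr.
by rewrite [leRHS]mulrC ler_pM2l ?expR_gt0 // ler_peMl ?expR_ge0 ?ler1n.
Qed.

End Visual.

(** * Leaf-preserving quasisymmetric maps *)

Section Bilipschitz.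
Context {R : realType} {r : nat} {ns : nat -> nat} {alpha : nat -> R}
        {hyp : block_data r ns alpha}.
Local Notation V := (vec R r ns).
Local Notation D := (@Dmet R r ns alpha).
Implicit Types (x y z : V) (s t c : R).

(** Quasisymmetry at the single ratio t, with c in the role of eta t, written without division. *)
Definition controlled (h : V -> V) t c := forall x y z,
  D x y <= t * D x z -> D (h x) (h y) <= c * D (h x) (h z).

Definition leafwise (h : V -> V) := forall x y, same_leaf x y -> same_leaf (h x) (h y).

Let r1 : (1 < r)%N := @blocks_ge2 _ _ _ _ hyp.
Let i1 : 'I_r := Ordinal r1.
Let b1 : (0 < ns i1)%N := @block_gt0 _ _ _ _ hyp i1 r1.
Let b0 : (0 < ns 0)%N := @block_gt0 _ _ _ _ hyp 0 (ltnW r1).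

Lemma same_leaf_sym x y : same_leaf x y -> same_leaf y x.
Proof. by move=> h i ip; rewrite h. Qed.

Lemma same_leaf_trans y x z : same_leaf x y -> same_leaf y z -> same_leaf x z.
Proof. by move=> h1 h2 i ip; rewrite h1 // h2. Qed.

Lemma same_leaf_shift0 b t x : same_leaf x (shift 0 b t x).
Proof.
move=> i ip; apply/funext => j; rewrite /shift; case: eqP => [e|_] /=; last by rewrite addr0.
by rewrite e in ip.
Qed.

(** The exponent makes the D-distance to x equal to s. *)
Definition off_leaf s x : V := shift 1 0 (s `^ weight alpha 1) x.

Lemma Dmet_off_leaf s x : 0 <= s -> D x (off_leaf s x) = s.
Proof.
move=> s0; rewrite /off_leaf (@Dmet_shift _ _ _ _ hyp i1) // ger0_norm ?powR_ge0 //.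
by rewrite powRK // (@weight_neq0 _ _ _ _ hyp i1).
Qed.

(** The blocks other than the first are constant along leaves, so parallel leaves keep their
    distance. *)
Lemma off_leaf_far x y z s : 0 <= s -> same_leaf x y -> same_leaf (off_leaf s x) z -> s <= D y z.
Proof.
move=> s0 xy xz; apply: (@le_Dmet_of_coord _ _ _ _ hyp _ _ _ i1 (Ordinal b1)) => //.
rewrite -xy // -xz // /off_leaf /shift /= opprD addrA subrr add0r normrN.
exact: ler_norm.
Qed.

(** The scale to which h carries the scale s near x; for a controlled map any other point at
    distance s from x gives a comparable value. *)
Definition stretch (h : V -> V) x s : R := D (h x) (h (off_leaf s x)).

Lemma stretch_ge0 h x s : 0 <= stretch h x s.
Proof. exact: Dmet_ge0. Qed.

(** * Growth of the stretch of one map *)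

Section OneMap.
Variables (h k : V -> V) (c : R).
Hypotheses (kK : cancel k h) (hK : cancel h k) (hc : controlled h 1 c) (c0 : 0 < c)
  (hl : leafwise h) (kl : leafwise k).

(* The image of the leaf at distance [s] lies at the same distance from all points of
   the image of the leaf of [x]. *)
Lemma stretch_leaf x y s : 0 <= s -> same_leaf x y -> stretch h y s <= c * stretch h x s.
Proof.
move=> s0 xy.
(* [w] lies in the image leaf and has the first block of [h y]; its other differences from [h y] are
   those between [h x] and [h (off_leaf s x)]. *)
pose w : V := fun i j => if (i : nat) == 0%N then @h y i j else @h (off_leaf s x) i j.
have ww : same_leaf (h (off_leaf s x)) w.
  by move=> i ip; apply/funext => j; rewrite /w gtn_eqF.
have zw : same_leaf (off_leaf s x) (k w) by rewrite -[off_leaf s x]hK; exact: kl.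
have far : D y (off_leaf s y) <= 1 * D y (k w).
  by rewrite mul1r Dmet_off_leaf //; exact: off_leaf_far xy zw.
apply: le_trans (hc far) _; rewrite kK ler_pM2l //.
apply: Dmet_le => [|i]; first exact: stretch_ge0.
apply: le_trans (blocknorm_le_Dmet (h x) (h (off_leaf s x)) i).
apply: ler_wsqrtr; apply: ler_sum => j _; rewrite /w; case: eqP => [_|/eqP i0].
  by rewrite subrr expr0n sqr_ge0.
by rewrite -(hl xy) // lt0n.
Qed.

(** By [stretch_leaf], each of the n steps of length s along the leaf has an image of size at most
    c^2 times the stretch at x. *)
Lemma chain_le x s n : 0 <= s ->
  D (h x) (h (shift 0 0 (n%:R * s) x)) <= n%:R * (c * c * stretch h x s).
Proof.
move=> s0; elim: n => [|n IH]; first by rewrite !mulr0n !mul0r shift0 Dmet_refl.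
set y := shift 0 0 (n%:R * s) x in IH.
have -> : shift 0 0 (n.+1%:R * s) x = shift 0 0 s y.
  by rewrite /y shift_shift -natr1 mulrDl mul1r.
have step : D (h y) (h (shift 0 0 s y)) <= c * c * stretch h x s.
  have near : D y (shift 0 0 s y) <= 1 * D y (off_leaf s y).
    by rewrite mul1r Dmet_off_leaf // Dmet_shift0 // ger0_norm.
  apply: le_trans (hc near) _; rewrite -mulrA ler_pM2l //.
  by apply: stretch_leaf => //; exact: same_leaf_shift0.
apply: le_trans (Dmet_triangle (h y) _ _) _.
by rewrite -natr1 mulrDl mul1r lerD.
Qed.

(** The point off the leaf at distance n s is traded for one in the leaf, which n steps of length s
    reach since the first block has weight 1. *)
Lemma stretch_mul_le x s n : 0 <= s -> stretch h x (n%:R * s) <= n%:R * (c ^+ 3 * stretch h x s).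
Proof.
move=> s0; have ns0 : 0 <= n%:R * s by rewrite mulr_ge0.
have near : D x (off_leaf (n%:R * s) x) <= 1 * D x (shift 0 0 (n%:R * s) x).
  by rewrite mul1r Dmet_off_leaf // Dmet_shift0 // ger0_norm.
apply: le_trans (hc near) _.
have -> : n%:R * (c ^+ 3 * stretch h x s) = c * (n%:R * (c * c * stretch h x s)) by ring.
by rewrite ler_pM2l // chain_le.
Qed.

End OneMap.

(** * Map and inverse together: the stretch is linear in the scale *)

Section TwoMaps.
Variables (f g : V -> V).
Hypotheses (fK : cancel f g) (gK : cancel g f) (fl : leafwise f) (gl : leafwise g).
Hypotheses (fq : forall t, 0 <= t -> exists2 c, 1 <= c & controlled f t c)
  (gq : forall t, 0 <= t -> exists2 c, 1 <= c & controlled g t c).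

Let c1_gt0 c : 1 <= c -> 0 < c.
Proof. exact: lt_le_trans. Qed.

(** This is [stretch_mul_le] for the inverse. With m the stretch of f at scale s, the map g has
    stretch at most c s at scale m, hence at most c^4 n s at scale n m; so f carries the scale n s
    to at least n m, up to a constant. *)
Lemma stretch_mul_ge : exists2 c, 1 <= c & forall x s n, 0 <= s ->
  n%:R * stretch f x s <= c * stretch f x (n%:R * s).
Proof.
have [c c1 hc] := gq ler01.
have c0 := c1_gt0 c1.
have [|c' c'1 hc'] := fq (t := c ^+ 4); first by rewrite exprn_ge0 // ltW.
exists c' => [|x s n s0]; first exact: c'1.
set m := stretch f x s.
have m0 : 0 <= m := stretch_ge0 f x s.
have nm0 : 0 <= n%:R * m by rewrite mulr_ge0.
have ns0 : 0 <= n%:R * s by rewrite mulr_ge0.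
have e1 : stretch g (f x) m <= c * s.
  have near : D (f x) (off_leaf m (f x)) <= 1 * D (f x) (f (off_leaf s x)).
    by rewrite Dmet_off_leaf // mul1r.
  by have := hc _ _ _ near; rewrite /stretch !fK Dmet_off_leaf.
have e2 := stretch_mul_le fK gK hc c0 gl fl (f x) n m0.
have e3 : D x (g (off_leaf (n%:R * m) (f x))) <= c ^+ 4 * D x (off_leaf (n%:R * s) x).
  rewrite Dmet_off_leaf //; move: e2; rewrite /stretch fK => /le_trans; apply.
  have -> : c ^+ 4 * (n%:R * s) = n%:R * (c ^+ 3 * (c * s)) by ring.
  rewrite ler_wpM2l // ler_wpM2l ?exprn_ge0 ?(ltW c0) //.
  by move: e1; rewrite /stretch fK.
by have := hc' _ _ _ e3; rewrite gK Dmet_off_leaf.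
Qed.

Lemma stretch_near : exists2 c, 1 <= c & forall x y s, D x y <= s ->
  stretch f y s <= c * stretch f x s.
Proof.
have [c c1 hc] := fq ler01; have [d d1 hd] := fq (ler0n R 2).
exists (c + d) => [|x y s xy]; first by rewrite -[leLHS]addr0 lerD // (le_trans _ d1).
have s0 : 0 <= s by exact: le_trans (Dmet_ge0 _ _) xy.
apply: le_trans (Dmet_triangle (f x) _ _) _; rewrite DmetC mulrDl; apply: lerD.
  by apply: hc; rewrite mul1r Dmet_off_leaf.
apply: hd; rewrite Dmet_off_leaf //; apply: le_trans (Dmet_triangle y _ _) _.
by rewrite Dmet_off_leaf // mulr_natl mulr2n lerD2r.
Qed.

Lemma exists_nat_between s t : 0 < s -> s <= t ->
  exists2 n, (0 < n)%N & t <= n%:R * s <= 2 * t.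
Proof.
move=> s0 st; have t0 : 0 < t by exact: lt_le_trans st.
exists (Num.trunc (t / s)).+1 => //; apply/andP; split.
  by rewrite -ler_pdivrMr //; exact/ltW/truncnS_gt.
have -> : 2 * t = t + t by rewrite mulr_natl mulr2n.
rewrite -natr1 mulrDl mul1r lerD // -ler_pdivlMr //.
by rewrite truncn_le divr_ge0 // ltW.
Qed.

(** At a scale n s >= D x y the stretches at x and y are comparable; [stretch_mul_ge] at y and
    [stretch_mul_le] at x bring this back to scale s. *)
Lemma stretch_uniform : exists2 c, 1 <= c & forall x y s, 0 < s ->
  stretch f y s <= c * stretch f x s.
Proof.
have [c c1 hc] := fq ler01; have [d d1 hd] := stretch_mul_ge; have [e e1 he] := stretch_near.
have c0 := c1_gt0 c1; have d0 := c1_gt0 d1; have e0 := c1_gt0 e1.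
exists (d * e * c ^+ 3) => [|x y s s0].
  by rewrite !mulr_ege1 // exprn_ege1.
pose t := Num.max s (D x y).
have st : s <= t by rewrite le_max lexx.
have [n n0 /andP[n1 _]] := exists_nat_between s0 st.
have xy : D x y <= n%:R * s by apply: le_trans n1; rewrite le_max lexx orbT.
have nr : 0 < n%:R :> R by rewrite ltr0n.
rewrite -(ler_pM2l nr); apply: le_trans (hd y s n (ltW s0)) _.
apply: le_trans (ler_wpM2l (ltW d0) (he x y _ xy)) _.
have := stretch_mul_le gK fK hc c0 fl gl x n (ltW s0).
move=> /(ler_wpM2l (ltW e0))/(ler_wpM2l (ltW d0))/le_trans; apply.
by rewrite le_eqVlt; apply/orP; left; apply/eqP; ring.
Qed.

(** The larger scale is replaced by a multiple of the smaller one, with [stretch_mul_le] if s <= t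
    and [stretch_mul_ge] if t <= s. *)
Lemma stretch_linear : exists2 c, 1 <= c & forall x s t, 0 < s -> 0 < t ->
  s * stretch f x t <= c * (t * stretch f x s).
Proof.
have [c c1 hc] := fq ler01; have [e e1 he] := fq (ler0n R 2).
have [d d1 hd] := stretch_mul_ge.
have c0 := c1_gt0 c1; have d0 := c1_gt0 d1; have e0 := c1_gt0 e1.
have C1 : 1 <= 2 * c ^+ 4 by rewrite mulr_ege1 ?ler1n ?exprn_ege1.
have C2 : 1 <= d * e by rewrite mulr_ege1.
exists (2 * c ^+ 4 + d * e) => [|x s t s0 t0].
  by rewrite -[leLHS]addr0 lerD // (le_trans _ C2).
have m0 := stretch_ge0 f x s.
have [st|/ltW ts] := leP s t.
  have [n n0 /andP[n1 n2]] := exists_nat_between s0 st.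
  have e3 : stretch f x t <= c * stretch f x (n%:R * s).
    by apply: hc; rewrite mul1r !Dmet_off_leaf ?(ltW t0) // mulr_ge0 // ltW.
  have e4 := stretch_mul_le gK fK hc c0 fl gl x n (ltW s0).
  have := le_trans e3 (ler_wpM2l (ltW c0) e4).
  move=> /(ler_wpM2l (ltW s0))/le_trans; apply.
  apply: (@le_trans _ _ (2 * c ^+ 4 * (t * stretch f x s))); last first.
    apply: (ler_wpM2r (mulr_ge0 (ltW t0) m0)); rewrite lerDl; exact: le_trans ler01 C2.
  have -> : s * (c * (n%:R * (c ^+ 3 * stretch f x s))) = n%:R * s * (c ^+ 4 * stretch f x s) by ring.
  have -> : 2 * c ^+ 4 * (t * stretch f x s) = 2 * t * (c ^+ 4 * stretch f x s) by ring.
  exact: (ler_wpM2r (mulr_ge0 (exprn_ge0 4 (ltW c0)) m0) n2).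
have [n n0 /andP[n1 n2]] := exists_nat_between t0 ts.
have e3 := hd x t n (ltW t0).
have nt0 : 0 <= n%:R * t by rewrite mulr_ge0 // ltW.
have e4 : stretch f x (n%:R * t) <= e * stretch f x s.
  by apply: he; rewrite !Dmet_off_leaf // ltW.
apply: le_trans (ler_wpM2r (stretch_ge0 f x t) n1) _.
apply: (@le_trans _ _ (d * e * (t * stretch f x s))); last first.
  apply: (ler_wpM2r (mulr_ge0 (ltW t0) m0)); rewrite lerDr; exact: le_trans ler01 C1.
have -> : n%:R * t * stretch f x t = t * (n%:R * stretch f x t) by ring.
have -> : d * e * (t * stretch f x s) = t * (d * (e * stretch f x s)) by ring.
rewrite (ler_pM2l t0); apply: le_trans e3 _.
exact: (ler_wpM2l (ltW d0) e4).
Qed.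

(** With s = D x y, the distance of the images is comparable to the stretch at x at scale s, then to
    that at a fixed point z, then to s m, where m is the stretch at z at scale 1. *)
Lemma bilipschitz : exists2 L, 1 <= L & forall x y,
  D x y / L <= D (f x) (f y) <= L * D x y.
Proof.
have [c c1 hc] := fq ler01; have [d d1 hd] := stretch_uniform; have [e e1 he] := stretch_linear.
have c0 := c1_gt0 c1; have d0 := c1_gt0 d1; have e0 := c1_gt0 e1.
pose z : V := fun i j => 0; pose m := stretch f z 1.
have m0 : 0 < m.
  apply: Dmet_gt0 => /(can_inj fK) h.
  by have := @Dmet_off_leaf 1 z ler01; rewrite -h Dmet_refl => /eqP; rewrite eq_sym oner_eq0.
have k0 : 0 < c * (d * e) by rewrite !mulr_gt0.
pose L := 1 + c * (d * e) * m + c * (d * e) / m.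
have a1 : 0 < c * (d * e) * m by rewrite mulr_gt0.
have a2 : 0 < c * (d * e) / m by rewrite divr_gt0.
have L1 : 1 <= L by rewrite /L -addrA lerDl ltW // addr_gt0.
have L0 := c1_gt0 L1.
exists L => [|x y]; first exact: L1.
have [->|xy] := pselect (x = y).
  by rewrite !Dmet_refl mul0r mulr0 lexx.
set s := D x y; have s0 : 0 < s by exact: Dmet_gt0.
have u1 : D (f x) (f y) <= c * stretch f x s by apply: hc; rewrite mul1r Dmet_off_leaf // ltW.
have u2 : stretch f x s <= c * D (f x) (f y) by apply: hc; rewrite mul1r Dmet_off_leaf // ltW.
have v1 := hd z x s s0; have v2 := hd x z s s0.
have w1' := he z 1 s ltr01 s0; have w2 := he z s 1 s0 ltr01.
rewrite mul1r -/m in w1'; rewrite mul1r -/m in w2.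
apply/andP; split.
  rewrite ler_pdivrMr //.
  have : s * m <= c * (d * e) * D (f x) (f y).
    apply: le_trans w2 _.
    have -> : c * (d * e) * D (f x) (f y) = e * (d * (c * D (f x) (f y))) by ring.
    rewrite (ler_pM2l e0); apply: le_trans v2 _; exact: (ler_wpM2l (ltW d0) u2).
  rewrite -ler_pdivlMr // => /le_trans; apply.
  rewrite mulrAC mulrC ler_wpM2l ?Dmet_ge0 //.
  by rewrite /L lerDr; exact: (addr_ge0 ler01 (ltW a1)).
apply: le_trans u1 _; apply: (@le_trans _ _ (c * (d * e) * m * s)); last first.
  apply: (ler_wpM2r (ltW s0)); rewrite /L addrAC lerDr.
  exact: (addr_ge0 ler01 (ltW a2)).
have -> : c * (d * e) * m * s = c * (d * (e * (s * m))) by ring.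
rewrite (ler_pM2l c0); apply: le_trans v1 _; exact: (ler_wpM2l (ltW d0) w1').
Qed.

End TwoMaps.

End Bilipschitz.

(** * Quasisymmetric maps of the boundary *)

Section QuasiMobius.
Variables (R : realType) (T : Type) (e : T -> T -> R).
Hypotheses (e_ge0 : forall a b, 0 <= e a b) (eC : forall a b, e a b = e b a)
  (e_triangle : forall b a c, e a c <= e a b + e b c).

Definition weak_qs (F : T -> T) := forall t : R, 0 <= t -> exists2 c : R, 1 <= c &
  forall x y z, e x y <= t * e x z -> e (F x) (F y) <= c * e (F x) (F z).

(** m, M and m', M' are the smaller and larger distances in two pairings of four points. If m > s
    m', then M' <= 3 M, and the product bound gives m <= 3 t m', a contradiction. *)
Lemma min_max_product (m M m' M' s t : R) : 0 <= m -> m <= M -> 0 <= m' -> 0 <= t ->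
  M' <= M + m + m' -> m * M <= t * (m' * M') -> s = 3 * t + 1 -> m <= s * m'.
Proof.
move=> m0 mM m'0 t0 hM h ->; rewrite leNgt; apply/negP => hm.
have m'm : m' <= m by nra.
have M3 : M' <= 3 * M by lra.
have mp : 0 < m by nra.
have Mp : 0 < M by lra.
have h1 : t * (m' * M') <= t * (m' * (3 * M)) by rewrite ler_wpM2l // ler_wpM2l.
have h2 : m * M <= (3 * t * m') * M by apply: le_trans h (le_trans h1 _); rewrite le_eqVlt; apply/orP; left; apply/eqP; ring.
move: h2; rewrite ler_pM2r // => h2; lra.
Qed.

(** By the triangle inequality a bound of the products gives one of the minima. The latter compares
    distances from a common point, so F preserves it; the triangle inequality for the images leads
    back to products. *)
Lemma cross_ratio_control (F : T -> T) : weak_qs F ->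
  forall t : R, 0 <= t -> exists2 c : R, 1 <= c & forall a b x y,
    e a b * e x y <= t * (e a x * e b y) ->
    e (F a) (F b) * e (F x) (F y) <= c * (e (F a) (F x) * e (F b) (F y)).
Proof.
move=> hF t t0.
have prodE (p q : R) : p * q = Num.min p q * Num.max p q.
  by case: leP => // _; rewrite mulrC.
have sumE (p q : R) : p + q = Num.min p q + Num.max p q.
  by case: leP => // _; rewrite addrC.
have minmax (p q : R) : 0 <= p -> 0 <= q -> 0 <= Num.min p q /\ Num.min p q <= Num.max p q.
  by move=> p0 q0; split; [rewrite le_min p0 q0|rewrite ge_min le_max lexx].
have [|c c1 hc] := hF (3 * t + 1); first by rewrite addr_ge0 ?mulr_ge0.
exists (3 * c ^+ 2) => [|a b x y h].
  by rewrite mulr_ege1 ?ler1n ?exprn_ege1.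
have max_le a' b' x' y' : Num.max (e a' x') (e b' y') <=
    Num.max (e a' b') (e x' y') + Num.min (e a' b') (e x' y') + Num.min (e a' x') (e b' y').
  rewrite [Num.max (e a' b') _ + _]addrC -sumE.
  have A1 : e b' y' <= e a' b' + e x' y' + e a' x'.
    apply: le_trans (e_triangle a' b' y') _; rewrite eC -addrA lerD2l addrC.
    exact: e_triangle.
  have A2 : e a' x' <= e a' b' + e x' y' + e b' y'.
    apply: le_trans (e_triangle b' a' x') _; rewrite -addrA lerD2l addrC [e x' y']eC.
    exact: e_triangle.
  by case: (leP (e a' x') (e b' y')).
have [m0 mM] := minmax _ _ (e_ge0 a b) (e_ge0 x y).
have [n0 nM] := minmax _ _ (e_ge0 a x) (e_ge0 b y).
have key : Num.min (e a b) (e x y) <= (3 * t + 1) * Num.min (e a x) (e b y).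
  apply: min_max_product m0 mM n0 t0 (max_le a b x y) _ erefl.
  by rewrite -!prodE.
have key' : Num.min (e (F a) (F b)) (e (F x) (F y)) <=
    c * Num.min (e (F a) (F x)) (e (F b) (F y)).
  have s0 : 0 <= 3 * t + 1 by rewrite addr_ge0 ?mulr_ge0.
  have k1 : Num.min (e a b) (e x y) <= (3 * t + 1) * e a x.
    by apply: le_trans key _; rewrite ler_wpM2l // ge_min lexx.
  have k2 : Num.min (e a b) (e x y) <= (3 * t + 1) * e b y.
    by apply: le_trans key _; rewrite ler_wpM2l // ge_min lexx orbT.
  rewrite ge_min; case: (leP (e (F a) (F x)) (e (F b) (F y))) => _.
    move: k1; rewrite ge_min => /orP[h1|h1]; first by rewrite (hc _ _ _ h1).
    rewrite [e a x]eC in h1; rewrite [e (F a) (F x)]eC.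
    by rewrite (hc _ _ _ h1) orbT.
  move: k2; rewrite ge_min => /orP[h1|h1].
    by rewrite [e a b]eC in h1; rewrite [e (F a) (F b)]eC (hc _ _ _ h1).
  rewrite [e x y]eC [e b y]eC in h1; rewrite [e (F x) (F y)]eC [e (F b) (F y)]eC.
  by rewrite (hc _ _ _ h1) orbT.
have [p0 pM] := minmax _ _ (e_ge0 (F a) (F b)) (e_ge0 (F x) (F y)).
have [q0 qM] := minmax _ _ (e_ge0 (F a) (F x)) (e_ge0 (F b) (F y)).
have := max_le (F a) (F x) (F b) (F y).
rewrite (prodE (e (F a) (F b))) (prodE (e (F a) (F x))).
move: p0 pM q0 qM key'; clear -c1.
move: (Num.min _ _) (Num.max _ _) (Num.min _ _) (Num.max _ _) => m M n K.
move=> p0 pM q0 qM key' hM.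
have M0 : 0 <= M by exact: le_trans qM.
have K3 : K <= 3 * c * M.
  have cm : c * m <= c * M by rewrite ler_wpM2l // (le_trans _ c1).
  have M1 : M <= c * M by rewrite ler_peMl.
  by rewrite -mulrA; lra.
have -> : 3 * c ^+ 2 * (m * M) = (c * m) * (3 * c * M) by ring.
by apply: ler_pM => //; exact: le_trans pM.
Qed.

End QuasiMobius.

(** * The map in coordinates: leaves, the fixed point xi_0, and control by D *)

Section Core.
Context {R : realType} {r : nat} {ns : nat -> nat} {alpha : nat -> R}
        {hyp : block_data r ns alpha}.
Local Notation V := (vec R r ns).
Local Notation X := (option V).
Local Notation D := (@Dmet R r ns alpha).
Local Notation vn := (@vnorm R r ns alpha).
Local Notation ch := (@chord R r ns alpha).
Local Notation zero := ((fun i j => 0) : V).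
Variables (e : X -> X -> R) (k C : R).
Hypotheses (e_ge0 : forall a b, 0 <= e a b) (eC : forall a b, e a b = e b a)
  (e_triangle : forall b a c, e a c <= e a b + e b c)
  (e_eq0 : forall a b, e a b = 0 <-> a = b)
  (k0 : 0 < k) (C1 : 1 <= C)
  (ech : forall a b, ch a b `^ k / C <= e a b <= C * ch a b `^ k).
Implicit Types (x y z : V) (a : X) (F G : X -> X) (s t c : R).

Let C0 : 0 < C.
Proof. exact: lt_le_trans C1. Qed.

Let kn0 : k != 0.
Proof. by rewrite gt_eqF. Qed.

Lemma ch_le_e a b : ch a b `^ k <= C * e a b.
Proof. by have /andP[h _] := ech a b; rewrite mulrC -ler_pdivrMr. Qed.

Lemma e_le_ch a b : e a b <= C * ch a b `^ k.
Proof. by have /andP[] := ech a b. Qed.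

Lemma powR_le_root s t : 0 <= s -> 0 <= t -> s `^ k <= t -> s <= t `^ k^-1.
Proof.
move=> s0 t0 h; rewrite -[leLHS](@powRK _ s k) //.
by apply: powR_le; rewrite ?powR_ge0 // invr_ge0 ltW.
Qed.

Lemma ch_le_e_mul a b a' b' t : 0 <= t -> e a b <= t * e a' b' ->
  ch a b <= (C ^+ 2 * t) `^ k^-1 * ch a' b'.
Proof.
move=> t0 h.
have c0 := @chord_ge0 _ _ _ alpha hyp a b; have c0' := @chord_ge0 _ _ _ alpha hyp a' b'.
have Ct : 0 <= C ^+ 2 * t by rewrite mulr_ge0 // exprn_ge0 // ltW.
rewrite -[X in _ * X](@powRK _ _ k) // -powRM ?powR_ge0 //.
apply: powR_le_root => //; first by rewrite mulr_ge0 ?powR_ge0.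
apply: le_trans (ch_le_e a b) _.
have -> : C ^+ 2 * t * ch a' b' `^ k = C * (t * (C * ch a' b' `^ k)) by ring.
rewrite ler_pM2l //; apply: le_trans h _; apply: (ler_wpM2l t0); exact: e_le_ch.
Qed.

Lemma e_le_ch_mul a b a' b' t : 0 <= t -> ch a b <= t * ch a' b' ->
  e a b <= C ^+ 2 * t `^ k * e a' b'.
Proof.
move=> t0 h.
have c0 := @chord_ge0 _ _ _ alpha hyp a b; have c0' := @chord_ge0 _ _ _ alpha hyp a' b'.
apply: le_trans (e_le_ch a b) _.
have -> : C ^+ 2 * t `^ k * e a' b' = C * (t `^ k * (C * e a' b')) by ring.
rewrite ler_pM2l //; apply: le_trans (powR_le (ltW k0) c0 h) _.
by rewrite powRM //; apply: (ler_wpM2l (powR_ge0 _ _)); exact: ch_le_e.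
Qed.

Let v0 x : 0 < vn x := @vnorm_gt0 _ _ _ alpha x.
Let v1 x : 1 <= vn x := @vnorm_ge1 _ _ _ alpha x.

Lemma vnorm_le x y : vn y <= vn x + D x y.
Proof.
have d0 := @Dmet_ge0 _ _ _ alpha x y.
rewrite {1}/vnorm ge_max; apply/andP; split.
  by apply: le_trans (v1 x) _; rewrite lerDl.
apply: le_trans (@Dmet_triangle _ _ _ alpha hyp x _ _) _; rewrite lerD2r.
by rewrite le_max lexx orbT.
Qed.

(** In the ratio of the chords from x the factor [vnorm] x cancels, leaving [vnorm] z / [vnorm] y <=
    B. *)
Lemma Dmet_le_e B : 1 <= B -> exists2 t, 0 <= t & forall x y z,
  vn z <= B -> D x y <= D x z -> e (Some x) (Some y) <= t * e (Some x) (Some z).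
Proof.
move=> B1; exists (C ^+ 2 * B `^ k); first by rewrite mulr_ge0 ?powR_ge0 // exprn_ge0 // ltW.
move=> x y z zB h; apply: e_le_ch_mul; first exact: le_trans B1.
rewrite /chord mulrA ler_pdivrMr ?mulr_gt0 //.
have -> : B * D x z / (vn x * vn z) * (vn x * vn y) = D x z * (B / vn z) * vn y.
  by field; rewrite !gt_eqF.
apply: le_trans h _; apply: le_trans (_ : D x z * (B / vn z) <= _); last first.
  by rewrite ler_peMr // mulr_ge0 ?Dmet_ge0 // divr_ge0 ?(le_trans _ B1) // ltW.
by rewrite ler_peMr ?Dmet_ge0 // ler_pdivlMr // mul1r.
Qed.

Lemma e_le_Dmet B t : 1 <= B -> 0 <= t -> exists2 c, 1 <= c & forall x y z,
  vn y <= B -> e (Some x) (Some y) <= t * e (Some x) (Some z) -> D x y <= c * D x z.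
Proof.
move=> B1 t0; pose q := (C ^+ 2 * t) `^ k^-1.
have q0 : 0 <= q by exact: powR_ge0.
exists (q * B + 1); first by rewrite lerDr mulr_ge0 // (le_trans _ B1).
move=> x y z yB h; have d0 := @Dmet_ge0 _ _ _ alpha x z.
have := ch_le_e_mul t0 h; rewrite -/q /chord ler_pdivrMr ?mulr_gt0 //.
have -> : q * (D x z / (vn x * vn z)) * (vn x * vn y) = q * D x z * (vn y / vn z).
  by field; rewrite !gt_eqF.
move=> /le_trans; apply; rewrite mulrDl mul1r.
apply: (@le_trans _ _ (q * D x z * B)); last by rewrite mulrAC lerDl.
apply: (ler_wpM2l (mulr_ge0 q0 d0)); apply: le_trans yB.
by rewrite ler_pdivrMr // ler_peMr // ltW.
Qed.

Lemma Dmet_small x s : 0 < s -> exists2 c, 0 < c & forall y,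
  D x y <= c -> e (Some x) (Some y) < s.
Proof.
move=> s0; pose c := (s / (2 * C)) `^ k^-1.
have q0 : 0 < s / (2 * C) by rewrite divr_gt0 // mulr_gt0.
exists c => [|y h]; first exact: powR_gt0.
apply: le_lt_trans (e_le_ch _ _) _.
have hc : ch (Some x) (Some y) <= c.
  apply: le_trans h; rewrite /chord ler_pdivrMr ?mulr_gt0 // ler_peMr ?Dmet_ge0 //.
  by rewrite mulr_ege1.
have := powR_le (ltW k0) (@chord_ge0 _ _ _ alpha hyp _ _) hc.
rewrite /c powRVK ?(ltW q0) // => /(ler_wpM2l (ltW C0))/le_lt_trans; apply.
have -> : C * (s / (2 * C)) = s / 2 by field; rewrite gt_eqF.
by rewrite ltr_pdivrMr // ltr_pMr // ltr1n.
Qed.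

(** The chord is divided by [vnorm] y, which is at most [vnorm] x + D x y; h is so small that half
    of D x y absorbs the contribution of D x y. *)
Lemma e_small x s : 0 < s -> exists2 c, 0 < c & forall y,
  e (Some x) (Some y) < c -> D x y <= s.
Proof.
have arith (h n d m : R) : d <= h * (n * m) -> m <= n + d -> 0 <= d -> 0 < n -> 0 < h ->
   h * n <= 1 / 2 -> h * n * n <= s / 2 -> d <= s.
  move=> h1 h2 h3 h4 h5 h6 h7.
  have p1 : h * n * m <= h * n * (n + d) by rewrite ler_wpM2l // ltW // mulr_gt0.
  have p2 : h * n * d <= 1 / 2 * d by rewrite ler_wpM2r.
  by rewrite mulrDr in p1; rewrite mulrA in h1; clear h2 h3 h4 h5 h6; lra.
move=> s0; pose h := Num.min (1 / 2 / vn x) (s / 2 / (vn x * vn x)).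
have h0 : 0 < h by rewrite lt_min !divr_gt0 // mulr_gt0.
have h1 : h * vn x <= 1 / 2 by rewrite -ler_pdivlMr // ge_min lexx.
have h2 : h * vn x * vn x <= s / 2.
  by rewrite -mulrA -ler_pdivlMr ?mulr_gt0 // ge_min lexx orbT.
exists (h `^ k / C) => [|y hy]; first by rewrite divr_gt0 // powR_gt0.
have hc : ch (Some x) (Some y) <= h.
  rewrite -[leRHS](@powRK _ h k) ?(ltW h0) //.
  apply: powR_le_root; rewrite ?powR_ge0 ?chord_ge0 //.
  apply: le_trans (ch_le_e _ _) _; rewrite mulrC -ler_pdivlMr //; exact: ltW.
move: hc; rewrite /chord ler_pdivrMr ?mulr_gt0 // => hc.
exact: (arith _ _ _ _ hc (vnorm_le x y) (Dmet_ge0 _ _) (v0 x) h0 h1 h2).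
Qed.

Lemma vnorm_bounded s : 0 < s -> exists2 B, 1 <= B & forall y,
  s <= e None (Some y) -> vn y <= B.
Proof.
move=> s0; have q0 : 0 < C / s by rewrite divr_gt0.
exists ((C / s) `^ k^-1 + 1) => [|y h]; first by rewrite lerDr powR_ge0.
apply: le_trans (_ : _ <= (C / s) `^ k^-1) _; last by rewrite lerDl.
apply: powR_le_root; rewrite ?(ltW q0) ?(ltW (v0 y)) //.
have := le_trans h (e_le_ch _ _); rewrite /chord /= => h'.
rewrite ler_pdivlMr // mulrC -ler_pdivlMr ?powR_gt0 //.
apply: le_trans h' _; rewrite -powR_inv1 ?(ltW (v0 y)) // powRAC powR_inv1 ?powR_ge0 //.
Qed.

Lemma far_from_None B : 1 <= B -> exists2 c, 0 < c & forall y, vn y <= B ->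
  c <= e None (Some y).
Proof.
move=> B1; have B0 : 0 < B by exact: lt_le_trans B1.
exists (B^-1 `^ k / C) => [|y yB]; first by rewrite divr_gt0 // powR_gt0 // invr_gt0.
have /andP[h _] := ech None (Some y); apply: le_trans h.
rewrite ler_pM2r ?invr_gt0 //; apply: powR_le; rewrite ?(ltW k0) ?invr_ge0 ?(ltW B0) //.
by rewrite lef_pV2 ?posrE.
Qed.

Lemma far_from_Some x s B : 0 < s -> 1 <= B -> exists2 c, 0 < c & forall y,
  s <= D x y -> vn y <= B -> c <= e (Some x) (Some y).
Proof.
move=> s0 B1; have B0 : 0 < B by exact: lt_le_trans B1.
have q0 : 0 < s / (vn x * B) by rewrite divr_gt0 // mulr_gt0.
exists ((s / (vn x * B)) `^ k / C) => [|y sy yB]; first by rewrite divr_gt0 // powR_gt0.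
have /andP[h _] := ech (Some x) (Some y); apply: le_trans h.
rewrite ler_pM2r ?invr_gt0 //; apply: powR_le; rewrite ?(ltW k0) ?(ltW q0) //.
apply: ler_pM; rewrite ?(ltW s0) ?invr_ge0 ?mulr_ge0 ?(ltW B0) ?(ltW (v0 x)) //.
by rewrite lef_pV2 ?posrE ?mulr_gt0 // ler_pM2l.
Qed.

Lemma vnorm_tube p b l th z : (b < ns 0)%N -> @tube R r ns alpha p b l th z ->
  vn z <= vn p + (l + th).
Proof.
move=> bn [t [/andP[t0 tl] tz]]; apply: le_trans (vnorm_le p z) _; rewrite lerD2l.
apply: le_trans (@Dmet_triangle _ _ _ alpha hyp (shift 0 b t p) _ _) _; apply: lerD => //.
by rewrite Dmet_shift0 // ger0_norm.
Qed.

Definition econt F := forall a s, 0 < s -> exists2 c, 0 < c &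
  forall b, e a b < c -> e (F a) (F b) < s.

(** The value 0 is a placeholder where F (Some x) is xi_0; [fin_partE] excludes that case. *)
Definition fin_part F x : V := odflt zero (F (Some x)).

Section Transport.
Variables (F G : X -> X).
Hypotheses (FK : cancel F G) (GK : cancel G F) (Fc : econt F) (Gc : econt G)
  (Fq : weak_qs e F).

Lemma fin_partE x : G None <> Some x -> F (Some x) = Some (fin_part F x).
Proof.
move=> h; rewrite /fin_part; case E: (F (Some x)) => [y|] //.
by case: h; rewrite -E FK.
Qed.

(** The tube keeps away from the preimage of xi_0. Continuity of G at xi_0 keeps the image away from
    xi_0, hence bounded, and on bounded sets weak quasisymmetry passes between e and D. *)
Lemma segment_image p b (l th c : R) : (b < ns 0)%N -> 0 < l -> 0 < th -> 0 < c ->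
  (forall z, @tube R r ns alpha p b l th z -> c <= e (G None) (Some z)) ->
  same_leaf (fin_part F p) (fin_part F (shift 0 b l p)).
Proof.
move=> bn l0 th0 c0 far.
have tubeF z : @tube R r ns alpha p b l th z -> F (Some z) = Some (fin_part F z).
  move=> /far h; apply: fin_partE => E; move: h.
  by rewrite E (iffRL (e_eq0 _ _) erefl) leNgt c0.
have B1 : 1 <= vn p + (l + th).
  by apply: le_trans (v1 p) _; rewrite lerDl addr_ge0 // ltW.
have tubeB z : @tube R r ns alpha p b l th z -> vn z <= vn p + (l + th) := vnorm_tube bn.
have [dl dl0 hdl] := Gc None c0.
have [B B1' hB] := vnorm_bounded dl0.
have tubeB' z : @tube R r ns alpha p b l th z -> vn (fin_part F z) <= B.
  move=> hz; apply: hB; rewrite -tubeF //; rewrite leNgt; apply/negP => /hdl.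
  by rewrite FK ltNge far.
have [t t0 ht] := Dmet_le_e B1.
have [c' c'1 hc'] := Fq t0.
have [H H1 hH] := e_le_Dmet B1' (le_trans ler01 c'1).
have cont q : (forall z, D q z <= th -> @tube R r ns alpha p b l th z) ->
    forall s, 0 < s -> exists2 s', 0 < s' & forall z, D q z <= s' ->
      D (fin_part F q) (fin_part F z) <= s.
  move=> hq s s0.
  have [s1 s10 h1] := e_small (fin_part F q) s0.
  have [s2 s20 h2] := Fc (Some q) s10.
  have [s3 s30 h3] := Dmet_small q s20.
  exists (Num.min th s3) => [|z]; first by rewrite lt_min th0.
  rewrite le_min => /andP[z1 z3]; apply: h1.
  have tq : @tube R r ns alpha p b l th q by apply: hq; rewrite Dmet_refl ltW.
  by rewrite -!tubeF //; [apply: h2; exact: h3|exact: hq].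
apply: (@segment_same_leaf _ _ _ _ hyp (fin_part F) p b l th H B) => //.
- exact: lt_le_trans B1'.
- by move=> z hz; apply: le_trans (tubeB' z hz); rewrite le_max lexx orbT.
- move=> x y z hx hy hz xyz; apply: hH; first exact: tubeB'.
  rewrite -!tubeF //; apply: hc'; apply: ht => //; exact: tubeB.
- move=> x y hx hy E; have : F (Some x) = F (Some y) by rewrite !tubeF // E.
  by move=> /(can_inj FK)[].
- apply: cont => z hz; exists 0; rewrite lexx (ltW l0) shift0; split => //.
- apply: cont => z hz; exists l; rewrite lexx (ltW l0); split => //.
Qed.

End Transport.

(** The coordinates of the first block are changed one at a time; a negative shift is a positive one
    read backwards. *)
Lemma leaf_path (Q : V -> V -> Prop) x : (forall u, Q u u) ->
  (forall u v, Q u v -> Q v u) -> (forall u v w, Q u v -> Q v w -> Q u w) ->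
  (forall u b l, same_leaf x u -> (b < ns 0)%N -> 0 < l -> Q u (shift 0 b l u)) ->
  forall y, same_leaf x y -> Q x y.
Proof.
move=> Qr Qs Qt Qstep y xy.
pose z m : V := fun i j => if ((i : nat) == 0%N) && (j < m)%N then y i j else x i j.
have zx m : same_leaf x (z m).
  by move=> i ip; apply/funext => j; rewrite /z gtn_eqF.
have Qst u b l : same_leaf x u -> (b < ns 0)%N -> Q u (shift 0 b l u).
  move=> xu bn; have [l0|l0|<-] := ltgtP 0 l; last by rewrite shift0.
    exact: Qstep.
  apply: Qs; have -> : u = shift 0 b (- l) (shift 0 b l u).
    by rewrite shift_shift addrN shift0.
  have E : shift 0 b l (shift 0 b (- l) (shift 0 b l u)) = shift 0 b l u.
    by rewrite shift_shift addNr shift0.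
  rewrite E; apply: Qstep => //; last by rewrite oppr_gt0.
  exact: same_leaf_trans xu (same_leaf_shift0 _ _ _).
have Qz m : (m <= ns 0)%N -> Q x (z m).
  elim: m => [_|m IH mn].
    have -> : z 0%N = x by apply: vecP => i j; rewrite /z ltn0 andbF.
    exact: Qr.
  apply: Qt (IH (ltnW mn)) _.
  pose block0' := @block0 _ _ _ _ hyp.
  pose jm : 'I_(ns block0') := Ordinal mn.
  have -> : z m.+1 = shift 0 m (y block0' jm - x block0' jm) (z m).
    apply: vecP => i j; rewrite /z /shift.
    have [i00|] := eqVneq (i : nat) 0%N; last by rewrite addr0.
    rewrite /= ltnS leq_eqVlt; have [jm'|jm'] := eqVneq (j : nat) m.
      rewrite jm' ltnn /=.
      have ei : i = block0' by apply: val_inj.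
      by subst i; have -> : j = jm; [apply: val_inj|rewrite addrC subrK].
    by rewrite /= addr0.
  exact: (Qst _ _ _ (zx m) mn).
have -> : y = z (ns 0); last exact: Qz.
apply: vecP => i j; rewrite /z; have [i00|] := eqVneq (i : nat) 0%N.
  by have -> : (j < ns 0)%N by rewrite -i00.
by rewrite -lt0n => ip; rewrite (xy i ip).
Qed.

Lemma same_leaf_closed (u a : V) : (forall s, 0 < s -> exists2 w, same_leaf u w &
  e (Some a) (Some w) < s) -> same_leaf u a.
Proof.
move=> h i ip; apply/funext => j; apply/eqP; rewrite -subr_eq0 -normr_le0.
apply/ler_addgt0Pr => s s0; rewrite add0r.
have w0 := @weight_gt0 _ _ _ alpha hyp i.
have [c c0 hc] := e_small a (powR_gt0 (weight alpha i)^-1 s0).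
have [w uw /hc hw] := h c c0; rewrite uw // distrC.
apply: le_trans (coord_le_blocknorm _ _ _) _.
have := @blocknorm_le_of_Dmet _ _ _ _ hyp _ _ i _ hw.
by rewrite powRVK ?(ltW s0) // gt_eqF.
Qed.

(** Every leaf has xi_0 in its closure: t makes [vnorm] at least 1 / q, where q is the chord that
    keeps e at most s / 2. *)
Lemma near_None b x s : (b < ns 0)%N -> 0 < s -> exists t, e None (Some (shift 0 b t x)) < s.
Proof.
move=> bn s0; pose q := (s / (2 * C)) `^ k^-1.
have q0 : 0 < s / (2 * C) by rewrite divr_gt0 // mulr_gt0.
have qq : 0 < q by exact: powR_gt0.
pose t := q^-1 + D zero x; exists t.
have t0 : 0 <= t by rewrite addr_ge0 ?Dmet_ge0 // invr_ge0 ltW.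
have vt : q^-1 <= vn (shift 0 b t x).
  apply: le_trans (_ : D zero (shift 0 b t x) <= _); last by rewrite le_max lexx orbT.
  have := @Dmet_triangle _ _ _ alpha hyp zero x (shift 0 b t x).
  by rewrite Dmet_shift0 // ger0_norm // [D x zero]DmetC [leRHS]addrC lerD2r.
apply: le_lt_trans (e_le_ch _ _) _.
have hc : ch None (Some (shift 0 b t x)) <= q.
  by rewrite /chord -[leRHS]invrK lef_pV2 ?posrE ?invr_gt0.
have := powR_le (ltW k0) (@chord_ge0 _ _ _ alpha hyp _ _) hc.
rewrite /q powRVK ?(ltW q0) // => /(ler_wpM2l (ltW C0))/le_lt_trans; apply.
have -> : C * (s / (2 * C)) = s / 2 by field; rewrite gt_eqF.
by rewrite ltr_pdivrMr // ltr_pMr // ltr1n.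
Qed.

Lemma off_leaf_not_same s x : 0 < s -> ~ same_leaf x (off_leaf (alpha := alpha) s x).
Proof.
move=> s0 h; have := @off_leaf_far _ _ _ alpha hyp x x x s (ltW s0) (fun i _ => erefl)
  (same_leaf_sym h).
by rewrite Dmet_refl leNgt s0.
Qed.

(** Coordinate [j] of block [i] is constant along the axis of the tube, which bounds the distance
    from w to the axis below. *)
Lemma tube_far w x b l th z : @tube R r ns alpha x b l th z -> forall (i : 'I_r) (j : 'I_(ns i)), (0 < i)%N ->
  `|w i j - x i j| `^ (weight alpha i)^-1 - th <= D w z.
Proof.
move=> [t [_ tz]] i j ip.
have w0 := @weight_gt0 _ _ _ alpha hyp i.
rewrite lerBlDr; apply: le_trans (_ : _ <= D w (shift 0 b t x)) _.
  apply: (@le_Dmet_of_coord _ _ _ _ hyp _ _ _ i j); first exact: powR_ge0.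
  rewrite powRVK ?gt_eqF // /shift gtn_eqF //= addr0 //.
apply: le_trans (@Dmet_triangle _ _ _ alpha hyp z _ _) _.
by rewrite lerD2l DmetC.
Qed.

Let b0 : (0 < ns 0)%N.
Proof. by apply: (@block_gt0 _ _ _ _ hyp); apply: ltnW; exact: (@blocks_ge2 _ _ _ _ hyp). Qed.

Lemma not_same_leaf x y : ~ same_leaf x y ->
  exists (i : 'I_r) (j : 'I_(ns i)), (0 < i)%N /\ x i j <> y i j.
Proof.
move=> h; apply: contrapT => h2; apply: h => i ip; apply/funext => j.
by apply: contrapT => h3; apply: h2; exists i, j.
Qed.

(* A leaf that avoids [b := G None] is mapped into one leaf, which contains
   [a := F None] in its closure; so F maps all those leaves into the leaf of [a]. *)
Lemma fix_None F G : cancel F G -> cancel G F -> econt F -> econt G -> weak_qs e F ->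
  F None = None.
Proof.
move=> FK GK Fc Gc Fq; case Fa: (F None) => [a|] //; exfalso.
have [b Gb] : exists b, G None = Some b.
  case E: (G None) => [b|]; first by exists b.
  by have := GK None; rewrite E Fa.
have fE x : ~ same_leaf b x -> F (Some x) = Some (fin_part F x).
  move=> bx; apply: (fin_partE FK); rewrite Gb => -[bE]; apply: bx.
  by rewrite bE.
have leaf x y : ~ same_leaf b x -> same_leaf x y ->
    same_leaf (fin_part F x) (fin_part F y).
  move=> bx; apply: (@leaf_path (fun u v => same_leaf (fin_part F u) (fin_part F v)) x).
  - by move=> u i _.
  - by move=> u v; exact: same_leaf_sym.
  - by move=> u v w; exact: same_leaf_trans.
  move=> u c l xu cn l0.
  have bu : ~ same_leaf b u.
    by move=> h; apply: bx; exact: same_leaf_trans h (same_leaf_sym xu).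
  have [i [j [ip ne]]] := not_same_leaf bu.
  pose g := `|b i j - u i j| `^ (weight alpha i)^-1.
  have g0 : 0 < g by apply: powR_gt0; rewrite normr_gt0 subr_eq0; exact/eqP.
  have th0 : 0 < g / 2 by rewrite divr_gt0.
  have B1 : 1 <= vn u + (l + g / 2).
    by apply: le_trans (v1 u) _; rewrite lerDl addr_ge0 // ltW.
  have [c' c'0 hc'] := far_from_Some b th0 B1.
  apply: (segment_image FK Fc Gc Fq cn l0 th0 c'0) => z hz; rewrite Gb; apply: hc'.
    have := tube_far b hz j ip; rewrite -/g; apply: le_trans.
    by rewrite {2}[g]splitr addrK.
  exact: vnorm_tube hz.
have near x : ~ same_leaf b x -> same_leaf (fin_part F x) a.
  move=> bx; apply: same_leaf_closed => s s0.
  have [c c0 hc] := Fc None s s0; have [t ht] := near_None x b0 c0.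
  have xt := @same_leaf_shift0 _ _ _ 0 t x.
  exists (fin_part F (shift 0 0 t x)); first exact: leaf.
  rewrite -fE; first by rewrite -Fa; exact: hc.
  by move=> h; apply: bx; exact: same_leaf_trans h (same_leaf_sym xt).
(* By [near], the preimage z of a point w off the leaf of [a] must lie in the leaf of [b]; but z is
   a limit of points off that leaf, whose images lie in the closed leaf of [a]. *)
pose w := off_leaf (alpha := alpha) 1 a.
have aw : ~ same_leaf a w by exact: off_leaf_not_same.
case Gw: (G (Some w)) => [z|]; last first.
  have : F None = Some w by rewrite -Gw GK.
  by rewrite Fa => -[E]; apply: aw; rewrite -E.
have Fz : F (Some z) = Some w by rewrite -Gw GK.
have [bz|bz] := pselect (same_leaf b z); last first.
  apply: aw; apply: same_leaf_sym; have := near z bz.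
  by rewrite /fin_part Fz.
apply: aw; apply: same_leaf_closed => s s0.
have [c c0 hc] := Fc (Some z) s s0; have [c' c'0 hc'] := Dmet_small z c0.
have bu : ~ same_leaf b (off_leaf (alpha := alpha) c' z).
  move=> h; apply: (off_leaf_not_same (x := z) c'0).
  exact: same_leaf_trans (same_leaf_sym bz) h.
exists (fin_part F (off_leaf (alpha := alpha) c' z)); first exact: same_leaf_sym (near _ bu).
rewrite -fE // -Fz; apply: hc; apply: hc'.
by rewrite Dmet_off_leaf // ltW.
Qed.

(** As G fixes xi_0, every tube, being bounded, keeps away from its preimage. *)
Lemma fin_leafwise F G : cancel F G -> econt F -> econt G -> weak_qs e F ->
  G None = None -> leafwise (fin_part F).
Proof.
move=> FK Fc Gc Fq GN x y.
apply: (@leaf_path (fun u v => same_leaf (fin_part F u) (fin_part F v)) x).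
- by move=> u i _.
- by move=> u v; exact: same_leaf_sym.
- by move=> u v w; exact: same_leaf_trans.
move=> u c l xu cn l0.
have B1 : 1 <= vn u + (l + 1).
  by apply: le_trans (v1 u) _; rewrite lerDl addr_ge0 // ltW.
have [c' c'0 hc'] := far_from_None B1.
apply: (segment_image FK Fc Gc Fq cn l0 ltr01 c'0) => z hz; rewrite GN; apply: hc'.
exact: vnorm_tube hz.
Qed.

Lemma e_prod_le a b a' b' t : 0 <= t -> ch a b * ch a' b' <= t * (ch a a' * ch b b') ->
  e a b * e a' b' <= C ^+ 4 * t `^ k * (e a a' * e b b').
Proof.
move=> t0 h.
have c0 u v : 0 <= ch u v := @chord_ge0 _ _ _ alpha hyp u v.
have p0 u v : 0 <= ch u v `^ k := powR_ge0 _ _.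
apply: le_trans (ler_pM (e_ge0 _ _) (e_ge0 _ _) (e_le_ch a b) (e_le_ch a' b')) _.
have -> : C * ch a b `^ k * (C * ch a' b' `^ k) = C ^+ 2 * (ch a b * ch a' b') `^ k.
  by rewrite powRM //; ring.
have -> : C ^+ 4 * t `^ k * (e a a' * e b b') = C ^+ 2 * (t `^ k * ((C * e a a') * (C * e b b'))).
  by ring.
apply: (ler_wpM2l (exprn_ge0 2 (ltW C0))).
apply: le_trans (powR_le (ltW k0) (mulr_ge0 (c0 _ _) (c0 _ _)) h) _.
rewrite (powRM _ t0 (mulr_ge0 (c0 _ _) (c0 _ _))) (powRM _ (c0 a a') (c0 b b')).
apply: (ler_wpM2l (powR_ge0 _ _)).
exact: ler_pM (p0 _ _) (p0 _ _) (ch_le_e _ _) (ch_le_e _ _).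
Qed.

Lemma ch_prod_le a b a' b' t : 0 <= t -> e a b * e a' b' <= t * (e a a' * e b b') ->
  ch a b * ch a' b' <= (C ^+ 4 * t) `^ k^-1 * (ch a a' * ch b b').
Proof.
move=> t0 h.
have c0 u v : 0 <= ch u v := @chord_ge0 _ _ _ alpha hyp u v.
have p0 u v : 0 <= ch u v `^ k := powR_ge0 _ _.
have Ct : 0 <= C ^+ 4 * t by rewrite mulr_ge0 // exprn_ge0 // ltW.
have m0 := mulr_ge0 (c0 a a') (c0 b b').
rewrite -[X in _ <= _ * X](powRK m0 kn0) -(powRM _ Ct (powR_ge0 _ _)).
apply: powR_le_root.
- exact: mulr_ge0 (c0 _ _) (c0 _ _).
- exact: mulr_ge0 Ct (powR_ge0 _ _).
rewrite (powRM _ (c0 a b) (c0 a' b')) (powRM _ (c0 a a') (c0 b b')).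
apply: le_trans (ler_pM (p0 _ _) (p0 _ _) (ch_le_e a b) (ch_le_e a' b')) _.
have -> : C * e a b * (C * e a' b') = C ^+ 2 * (e a b * e a' b') by ring.
have -> : C ^+ 4 * t * (ch a a' `^ k * ch b b' `^ k) =
   C ^+ 2 * (t * ((C * ch a a' `^ k) * (C * ch b b' `^ k))) by ring.
apply: (ler_wpM2l (exprn_ge0 2 (ltW C0))); apply: le_trans h _.
apply: (ler_wpM2l t0).
exact: ler_pM (e_ge0 _ _) (e_ge0 _ _) (e_le_ch _ _) (e_le_ch _ _).
Qed.

(** With xi_0 as fourth point the cross-ratio of chords is a ratio of values of D, as the factors
    [vnorm] cancel. *)
Lemma chord_cross x y z t :
  (ch (Some x) (Some y) * ch (Some z) None <=
     t * (ch (Some x) (Some z) * ch (Some y) None)) = (D x y <= t * D x z).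
Proof.
pose q := (vn x * vn y * vn z)^-1.
have q0 : 0 < q by rewrite invr_gt0 !mulr_gt0.
have -> : ch (Some x) (Some y) * ch (Some z) None = D x y * q.
  by rewrite /chord /q; field; rewrite !gt_eqF.
have -> : t * (ch (Some x) (Some z) * ch (Some y) None) = t * D x z * q.
  by rewrite /chord /q; field; rewrite !gt_eqF.
by rewrite ler_pM2r.
Qed.

(** F controls cross-ratios; taking the fixed point xi_0 as fourth point turns this into control of
    ratios of D. *)
Lemma fin_controlled F : F None = None -> (forall x, F (Some x) = Some (fin_part F x)) ->
  weak_qs e F -> forall t, 0 <= t -> exists2 c, 1 <= c & controlled (alpha := alpha) (fin_part F) t c.
Proof.
move=> FN FS Fq t t0.
have s0 : 0 <= C ^+ 4 * t `^ k by rewrite mulr_ge0 ?powR_ge0 // exprn_ge0 // ltW.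
have [c c1 hc] := cross_ratio_control e_ge0 eC e_triangle Fq s0.
pose q := (C ^+ 4 * c) `^ k^-1; have q0 : 0 <= q := powR_ge0 _ _.
exists (q + 1); first by rewrite lerDr.
move=> x y z; rewrite -chord_cross => /(e_prod_le t0)/hc; rewrite FN !FS.
move=> /(ch_prod_le (le_trans ler01 c1)); rewrite -/q chord_cross => /le_trans; apply.
by rewrite mulrDl mul1r lerDl Dmet_ge0.
Qed.

Lemma qs_bilipschitz F G : cancel F G -> cancel G F -> econt F -> econt G ->
  weak_qs e F -> weak_qs e G ->
  F None = None /\ (forall x, F (Some x) = Some (fin_part F x)) /\
  exists2 L, 1 <= L & forall x y,
    D x y / L <= D (fin_part F x) (fin_part F y) <= L * D x y.
Proof.
move=> FK GK Fc Gc Fq Gq.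
have FN := fix_None FK GK Fc Gc Fq; have GN := fix_None GK FK Gc Fc Gq.
have FS x : F (Some x) = Some (fin_part F x) by apply: (fin_partE FK); rewrite GN.
have GS x : G (Some x) = Some (fin_part G x) by apply: (fin_partE GK); rewrite FN.
split => //; split => //.
have fK : cancel (fin_part F) (fin_part G).
  by move=> x; apply: Some_inj; rewrite -GS -FS FK.
have gK : cancel (fin_part G) (fin_part F).
  by move=> x; apply: Some_inj; rewrite -FS -GS GK.
apply: (bilipschitz fK gK).
- exact: fin_leafwise FK Fc Gc Fq GN.
- exact: fin_leafwise GK Gc Fc Gq FN.
- exact: fin_controlled FN FS Fq.
- exact: fin_controlled GN GS Gq.
Qed.

End Core.

(** * Coordinates on the boundary *)

Section Transfer.
Context {R : realType} {r : nat} {ns : nat -> nat} {alpha : nat -> R}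
        {hyp : block_data r ns alpha}.
Local Notation V := (vec R r ns).
Local Notation B := (bnd R r ns alpha).

(** With two different limits, the quotient peak / (N N) would eventually be at least chord / 8 and
    at most chord / 16. *)
Lemma lim_unique (a b : option V) (s : nat -> pt R r ns) :
  lim_to (alpha := alpha) a s -> lim_to (alpha := alpha) b s -> a = b.
Proof.
move=> ha hb; apply: contrapT => ab.
have [K hK] := @peak_chord _ _ _ alpha hyp _ _ _ _ ab ha hb.
have c0 := @chord_gt0 _ _ _ alpha hyp _ _ ab.
have [|K' hK'] := lim_vanish ha ha (e := chord alpha a b / 16); first by rewrite divr_gt0.
set m := maxn K K'.
have := hK' m m (leq_maxr _ _) (leq_maxr _ _).
have /andP[+ _] := hK m m (leq_maxl _ _) (leq_maxl _ _).
set N2 := _ * peak _ _ _; have N0 : 0 < N2 by rewrite mulr_gt0 ?peak_gt0.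
rewrite ler_pdivlMr // => h1 h2; have := le_trans h1 h2; rewrite ler_pM2r //.
by apply/negP; rewrite -ltNge ltr_pM2l // ltf_pV2 ?posrE // ltr_nat.
Qed.

Variables (d : B -> B -> R) (hd : visual_metric d).

Lemma bpoint_inj : injective (@bpoint R r ns alpha hyp).
Proof.
move=> a b E; have [k [C [k0 C1 hC]]] := visual_chord hd.
apply: contrapT => ab; have c0 := @chord_gt0 _ _ _ alpha hyp _ _ ab.
have [[_ [d0 _]] _] := hd.
have /andP[+ _] := hC a b; rewrite E (iffRL (d0 _ _) erefl) leNgt.
by rewrite divr_gt0 ?powR_gt0 // (lt_le_trans _ C1).
Qed.

Definition bcoord (xi : B) : option V := sval (cid (@bpoint_surj _ _ _ _ hyp xi)).

Lemma bcoordK : cancel bcoord (@bpoint R r ns alpha hyp).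
Proof. by move=> xi; rewrite -(svalP (cid (@bpoint_surj _ _ _ _ hyp xi))). Qed.

Lemma bpointK : cancel (@bpoint R r ns alpha hyp) bcoord.
Proof. by move=> a; apply: bpoint_inj; rewrite bcoordK. Qed.

Lemma ident_bpoint x xi : ident x xi -> xi = bpoint (Some x).
Proof.
move=> h; have [a E] := bpoint_surj xi; rewrite E in h *; congr bpoint.
apply: (@lim_unique _ _ (model_seq (Some x))); last exact: model_seq_lim.
by apply/seq_to_bpoint.
Qed.

End Transfer.

(** * Weak quasisymmetry of a quasisymmetric map and of its inverse *)

Section WeakQs.
Variables (R : realType) (T : Type) (d : T -> T -> R).
Hypothesis hm : is_metric d.

Lemma metric_gt0 x y : x <> y -> 0 < d x y.
Proof.
have [d0 [dE _]] := hm.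
by move=> h; rewrite lt0r d0 andbT; apply/eqP => /dE.
Qed.

Lemma qs_control_le (eta : R -> R) s t : qs_control eta -> 0 <= s -> s <= t -> eta s <= eta t.
Proof.
move=> [_ [inc _]] s0; rewrite le_eqVlt => /orP[/eqP->//|st].
by apply/ltW/inc => //; rewrite inE /= in_itv /= andbT // (le_trans s0) // ltW.
Qed.

Lemma weak_qs_distinct (F : T -> T) t c x y z : 1 <= c -> 0 <= t ->
  d x y <= t * d x z ->
  (x <> y -> x <> z -> y <> z -> d (F x) (F y) <= c * d (F x) (F z)) ->
  d (F x) (F y) <= c * d (F x) (F z).
Proof.
have [d0 [dE _]] := hm.
move=> c1 t0 h H.
have [xy|xy] := pselect (x = y).
  by rewrite xy (iffRL (dE _ _) erefl) mulr_ge0 ?d0 // (le_trans _ c1).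
have [yz|yz] := pselect (y = z).
  by rewrite yz ler_peMl ?d0.
have [xz|xz] := pselect (x = z).
  case: xy; apply/dE/eqP; rewrite eq_le d0 andbT; apply: le_trans h _.
  by rewrite xz (iffRL (dE _ _) erefl) mulr0.
exact: H.
Qed.

Lemma quasisymmetric_weak_qs F : injective F -> quasisymmetric d F -> weak_qs d F.
Proof.
move=> FI [eta [ceta hF]] t t0.
have m1 : 1 <= Num.max 1 (eta t) by rewrite le_max lexx.
exists (Num.max 1 (eta t)) => // x y z h; apply: (weak_qs_distinct m1 t0 h) => xy xz yz.
have p0 := metric_gt0 xz.
have P0 : 0 < d (F x) (F z) by apply: metric_gt0 => /FI.
have := hF x y z xy xz yz; rewrite ler_pdivrMr // => /le_trans; apply.
rewrite ler_pM2r // le_max; apply/orP; right; apply: qs_control_le => //.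
  by rewrite divr_ge0 // ?(ltW p0) // ltW // metric_gt0.
by rewrite ler_pdivrMr.
Qed.

(** Choose u > 0 with eta u = 1 / (2 (t + 1)) and c = max (1, 1 / u). If the bound failed, the ratio
    of d (G x) (G z) to d (G x) (G y) would be at most u, so that d x y >= 2 (t + 1) d x z > t d x
    z. *)
Lemma quasisymmetric_inv_weak_qs F G : cancel F G -> cancel G F ->
  quasisymmetric d F -> weak_qs d G.
Proof.
move=> FK GK [eta [ceta hF]] t t0.
have t2 : t < 2 * (t + 1) by lra.
have t1 : 0 < 2 * (t + 1) by rewrite mulr_gt0 // ltr_wpDl.
have [e0 [_ [_ sur]]] := ceta.
have [|u u0 hu] := sur (2 * (t + 1))^-1; first by rewrite invr_ge0 ltW.
have up : 0 < u.
  rewrite lt0r u0 andbT; apply/eqP => E; move: hu; rewrite E e0 => /esym/eqP.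
  by rewrite invr_eq0 gt_eqF.
have m1 : 1 <= Num.max 1 u^-1 by rewrite le_max lexx.
exists (Num.max 1 u^-1) => // x y z h; apply: (weak_qs_distinct m1 t0 h) => xy xz yz.
rewrite leNgt; apply/negP => hlt.
have Gxy : G x <> G y by move=> /(can_inj GK).
have Gxz : G x <> G z by move=> /(can_inj GK).
have Gzy : G z <> G y by move=> /(can_inj GK)/esym.
have p0 := metric_gt0 Gxy; have q0 := metric_gt0 Gxz.
have := hF (G x) (G z) (G y) Gxz Gxy Gzy; rewrite !GK.
have : eta (d (G x) (G z) / d (G x) (G y)) <= eta u.
  apply: qs_control_le => //; first by rewrite divr_ge0 // ltW.
  rewrite ler_pdivrMr // -ler_pdivrMl //; apply: le_trans (ltW hlt).
  by rewrite ler_pM2r // le_max lexx orbT.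
rewrite hu => h1 h2; have := le_trans h2 h1.
have xyp := metric_gt0 xy; have xzp := metric_gt0 xz.
rewrite ler_pdivrMr // mulrC ler_pdivlMr // => h3.
have := le_trans h3 h; rewrite mulrC ler_pM2r // => h4.
by move: h4; rewrite leNgt t2.
Qed.

End WeakQs.

(** * Transport of the bilipschitz estimate to the boundary *)

Theorem theorem1p1 (R : realType) (r : nat) (ns : nat -> nat) (alpha : nat -> R)
  (hr : (2 <= r)%N)
  (hns : forall i : nat, (i < r)%N -> (0 < ns i)%N)
  (ha0 : 0 < alpha 0%N)
  (hinc : forall i : nat, (i.+1 < r)%N -> alpha i < alpha i.+1)
  (d : bnd R r ns alpha -> bnd R r ns alpha -> R) (hd : visual_metric d)
  (F : bnd R r ns alpha -> bnd R r ns alpha)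
  (hF : homeo d F) (hqs : quasisymmetric d F) :
  exists xi0 : bnd R r ns alpha, is_xi0 xi0 /\
    F @` [set xi | xi <> xi0] = [set xi | xi <> xi0] /\
    exists L : R, 1 <= L /\
      forall (x y x' y' : vec R r ns) (xi eta : bnd R r ns alpha),
        ident x xi -> ident y eta -> ident x' (F xi) -> ident y' (F eta) ->
        Dmet alpha x y / L <= Dmet alpha x' y' /\
        Dmet alpha x' y' <= L * Dmet alpha x y.
Proof.
have hyp : block_data r ns alpha by constructor.
have [k [C [k0 C1 hC]]] := visual_chord hd.
have hm := hd.1; have [d0 [dE [dC dT]]] := hm.
have [G [FK [GK [Fc Gc]]]] := hF.
(* [p] and [q] identify the boundary with [option V]; the metric, F and its inverse are transported
   along them. *)
pose p := @bpoint R r ns alpha hyp; pose q := @bcoord R r ns alpha hyp.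
have qK : cancel q p := bcoordK (hyp := hyp).
have pK : cancel p q := bpointK hd (hyp := hyp).
pose e a b := d (p a) (p b).
pose F' a := q (F (p a)); pose G' a := q (G (p a)).
have FK' : cancel F' G' by move=> a; rewrite /F' /G' qK FK pK.
have GK' : cancel G' F' by move=> a; rewrite /F' /G' qK GK pK.
have cont H (H' := fun a => q (H (p a))) : mcont d H -> econt e H'.
  move=> Hc a s /(Hc (p a))[c c0 hc]; exists c => // b /hc.
  by rewrite /e /H' !qK.
have wqs H (H' := fun a => q (H (p a))) : weak_qs d H -> weak_qs e H'.
  move=> Hq t /Hq[c c1 hc]; exists c => // x y z /hc.
  by rewrite /e /H' !qK.
have e_ge0 a b : 0 <= e a b by exact: d0.
have eC a b : e a b = e b a by exact: dC.
have e_triangle b a c : e a c <= e a b + e b c by exact: dT.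
have e_eq0 a b : e a b = 0 <-> a = b.
  by rewrite dE; split => [/(can_inj pK)|->].
have Fq := wqs F (quasisymmetric_weak_qs hm (can_inj FK) hqs).
have Gq := wqs G (quasisymmetric_inv_weak_qs hm FK GK hqs).
have [FN [FS [L L1 hL]]] := qs_bilipschitz e_ge0 eC e_triangle e_eq0 k0 C1 hC FK' GK'
  (cont F Fc) (cont G Gc) Fq Gq.
have Fxi0 : F (p None) = p None by rewrite -[LHS]qK -/(F' None) FN.
exists (p None); split.
  by apply/seq_to_bpoint; exact: model_seq_lim.
split.
  apply/seteqP; split => [_ [xi h <-]|xi h].
    by move=> E; apply: h; apply: (can_inj FK); rewrite E Fxi0.
  exists (G xi); last exact: GK.
  by move=> E; apply: h; rewrite -[xi]GK E Fxi0.
exists L; split => // x y x' y' xi eta /(ident_bpoint (hyp := hyp)) -> /(ident_bpoint (hyp := hyp)) ->.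
have img z z' : ident z' (F (p (Some z))) -> z' = fin_part F' z.
  move=> /(ident_bpoint (hyp := hyp)) E; apply: Some_inj.
  by rewrite -FS /F' E pK.
by move=> /img -> /img ->; have /andP[] := hL x y.
Qed.
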